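(* Let $\mathcal{L}\subseteq\mathrm{Lin}$ be nonempty and downward $\preceq$-closed. Then the relations $\trianglelefteq^{\mathcal{L}}_{\mathrm{LO}}$ and $\underline{\bowtie}^{\mathcal{L}}_{\mathrm{LO}}$ are $\boldsymbol{\Sigma}^1_1$-hard. Therefore, if $\mathcal{L}$ is Borel, then $\trianglelefteq^{\mathcal{L}}_{\mathrm{LO}}$ and $\underline{\bowtie}^{\mathcal{L}}_{\mathrm{LO}}$ are complete analytic (as subsets of $\mathrm{LO}\times\mathrm{LO}$); if instead $\mathcal{L}$ is proper coanalytic and ccs, then they are neither analytic nor coanalytic (that is, their complexity is at least $\boldsymbol{\Delta}^1_2$).
   Context: Linear orders are reflexive and nonempty. $L\preceq L'$ means there is an embedding $f:L\to L'$, i.e. $x\le_L y\iff f(x)\le_{L'}f(y)$. $\mathrm{LO}\subseteq 2^{\mathbb{N}\times\mathbb{N}}$ is the (closed, hence Polish) set of codes for linear orders with domain $\mathbb{N}$; $\mathrm{Fin}\subseteq 2^{\mathbb{N}\times\mathbb{N}}$ is the set of codes for nonempty linear orders on finite subsets of $\mathbb{N}$; $\mathrm{Lin}=\mathrm{Fin}\cup\mathrm{LO}$ is a standard Borel space. A class $\mathcal{L}\subseteq\mathrm{Lin}$ is downward $\preceq$-closed if $K\in\mathrm{Lin}$ and $K\preceq L\in\mathcal{L}$ imply $K\in\mathcal{L}$; membership in $\mathcal{L}$ is meant up to isomorphism. A subset $I$ of a linear order $L$ is convex if $x\le_L y\le_L z$ and $x,z\in I$ imply $y\in I$. For $A,B\subseteq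 L$ write $A\le_L B$ (resp. $A<_L B$) if $a\le_L b$ (resp. $a<_L b$) for all $a\in A$, $b\in B$. A $K$-convex partition of $L$ is a partition $(L_k)_{k\in K}$ of $L$ (into nonempty sets) such that $k<_K k'\iff L_k<_L L_{k'}$. The relation $L\trianglelefteq^{\mathcal{L}}L'$ holds iff there are $K\in\mathcal{L}$, a $K$-convex partition $(L_k)_{k\in K}$ of $L$, and an embedding $f$ of $L$ into $L'$ such that $f(L_k)$ is a convex subset of $L'$ for every $k\in K$. $\trianglelefteq^{\mathcal{L}}_{\mathrm{LO}}$ is its restriction to $\mathrm{LO}$, and $L\mathrel{\underline{\bowtie}^{\mathcal{L}}_{\mathrm{LO}}}L'$ iff $L\trianglelefteq^{\mathcal{L}}_{\mathrm{LO}}L'$ and $L'\trianglelefteq^{\mathcal{L}}_{\mathrm{LO}}L$. $\mathcal{L}$ is ccs (closed under convex sums) if for all $K,K'\in\mathcal{L}$ and every family $(K'_k)_{k\in K}$ of nonempty convex subsets of $K'$ such that $k_0<_K k_1\Rightarrow K'_{k_0}\le_{K'}K'_{k_1}$, we have $\sum_{k\in K}K'_k\in\mathcal{L}$, where $\sum_{k\in K}K'_k=\{(x,k): k\in K, x\in K'_k\}$ ordered antilexicographically. Hardness and completeness are in the sense of Wadge (continuous) reducibility: $A\subseteq X$ is $\boldsymbol{\Sigma}^1_1$-hard if every $\boldsymbol{\Sigma}^1_1$ subset of a zero-dimensional Polish space is a continuous preimage of $A$; complete analytic means analytic and $\boldsymbol{\Sigma}^1_1$-hard. Proper coanalytic means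 coanalytic but not analytic (as a subset of $\mathrm{Lin}$). *)

(* Defs.v *)
From HB Require Import structures.
From mathcomp Require Import all_boot all_order all_algebra.
From mathcomp Require Import all_classical all_reals all_analysis.

Set Implicit Arguments.
Unset Strict Implicit.
Unset Printing Implicit Defensive.

Import Order.TTheory GRing.Theory Num.Theory.
Local Open Scope classical_set_scope.
Local Open Scope ring_scope.

Section descriptive.
Context (R : realType).

Definition is_metric (T : Type) (d : T -> T -> R) : Prop :=
  [/\ forall x y, 0 <= d x y,
      forall x y, d x y = 0 <-> x = y,
      forall x y, d x y = d y x &
      forall x y z, d x z <= d x y + d y z].

Definition metric_complete (T : Type) (d : T -> T -> R) : Prop :=
  forall u : nat -> T,
    (forall e, 0 < e -> exists N, forall m n,
        (N <= m)%N -> (N <= n)%N -> d (u m) (u n) < e) ->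
    exists l, forall e, 0 < e -> exists N, forall n,
        (N <= n)%N -> d (u n) l < e.

Definition completely_metrizable (T : topologicalType) : Prop :=
  exists d : T -> T -> R,
    [/\ is_metric d,
        forall (x : T) (A : set T),
          nbhs x A <-> exists2 e, 0 < e & [set y | d x y < e] `<=` A &
        metric_complete d].

Definition polish (T : topologicalType) : Prop :=
  (exists2 D : set T, countable D & dense D) /\ completely_metrizable T.

(* The library's [zero_dimensional] only asks that clopen sets separate points,
   which is weaker than having a basis of clopen sets. *)
Definition clopen_basis (T : topologicalType) : Prop :=
  forall (x : T) (A : set T), nbhs x A -> exists U, [/\ clopen U, U x & U `<=` A].

(* When X is a Borel subset of a Polish space, with the subspace topology, these
   are the analytic and coanalytic subsets of the standard Borel space X. The
   empty Polish space is allowed, so that the empty set is analytic. *)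
Definition analytic (X : topologicalType) (A : set X) : Prop :=
  exists (P : topologicalType) (f : P -> X),
    [/\ polish P, continuous f & A = range f].

Definition coanalytic (X : topologicalType) (A : set X) : Prop :=
  analytic (~` A).

Definition proper_coanalytic (X : topologicalType) (A : set X) : Prop :=
  coanalytic A /\ ~ analytic A.

Definition wadge_reducible (X Y : topologicalType) (A : set X) (B : set Y) :
  Prop := exists2 f : X -> Y, continuous f & A = f @^-1` B.

Definition analytic_hard (X : topologicalType) (B : set X) : Prop :=
  forall (Z : topologicalType) (A : set Z),
    polish Z -> clopen_basis Z -> analytic A -> wadge_reducible A B.

Definition complete_analytic (X : topologicalType) (B : set X) : Prop :=
  analytic B /\ analytic_hard B.

End descriptive.

Definition borel (X : topologicalType) (A : set X) : Prop := <<s @open X >> A.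

Definition lo_code : Type := prod_topology (fun _ : nat * nat => bool).

HB.instance Definition _ := Pointed.on lo_code.
HB.instance Definition _ := Nbhs.on lo_code.
HB.instance Definition _ := Topological.on lo_code.

(* Coded orders are reflexive, so the domain is read off the diagonal. *)
Definition dom (c : lo_code) : Type := {n : nat | c (n, n)}.

Definition ole (c : lo_code) (x y : dom c) : bool := c (val x, val y).

Definition olt (c : lo_code) (x y : dom c) : bool := ole x y && (val x != val y).

Definition linear_order_code (c : lo_code) : Prop :=
  [/\ exists n, c (n, n),
      forall m n, c (m, n) -> c (m, m) && c (n, n),
      antisymmetric (@ole c), transitive (@ole c) & total (@ole c)].

Definition Fin : set lo_code :=
  [set c | linear_order_code c /\ finite_set [set n | c (n, n)]].

Definition LO : set lo_code :=
  [set c | linear_order_code c /\ forall n, c (n, n)].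

Definition Lin : set lo_code := Fin `|` LO.

Definition embedding (K L : lo_code) (f : dom K -> dom L) : Prop :=
  forall x y, ole x y <-> ole (f x) (f y).

Definition embeds (K L : lo_code) : Prop := exists f : dom K -> dom L, embedding f.

Definition downward_closed (C : set Lin) : Prop :=
  forall K L : Lin, C L -> embeds (val K) (val L) -> C K.

Definition convex_subset (L : lo_code) (I : set (dom L)) : Prop :=
  forall x y z, ole x y -> ole y z -> I x -> I z -> I y.

Definition set_le (L : lo_code) (A B : set (dom L)) : Prop :=
  forall a b, A a -> B b -> ole a b.

Definition set_lt (L : lo_code) (A B : set (dom L)) : Prop :=
  forall a b, A a -> B b -> olt a b.

Definition convex_partition (K L : lo_code) (P : dom K -> set (dom L)) : Prop :=
  [/\ forall k, P k !=set0,
      \bigcup_k P k = setT,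
      forall k k', k <> k' -> P k `&` P k' = set0 &
      forall k k', olt k k' <-> set_lt (P k) (P k')].

Definition piecewise_convex_embeds (C : set Lin) (L L' : lo_code) : Prop :=
  exists2 K : Lin, C K &
  exists (P : dom (val K) -> set (dom L)) (f : dom L -> dom L'),
    [/\ convex_partition P, embedding f & forall k, convex_subset (f @` P k)].

Definition pce_LO (C : set Lin) : set (LO * LO) :=
  [set p | piecewise_convex_embeds C (val p.1) (val p.2)].

Definition bi_pce_LO (C : set Lin) : set (LO * LO) :=
  [set p | pce_LO C (p.1, p.2) /\ pce_LO C (p.2, p.1)].

Definition csum (K K' : lo_code) (F : dom K -> set (dom K')) : Type :=
  {k : dom K & set_type (F k)}.

Definition csum_le (K K' : lo_code) (F : dom K -> set (dom K')) (p q : csum F) :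
  Prop :=
  olt (tag p) (tag q) \/
  (tag p = tag q /\ ole (val (tagged p)) (val (tagged q))).

(* A convex sum is not itself a code: it belongs to C up to isomorphism. *)
Definition ccs (C : set Lin) : Prop :=
  forall (K K' : Lin) (F : dom (val K) -> set (dom (val K'))),
    C K -> C K' ->
    (forall k, F k !=set0 /\ convex_subset (F k)) ->
    (forall k0 k1, olt k0 k1 -> set_le (F k0) (F k1)) ->
    exists2 S : Lin, C S &
    exists2 g : dom (val S) -> csum F,
      bijective g & forall x y, ole x y <-> csum_le (g x) (g y).

(* Main.v *)
Require Import Defs.
From HB Require Import structures.
From mathcomp Require Import all_boot all_order all_algebra.
From mathcomp Require Import all_classical all_reals all_analysis.
From mathcomp Require Import lra.

(** A nonempty downward closed class contains the one-point order, so the relation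
    of piecewise convex embeddability lies between convex embeddability and
    embeddability.

    Hardness. An analytic set of sequences [w] of bits consists of those [w] for
    which a tree depending continuously on [w] is ill-founded ([ill_extends]). To
    this tree is attached, still continuously, an order [L] that is a well-order
    when the tree is well-founded ([W_fin]), and isomorphic to its double [L + L]
    when it is ill-founded ([ill_doubling]). A well-order does not contain its
    double, and [L] is an initial segment of its double, so that the pair formed by
    [L + L] and [L] reduces the analytic set to the relation and to its symmetric
    part, whatever the class ([double_pce], [pce_double]).

    The nodes used to define [L] are finite sequences of nodes of the tree. A child
    of a node replaces all entries by successors in the tree and appends an
    arbitrary sequence. The rank of a node is the least rank of its entries, hence
    all well-founded nodes reappear, with their rank, below every ill-founded one.
    The order of a node is a point followed by the sum over [omega] of the orders of
    its children, each repeated infinitely often. Call two points equivalent when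
    the interval between them is well-ordered. In the ill-founded case, following
    the leftmost path through ill-founded nodes from any point, one meets without
    leaving its class a copy of the order of any well-founded node; this is
    arranged by the enumeration of children, which at depth [k] interleaves those
    that append the [k]-th sequence ([absorb]). Hence well-ordered intervals embed in
    all classes ([absorbed_between]), and the classes are isomorphic to a single
    well-order [W] ([wellorder_iso]). Classes are densely ordered with a first and
    no last one, so by Cantor's theorem [L] is [W] times [1 + eta], which is
    isomorphic to its double ([self_doubling]).

    Completeness. The spaces of codes embed in Cantor space, and their analytic
    subsets are the traces of projections of closed subsets of the product of Cantor
    and Baire space ([analytic_souslin], [souslin_analytic]). These traces are stable
    under countable unions and intersections and continuous preimages, and contain
    the Borel sets ([souslin_borel]). The relation is defined by an existential
    quantification over a member of the class and over functions on the naturals,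
    followed by a closed condition ([pce_souslin]).

    Lower bounds. Let [S] be the rationals with every point replaced by a copy of
    [omega + 1], and let [Y] be the initial segment of [S] below the top of one of
    these copies. For an order [K], let [A] be [K] with every point replaced by a
    copy of [Y]. If [K] is in the class, then the partition of [A] in copies of [Y]
    shows that [A] is below [S] ([blocks_embed]); and [S] is always isomorphic to a
    convex subset of [Y] ([first_block_embed]). Conversely, if [A] is below [S] by a
    partition indexed by a member of the class, each piece meets only one copy of [Y]
    ([piece_one_block]), so [K] embeds in this member. Thus the infinite orders of the
    class form a continuous preimage of both relations ([class_reduction]), which are
    therefore not analytic when the class is not. If they were coanalytic, then the
    complement of the class, which is analytic and so reduces to them by hardness,
    would be coanalytic, and the class analytic ([not_coanalytic]). *)

Set Implicit Arguments.
Unset Strict Implicit.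
Unset Printing Implicit Defensive.

Local Open Scope classical_set_scope.

(** * Strict linear orders and Cantor's theorem *)

Definition strict_total (T : Type) (lt : T -> T -> Prop) : Prop :=
  [/\ forall x, ~ lt x x, forall y x z, lt x y -> lt y z -> lt x z &
      forall x y, lt x y \/ x = y \/ lt y x].

Definition dense_lt (T : Type) (lt : T -> T -> Prop) : Prop :=
  forall x y, lt x y -> exists2 z, lt x z & lt z y.

Definition unbounded_above (T : Type) (lt : T -> T -> Prop) : Prop :=
  forall x, exists y, lt x y.

Definition unbounded_below (T : Type) (lt : T -> T -> Prop) : Prop :=
  forall x, exists y, lt y x.

Lemma strict_total_flip T (lt : T -> T -> Prop) :
  strict_total lt -> strict_total (fun x y => lt y x).
Proof.
move=> [irr tr tot]; split=> // [y x z xy yz|x y]; first exact: tr yz xy.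
by have [|[->|]] := tot x y; [right; right|right; left|left].
Qed.

(** The lexicographic order, the first coordinate being the most significant. *)
Definition lex (A B : Type) (ltA : A -> A -> Prop) (ltB : B -> B -> Prop)
  (p q : A * B) : Prop := ltA p.1 q.1 \/ p.1 = q.1 /\ ltB p.2 q.2.

Lemma strict_total_lex A B (ltA : A -> A -> Prop) (ltB : B -> B -> Prop) :
  strict_total ltA -> strict_total ltB -> strict_total (lex ltA ltB).
Proof.
move=> [iA tA cA] [iB tB cB]; split.
- by move=> [a b] [/iA//|[_ /iB]].
- move=> [a' b'] [a b] [a'' b''] [/= h|/= [<- h]] [/= k|/= [e k]].
  + by left; apply: tA h k.
  + by left; rewrite -e.
  + by left.
  + by right; split=> //; apply: tB h k.
- move=> [a b] [a' b']; have [h|[->|h]] := cA a a'; first by left; left.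
    have [h|[->|h]] := cB b b'; first by left; right.
      by right; left.
    by right; right; right.
  by right; right; left.
Qed.

(** The two-point order, [false] being below [true]. *)
Definition ltB (a b : bool) : Prop := ~~ a && b.

Lemma ltB_total : strict_total ltB.
Proof. by split=> [[]|[] [] []|[] []]//; rewrite /ltB /=; intuition. Qed.

Section ListBounds.
Context (T : eqType) (lt : T -> T -> Prop).
Hypothesis tot : strict_total lt.

Lemma seq_max (s : seq T) : s <> [::] ->
  exists2 m, m \in s & forall x, x \in s -> x = m \/ lt x m.
Proof.
case: tot => irr tr tri; elim: s => // a s IH _.
have [->|/eqP s0] := eqVneq s [::].
  by exists a => [|x]; rewrite !inE//; move=> /eqP; left.
have [m ms hm] := IH s0; have [am|ma] : lt a m \/ (a = m \/ lt m a) by exact: tri.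
  by exists m => [|x]; rewrite inE ?ms ?orbT//; move=> /orP[/eqP->|/hm//]; right.
exists a; first by rewrite inE eqxx.
move=> x; rewrite inE => /orP[/eqP->|/hm]; first by left.
case: ma => [->//|ma] [->|xm]; first by right.
by right; apply: tr xm ma.
Qed.

End ListBounds.

Lemma seq_between (T : eqType) (lt : T -> T -> Prop) (A B : seq T) :
  strict_total lt -> dense_lt lt -> unbounded_above lt ->
  A <> [::] \/ unbounded_below lt -> inhabited T ->
  (forall a b, a \in A -> b \in B -> lt a b) ->
  exists u, (forall a, a \in A -> lt a u) /\ (forall b, b \in B -> lt u b).
Proof.
move=> tot dn ub lb [t0] AB; have [irr tr _] := tot.
have [A0|/eqP A0] := eqVneq A [::].
  rewrite {}A0 in AB lb *; case: lb => // lb.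
  have [->|/eqP B0] := eqVneq B [::]; first by exists t0.
  have [m mB hm] := seq_max (strict_total_flip tot) B0.
  have [u um] := lb m; exists u; split=> // b /hm[->//|]; exact: tr um.
have [a aA ha] := seq_max tot A0.
have [B0|/eqP B0] := eqVneq B [::].
  have [u au] := ub a; exists u; rewrite B0; split=> // b /ha[->//|h].
  exact: tr h au.
have [b bB hb] := seq_max (strict_total_flip tot) B0.
have [u au ub'] := dn _ _ (AB _ _ aA bB).
exists u; split=> [x /ha[->//|h]|x /hb[->//|h]]; first exact: tr h au.
exact: tr ub' h.
Qed.

(** Order isomorphisms. Injectivity is not required: between strict total orders
    it follows from the first condition. *)
Definition order_iso (T U : Type) (ltT : T -> T -> Prop) (ltU : U -> U -> Prop)
  (f : T -> U) : Prop :=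
  (forall x y, ltT x y <-> ltU (f x) (f y)) /\ (forall u, exists t, f t = u).

Section BackAndForth.
Context (T U : eqType) (ltT : T -> T -> Prop) (ltU : U -> U -> Prop).
Context (cT : T -> nat) (cU : U -> nat).
Hypotheses (cTI : injective cT) (cUI : injective cU).

(** The back-and-forth construction, for an arbitrary family [good] of finite
    partial isomorphisms with the extension property on both sides. *)
Lemma back_and_forth (good : seq (T * U) -> Prop) (s0 : seq (T * U)) :
  good s0 ->
  (forall s p q, good s -> p \in s -> q \in s ->
     ltT p.1 q.1 <-> ltU p.2 q.2) ->
  (forall s p q, good s -> p \in s -> q \in s -> p.1 = q.1 -> p.2 = q.2) ->
  (forall s t, good s -> exists u, good ((t, u) :: s)) ->
  (forall s u, good s -> exists t, good ((t, u) :: s)) ->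
  exists f, order_iso ltT ltU f.
Proof.
move=> g0 gmono gfun forth back.
pose G := {s | good s}.
have step (p : G * nat) : exists s' : G, [/\ {subset sval p.1 <= sval s'},
    forall t, cT t = p.2 -> exists u, (t, u) \in sval s' &
    forall u, cU u = p.2 -> exists t, (t, u) \in sval s'].
  case: p => -[s gs] n /=.
  have [s1 [gs1 ss1 h1]] : exists s1, [/\ good s1, {subset s <= s1} &
      forall t, cT t = n -> exists u, (t, u) \in s1].
    have [[t tn]|nt] := pselect (exists t, cT t = n); last first.
      by exists s; split=> // t tn; exfalso; apply: nt; exists t.
    have [u gu] := forth _ t gs; exists ((t, u) :: s); split=> //.
      by move=> p ps; rewrite inE ps orbT.
    by move=> t' t'n; exists u; rewrite (cTI (etrans t'n (esym tn))) mem_head.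
  have [[u un]|nu] := pselect (exists u, cU u = n); last first.
    exists (exist _ _ gs1); split=> // u un; exfalso; apply: nu; by exists u.
  have [t gt] := back _ u gs1; exists (exist _ _ gt); split=> /=.
  - by move=> p /ss1 ps; rewrite inE ps orbT.
  - by move=> t' /h1[u' h]; exists u'; rewrite inE h orbT.
  - by move=> u' u'n; exists t; rewrite (cUI (etrans u'n (esym un))) mem_head.
have [F hF] := choice step.
pose S := fix S n : G := if n is n'.+1 then F (S n', n') else exist _ _ g0.
have Ssub m n : (m <= n)%N -> {subset sval (S m) <= sval (S n)}.
  move=> /subnK <-; elim: (n - m)%N => [//|k IH] p /IH ps.
  by rewrite addSn /=; have [h _ _] := hF (S (k + m)%N, (k + m)%N); apply: h.
have hf t : exists u, exists n, (t, u) \in sval (S n).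
  have [_ h _] := hF (S (cT t), cT t); have [u tu] := h _ erefl.
  by exists u, (cT t).+1.
have [f hf'] := choice hf; exists f; split=> [x y|u].
  have [m hm] := hf' x; have [n hn] := hf' y.
  have := gmono _ (x, f x) (y, f y) (svalP (S (maxn m n))).
  by apply; [apply: Ssub hm; rewrite leq_maxl|apply: Ssub hn; rewrite leq_maxr].
have [_ _ h] := hF (S (cU u), cU u); have [t tu] := h _ erefl; exists t.
have [m hm] := hf' t.
apply: (gfun _ (t, f t) (t, u) (svalP (S (maxn m (cU u).+1)))) => //=.
  by apply: Ssub hm; rewrite leq_maxl.
by apply: (Ssub _ _ (leq_maxr m (cU u).+1)); apply: tu.
Qed.

End BackAndForth.

Section Extension.
Context (T U : eqType) (ltT : T -> T -> Prop) (ltU : U -> U -> Prop).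
Hypotheses (totT : strict_total ltT) (totU : strict_total ltU).

(** Finite partial isomorphisms, as lists of pairs. *)
Definition partial_iso (s : seq (T * U)) : Prop :=
  forall p q, p \in s -> q \in s -> ltT p.1 q.1 <-> ltU p.2 q.2.

Lemma partial_iso_fun s p q :
  partial_iso s -> p \in s -> q \in s -> p.1 = q.1 -> p.2 = q.2.
Proof.
move=> is_ ps qs e; case: totT totU => irr _ _ [_ _ tri].
have [/(is_ _ _ ps qs)|[//|/(is_ _ _ qs ps)]] := tri p.2 q.2;
  by rewrite e => /irr.
Qed.

(** A point [t] enters the domain when its cut has a realization: the target has
    no least point, or some point of the domain lies weakly below [t]. *)
Lemma partial_iso_extend s t : partial_iso s ->
  dense_lt ltU -> unbounded_above ltU -> inhabited U ->
  (exists2 p, p \in s & p.1 = t \/ ltT p.1 t) \/ unbounded_below ltU ->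
  exists u, partial_iso ((t, u) :: s).
Proof.
move=> is_ dn ub inh lb; have [irr tr tri] := totT; have [irrU trU triU] := totU.
have [[p ps pt]|nt] := pselect (exists2 p, p \in s & p.1 = t).
  exists p.2; rewrite -pt => q r; rewrite !inE -surjective_pairing.
  by move=> /orP[/eqP->|qs] /orP[/eqP->|rs]; apply: is_.
pose A := [seq p.2 | p <- s & `[< ltT p.1 t >]].
pose B := [seq p.2 | p <- s & `[< ltT t p.1 >]].
have [||u [uA uB]] := @seq_between _ _ A B totU dn ub _ inh.
- case: lb => [[p ps pt]|]; [left|by right].
  have ptt : ltT p.1 t by case: pt => // pt; exfalso; apply: nt; exists p.
  have : p.2 \in A.
    by apply/mapP; exists p => //; rewrite mem_filter ps andbT; apply/asboolP.
  by move=> h A0; move: h; rewrite A0.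
- move=> a b /mapP[p]; rewrite mem_filter => /andP[/asboolP pt ps] ->.
  move=> /mapP[q]; rewrite mem_filter => /andP[/asboolP tq qs] ->.
  by apply/(is_ _ _ ps qs); apply: tr pt tq.
exists u => q r; rewrite !inE => /orP[/eqP->|qs] /orP[/eqP->|rs] /=.
- by split=> [/irr|/irrU].
- have [tr'|[tr'|tr']] := tri t r.1.
  + split=> // _; apply: uB; apply/mapP; exists r => //.
    by rewrite mem_filter rs andbT; apply/asboolP.
  + by exfalso; apply: nt; exists r.
  + split=> [tr2|]; first by case: (irr t); apply: tr tr2 tr'.
    have : ltU r.2 u.
      apply: uA; apply/mapP; exists r => //.
      by rewrite mem_filter rs andbT; apply/asboolP.
    by move=> a b; case: (irrU u); apply: trU b a.
- have [tr'|[tr'|tr']] := tri q.1 t.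
  + split=> // _; apply: uA; apply/mapP; exists q => //.
    by rewrite mem_filter qs andbT; apply/asboolP.
  + by exfalso; apply: nt; exists q.
  + split=> [tr2|]; first by case: (irr t); apply: tr tr' tr2.
    have : ltU u q.2.
      apply: uB; apply/mapP; exists q => //.
      by rewrite mem_filter qs andbT; apply/asboolP.
    by move=> a b; case: (irrU u); apply: trU a b.
- exact: is_.
Qed.

End Extension.

Lemma partial_iso_flip (T U : eqType) ltT ltU (s : seq (T * U)) :
  partial_iso ltT ltU s <->
  partial_iso ltU ltT [seq (p.2, p.1) | p <- s].
Proof.
split=> h p q.
  by move=> /mapP[p' ps ->] /mapP[q' qs ->] /=; apply: iff_sym; apply: h.
move=> ps qs; have := h (p.2, p.1) (q.2, q.1); rewrite /= => h'.
by apply: iff_sym; apply: h'; apply/mapP; [exists p|exists q].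
Qed.

Lemma partial_iso_extend_back (T U : eqType) ltT ltU (s : seq (T * U)) u :
  strict_total ltT -> strict_total ltU -> partial_iso ltT ltU s ->
  dense_lt ltT -> unbounded_above ltT -> inhabited T ->
  (exists2 p, p \in s & p.2 = u \/ ltU p.2 u) \/ unbounded_below ltT ->
  exists t, partial_iso ltT ltU ((t, u) :: s).
Proof.
move=> tT tU /partial_iso_flip is_ dn ub inh lb.
have [|t ht] := partial_iso_extend (t := u) tU tT is_ dn ub inh.
  case: lb => [[p ps pu]|]; [left|by right].
  by exists (p.2, p.1) => //; apply/mapP; exists p.
by exists t; apply/partial_iso_flip.
Qed.

(** Cantor's theorem. *)
Lemma cantor_iso (T U : eqType) (ltT : T -> T -> Prop) (ltU : U -> U -> Prop)
    (cT : T -> nat) (cU : U -> nat) :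
  injective cT -> injective cU -> strict_total ltT -> strict_total ltU ->
  dense_lt ltT -> dense_lt ltU -> unbounded_above ltT -> unbounded_above ltU ->
  unbounded_below ltT -> unbounded_below ltU -> inhabited T -> inhabited U ->
  exists f, order_iso ltT ltU f.
Proof.
move=> iT iU tT tU dT dU aT aU bT bU hT hU.
apply: (back_and_forth iT iU (good := partial_iso ltT ltU) (s0 := [::])) => //.
- by move=> s p q is_; apply: is_.
- by move=> s p q is_; apply: partial_iso_fun is_.
- by move=> s t is_; apply: partial_iso_extend => //; right.
- by move=> s u is_; apply: partial_iso_extend_back => //; right.
Qed.

(** Cantor's theorem for dense orders with a least and no greatest element. *)
Lemma cantor_iso_least (T U : eqType) (ltT : T -> T -> Prop)
    (ltU : U -> U -> Prop) (cT : T -> nat) (cU : U -> nat) (t0 : T) (u0 : U) :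
  injective cT -> injective cU -> strict_total ltT -> strict_total ltU ->
  dense_lt ltT -> dense_lt ltU -> unbounded_above ltT -> unbounded_above ltU ->
  (forall t, t0 = t \/ ltT t0 t) -> (forall u, u0 = u \/ ltU u0 u) ->
  exists f, order_iso ltT ltU f.
Proof.
move=> iT iU tT tU dT dU aT aU bT bU.
apply: (back_and_forth iT iU (s0 := [:: (t0, u0)])
  (good := fun s => partial_iso ltT ltU s /\ (t0, u0) \in s)).
- split; last exact: mem_head.
  move=> p q; rewrite !inE => /eqP-> /eqP-> /=.
  by case: tT tU => iT' _ _ [iU' _ _]; split=> [/iT'|/iU'].
- by move=> s p q [is_ _]; apply: is_.
- by move=> s p q [is_ _]; apply: partial_iso_fun is_.
- move=> s t [is_ s0]; have [||u hu] := partial_iso_extend (t := t) tT tU is_ dU aU _.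
  + by constructor; exact: u0.
  + by left; exists (t0, u0).
  by exists u; split=> //; rewrite inE s0 orbT.
- move=> s u [is_ s0]; have [||t ht] := partial_iso_extend_back (u := u) tT tU is_ dT aT.
  + by constructor; exact: t0.
  + by left; exists (t0, u0).
  by exists t; split=> //; rewrite inE s0 orbT.
Qed.

(** * Well-ordered subsets and their isomorphisms *)

(** [S] is well-founded: its nonempty subsets have minimal elements. *)
Definition wfset (X : Type) (lt : X -> X -> Prop) (S : set X) : Prop :=
  forall A, A `<=` S -> A !=set0 -> exists2 a, A a & forall b, A b -> ~ lt b a.

Lemma wfset_sub X (lt : X -> X -> Prop) (S S' : set X) :
  wfset lt S' -> S `<=` S' -> wfset lt S.
Proof. by move=> w ss A AS; apply: w => x /AS/ss. Qed.

Lemma wfset_subT X (lt : X -> X -> Prop) (S : set X) :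
  wfset lt setT -> wfset lt S.
Proof. by move=> w; apply: (wfset_sub w). Qed.

Lemma wfset1 X (lt : X -> X -> Prop) x : strict_total lt -> wfset lt [set x].
Proof.
move=> [irr _ _] A Ax [a Aa]; exists a => // b Ab.
by rewrite (Ax _ Ab) (Ax _ Aa); apply: irr.
Qed.

Lemma wfsetU X (lt : X -> X -> Prop) (S S' : set X) : strict_total lt ->
  wfset lt S -> wfset lt S' -> wfset lt (S `|` S').
Proof.
move=> [irr tr tri] w w' A AS A0.
have [n1|] := pselect (A `&` S !=set0); last first.
  move=> n1; apply: w' A0 => a Aa; case: (AS _ Aa) => // Sa.
  by exfalso; apply: n1; exists a.
have [n2|] := pselect (A `&` S' !=set0); last first.
  move=> n2; apply: w A0 => a Aa; case: (AS _ Aa) => // Sa.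
  by exfalso; apply: n2; exists a.
have [||a [Aa Sa] ha] := w (A `&` S); first by move=> x [].
  by [].
have [||b [Ab Sb] hb] := w' (A `&` S'); first by move=> x [].
  by [].
have cmp c x : ~ lt c x -> c = x \/ lt x c.
  by case: (tri c x) => [|[|]] //; [left|right].
have [ab|ab] := pselect (lt b a); [exists b => // c Ac cb|exists a => // c Ac ca];
  case: (AS _ Ac) => Sc.
- by apply: (ha c); [split|apply: tr cb ab].
- by apply: (hb c).
- by apply: (ha c).
- case: (cmp _ _ (hb c (conj Ac Sc))) => [e|bc]; first by apply: ab; rewrite -e.
  by apply: ab; apply: tr bc ca.
Qed.

Lemma wfset_Acc X (lt : X -> X -> Prop) (S : set X) x :
  wfset lt S -> S x -> Acc (fun a b => S a /\ lt a b) x.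
Proof.
move=> w Sx; apply: contrapT => nx.
pose A := [set y | S y /\ ~ Acc (fun a b => S a /\ lt a b) y].
have [||a [Sa na] ha] := w A; first by move=> y [].
  by exists x.
apply: na; constructor => b [Sb ba]; apply: contrapT => nb.
by apply: (ha b).
Qed.

(** Comparison of ranks: [rank_le R R' x y] says that the rank of [x] for the
    well-founded relation [R] is at most the rank of [y] for [R']. *)
Inductive rank_le (T T' : Type) (R : T -> T -> Prop) (R' : T' -> T' -> Prop) :
  T -> T' -> Prop :=
| RankLe x y of (forall x1, R x1 x -> exists2 y1, R' y1 y & rank_le R R' x1 y1) :
  rank_le R R' x y.

Lemma rank_leE T T' R R' x y : @rank_le T T' R R' x y ->
  forall x1, R x1 x -> exists2 y1, R' y1 y & rank_le R R' x1 y1.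
Proof. by case. Qed.

Lemma rank_le_trans (T T' T'' : Type) R R' R'' x y z :
  Acc R x -> @rank_le T T' R R' x y -> @rank_le T' T'' R' R'' y z ->
  rank_le R R'' x z.
Proof.
move=> ax; elim: ax y z => {}x _ IH y z hxy hyz.
have xy := rank_leE hxy; have yz := rank_leE hyz.
constructor=> x1 xx1; have [y1 yy1 xy1] := xy _ xx1.
by have [z1 zz1 yz1] := yz _ yy1; exists z1 => //; apply: IH xy1 yz1.
Qed.

Lemma rank_le_total (T T' : Type) R R' x y : Acc R x ->
  @rank_le T T' R R' x y \/ exists2 x1, R x1 x & rank_le R' R y x1.
Proof.
move=> ax; elim: ax y => {}x _ IH y.
have [|nxy] := pselect (rank_le R R' x y); first by left.
right; apply: contrapT => nx; apply: nxy; constructor=> x1 xx1.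
apply: contrapT => n1; apply: nx; exists x1 => //; constructor=> y1 yy1.
have [h|//] := IH _ xx1 y1; exfalso; apply: n1; by exists y1.
Qed.

Lemma rank_le_irr (T : Type) (R : T -> T -> Prop) x x' :
  Acc R x -> R x x' -> ~ rank_le R R x' x.
Proof.
move=> ax; elim: ax x' => {}x _ IH x' xx' h.
by have [y yx] := rank_leE h xx'; apply: IH.
Qed.

(** Two well-ordered sets are isomorphic as soon as the initial segments with
    a last point of each of them embed in the other. *)
Lemma wellorder_iso (X : Type) (lt : X -> X -> Prop) (S S' : set X) :
  strict_total lt -> wfset lt S -> wfset lt S' ->
  (forall x, S x -> exists f : X -> X, forall a, S a -> ~ lt x a ->
     S' (f a) /\ forall b, S b -> lt b a -> lt (f b) (f a)) ->
  (forall x, S' x -> exists f : X -> X, forall a, S' a -> ~ lt x a ->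
     S (f a) /\ forall b, S' b -> lt b a -> lt (f b) (f a)) ->
  exists h : X -> X, [/\ forall x, S x -> S' (h x),
    forall x y, S x -> S y -> lt x y -> lt (h x) (h y) &
    forall y, S' y -> exists2 x, S x & h x = y].
Proof.
move=> [irr tr tri].
pose R (S : set X) a b := S a /\ lt a b.
have main S1 S2 x : wfset lt S1 -> wfset lt S2 -> S1 x ->
    (exists f : X -> X, forall a, S1 a -> ~ lt x a ->
     S2 (f a) /\ forall b, S1 b -> lt b a -> lt (f b) (f a)) ->
    exists y, [/\ S2 y, rank_le (R S1) (R S2) x y & rank_le (R S2) (R S1) y x].
  move=> w1 w2 S1x [f hf].
  have h1 a : Acc (R S1) a -> S1 a -> ~ lt x a -> rank_le (R S1) (R S2) a (f a).
    elim=> {}a _ IH S1a xa; constructor=> b [S1b ba].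
    have xb : ~ lt x b by move=> xb; apply: xa; apply: tr xb ba.
    exists (f b); last by apply: IH => //; split.
    by split; [case: (hf _ S1b xb)|case: (hf _ S1a xa) => _; apply].
  have ax := wfset_Acc w1 S1x.
  have [||y [S2y xy] hy] := w2 [set y | S2 y /\ rank_le (R S1) (R S2) x y].
  - by move=> y [].
  - by exists (f x); split; [case: (hf x S1x (@irr x))|apply: h1].
  exists y; split=> //; constructor=> y1 [S2y1 yy1].
  have [h|[x1 x1x h]] := @rank_le_total _ _ _ (R S2) x y1 ax; last by exists x1.
  by exfalso; apply: (hy y1).
move=> w w' emb emb'.
have exh x : exists y, S x -> [/\ S' y,
    rank_le (R S) (R S') x y & rank_le (R S') (R S) y x].
  have [Sx|nSx] := pselect (S x); last by exists x.
  by have [y hy] := main _ _ _ w w' Sx (emb _ Sx); exists y.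
have [h hh] := choice exh.
have inj x x' y : S x -> S x' -> rank_le (R S') (R S) y x ->
    rank_le (R S) (R S') x' y -> ~ lt x x'.
  move=> Sx Sx' yx x'y xx'; have ax := wfset_Acc w Sx.
  apply: (@rank_le_irr _ (R S) x x' ax); first by split.
  exact: rank_le_trans (wfset_Acc w Sx') x'y yx.
exists h; split=> [x /hh[]//|x x' Sx Sx' xx'|y Sy].
- have [S'h xh hx] := hh _ Sx; have [S'h' xh' hx'] := hh _ Sx'.
  have [//|[e|h'h]] := tri (h x) (h x').
    by exfalso; apply: (inj x x' (h x)) => //; rewrite e.
  exfalso; have [x0 [Sx0 x0x] h'x0] := rank_leE hx (conj S'h' h'h).
  by apply: (inj x0 x' (h x')) => //; apply: tr x0x xx'.
- have [x [Sx yx xy]] := main _ _ _ w' w Sy (emb' _ Sy).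
  exists x => //; have [S'h xh hx] := hh _ Sx.
  have ir a b x1 : S' a -> S' b -> rank_le (R S) (R S') x1 a ->
      rank_le (R S') (R S) b x1 -> ~ lt a b.
    move=> Sa Sb r1 r2 ab; have aa := wfset_Acc w' Sa.
    apply: (@rank_le_irr _ (R S') a b aa); first by split.
    exact: rank_le_trans (wfset_Acc w' Sb) r2 r1.
  have [|[//|]] := tri (h x) y; first by move/(ir _ _ _ S'h Sy xh yx).
  by move/(ir _ _ _ Sy S'h xy hx).
Qed.

(** * Self-doubling orders *)

Section Doubling.
Context (X : choiceType) (lt : X -> X -> Prop) (cX : X -> nat) (r0 : X).
Hypotheses (cXI : injective cX) (tot : strict_total lt).

(** The closed interval from [x] to [y]. *)
Definition between (x y : X) : set X := [set z | ~ lt z x /\ ~ lt y z].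

Local Notation wf := (wfset lt).

Hypothesis least : forall x, ~ lt x r0.
Hypothesis class_least : forall x, exists m, [/\ ~ lt x m, wf (between m x) &
  forall y, lt y m -> ~ wf (between y m)].
Hypothesis class_nomax : forall x, exists2 y, lt x y & ~ wf (between x y).
Hypothesis class_dense : forall x y, lt x y -> ~ wf (between x y) ->
  exists z, [/\ lt x z, lt z y, ~ wf (between x z) & ~ wf (between z y)].
Hypothesis class_absorb : forall x y z, wf (between x y) ->
  exists f : X -> X, forall a, between x y a ->
    [/\ ~ lt (f a) z, wf (between z (f a)) &
        forall b, between x y b -> lt b a -> lt (f b) (f a)].

(** The points that are least in their class, where two points are equivalent
    when the interval between them is well-ordered. *)
Let M : set X := [set m | forall y, lt y m -> ~ wf (between y m)].

Let irr : forall x, ~ lt x x. Proof. by case: tot. Qed.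
Let tr : forall y x z, lt x y -> lt y z -> lt x z. Proof. by case: tot. Qed.
Let tri : forall x y, lt x y \/ x = y \/ lt y x. Proof. by case: tot. Qed.

Let nlt x y : ~ lt x y -> y = x \/ lt y x.
Proof. by move=> h; case: (tri x y) => [|[|]]; [|left|right]. Qed.

Let le_lt_trans x y z : ~ lt y x -> lt y z -> lt x z.
Proof. by move=> /nlt[->//|xy] yz; apply: tr xy yz. Qed.

Let lt_le_trans x y z : lt x y -> ~ lt z y -> lt x z.
Proof. by move=> xy /nlt[<-//|yz]; apply: tr xy yz. Qed.

(** The least point of the class of [x]. *)
Let rep_ex : exists r : X -> X, forall x, [/\ ~ lt x (r x),
  wf (between (r x) x) & M (r x)].
Proof. by have [r hr] := choice class_least; exists r. Qed.

Let r := projT1 (cid rep_ex).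
Let r_le x : ~ lt x (r x). Proof. by case: (projT2 (cid rep_ex) x). Qed.
Let r_wf x : wf (between (r x) x).
Proof. by case: (projT2 (cid rep_ex) x). Qed.
Let r_M x : M (r x). Proof. by case: (projT2 (cid rep_ex) x). Qed.

Let r_mono x y : ~ lt y x -> ~ lt (r y) (r x).
Proof.
move=> xy yx; apply: (r_M yx); apply: (wfset_sub (@r_wf y)) => z [h1 h2]; split=> //.
by move=> yz; apply: xy; apply: (lt_le_trans (lt_le_trans yz h2) (@r_le x)).
Qed.

Let r_uniq x m : M m -> ~ lt x m -> wf (between m x) -> r x = m.
Proof.
move=> Mm mx w; have [h|[//|h]] := tri (r x) m; exfalso.
  apply: (Mm _ h); apply: (wfset_sub (@r_wf x)) => z [h1 h2]; split=> //.
  by move=> xz; apply: mx; apply: (lt_le_trans xz h2).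
apply: (r_M h); apply: (wfset_sub w) => z [h1 h2]; split=> //.
by move=> xz; apply: (@r_le x); apply: (lt_le_trans xz h2).
Qed.

Let M0 : M r0. Proof. by move=> y /least. Qed.

Let ltM (a b : set_type M) := lt (val a) (val b).

Let totM : strict_total ltM.
Proof.
split=> [x|y x z|x y]; [exact: irr|exact: tr|].
by have [|[/val_inj|]] := tri (val x) (val y); [left|right; left|right; right].
Qed.

Let valM (m : set_type M) : M (val m). Proof. by case: m => m /= /set_mem. Qed.

Let mkM x : set_type M := exist _ (r x) (mem_set (@r_M x)).

Let ltM_r (m : set_type M) x : ~ lt x (val m) -> ~ wf (between (val m) x) ->
  ltM m (mkM x).
Proof.
move=> mx nw; have [//|[h|h]] := tri (val m) (r x).
  by case: nw; rewrite h; apply: r_wf.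
case: nw; apply: (wfset_sub (@r_wf x)) => z [h1 h2]; split=> //.
by move=> zx; apply: h1; apply: tr zx h.
Qed.

Let denseM : dense_lt ltM.
Proof.
move=> x y xy; have [z [xz zy nxz nzy]] := class_dense xy (@valM y _ xy).
exists (mkM z); first by apply: ltM_r => // h; apply: irr (tr h xz).
by apply: le_lt_trans zy; apply: r_le.
Qed.

Let ubM : unbounded_above ltM.
Proof.
move=> m; have [y my nw] := class_nomax (val m); exists (mkM y).
by apply: ltM_r => // h; apply: irr (tr h my).
Qed.

Let m0 : set_type M := exist _ r0 (mem_set M0).

Let m0_le m : m0 = m \/ ltM m0 m.
Proof. by have [e|] := nlt (@least (val m)); [left; apply: val_inj|right]. Qed.

(** The order of classes of the doubled order is isomorphic to that of [X]. *)
Let theta_ex : exists th : bool * set_type M -> set_type M,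
  order_iso (lex ltB ltM) ltM th.
Proof.
apply: (@cantor_iso_least _ _ _ _ (fun p => pickle (p.1, cX (val p.2)))
  (fun m => cX (val m)) (false, m0) m0) => //.
- by move=> [a m] [b n] /(pcan_inj pickleK) /= [e1 /cXI/val_inj e2]; rewrite e1 e2.
- by move=> m n /cXI/val_inj.
- exact: (strict_total_lex ltB_total totM).
- move=> [[] m] [b n] [/= h|/= [eb h]]; first by case: b h.
  + by have [p mp pn] := denseM h; exists (true, p); right.
  + case: b h => // _; have [p mp] := ubM m.
    by exists (false, p); [right|left].
  + have [p mp pn] := denseM h.
    by exists (false, p); right.
- by move=> [b m]; have [n mn] := ubM m; exists (b, n); right.
- move=> [[] m]; first by right; left.
  by have [->|h] := m0_le m; [left|right; right].
Qed.

(** The class whose least point is [m]. *)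
Let cls (m : X) : set X := [set x | r x = m].

Let cls_wf m : wf (cls m).
Proof.
move=> A Am [x Ax].
have [||a [Aa ax] ha] := @r_wf x [set y | A y /\ ~ lt x y].
- move=> y [Ay xy]; split=> // yr; apply: (@r_le y).
  by rewrite (Am _ Ay) -(Am _ Ax).
- by exists x; split=> //; apply: irr.
exists a => // b Ab ba; apply: (ha b) => //; split=> // xb.
by apply: ax; apply: tr xb ba.
Qed.

Let cls_iso m m' : M m -> M m' -> exists h : X -> X,
  [/\ forall x, cls m x -> cls m' (h x),
    forall x y, cls m x -> cls m y -> lt x y -> lt (h x) (h y) &
    forall y, cls m' y -> exists2 x, cls m x & h x = y].
Proof.
have emb m1 m2 x : M m1 -> M m2 -> cls m1 x -> exists f : X -> X,
   forall a, cls m1 a -> ~ lt x a ->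
     cls m2 (f a) /\ forall b, cls m1 b -> lt b a -> lt (f b) (f a).
  move=> Mm1 Mm2 xm; have [|f hf] := @class_absorb m1 x m2.
    by rewrite -[m1]xm; exact: @r_wf.
  exists f => a am xa; have amx : between m1 x a.
    by split=> //; rewrite -[m1]am; apply: r_le.
  have [h1 h2 h3] := hf _ amx; split; first exact: r_uniq.
  move=> b bm ba; apply: h3 => //; split; first by rewrite -[m1]bm; apply: r_le.
  by move=> xb; apply: xa; apply: tr xb ba.
move=> Mm Mm'; apply: wellorder_iso => //.
- by move=> x; apply: emb.
- by move=> x; apply: emb.
Qed.

(** A countable order is isomorphic to its double when the relation of being at
    well-ordered distance has a first class, no last class, densely ordered
    classes with least elements, and each class absorbs all well-ordered
    intervals. *)
Lemma self_doubling : exists F : bool * X -> X,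
  (forall p q, lex ltB lt p q -> lt (F p) (F q)) /\ forall y, exists p, F p = y.
Proof.
have [th [thm ths]] := theta_ex.
have hx (p : X * X) : exists h : X -> X, M p.1 -> M p.2 ->
  [/\ forall x, cls p.1 x -> cls p.2 (h x),
    forall x y, cls p.1 x -> cls p.1 y -> lt x y -> lt (h x) (h y) &
    forall y, cls p.2 y -> exists2 x, cls p.1 x & h x = y].
  have [h1|n] := pselect (M p.1 /\ M p.2); last first.
    by exists id => a b; exfalso; apply: n.
  by have [h hh] := cls_iso h1.1 h1.2; exists h.
have [h hh] := choice hx.
pose tt (b : bool) x := th (b, mkM x).
exists (fun p => h (r p.2, val (tt p.1 p.2)) p.2); split; last first.
  move=> y; have [[b m] bm] := ths (mkM y).
  have [_ _ s] := hh (val m, val (mkM y)) (@valM _) (@valM _).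
  have [x xm xy] := s y erefl; exists (b, x) => /=.
  rewrite /tt; have -> : mkM x = m by apply: val_inj.
  by rewrite bm xm.
have key b x : cls (val (tt b x)) (h (r x, val (tt b x)) x).
  by have [k _ _] := hh (r x, val (tt b x)) (@r_M x) (@valM _); apply: k.
have far b x b' x' : ltM (tt b x) (tt b' x') ->
    lt (h (r x, val (tt b x)) x) (h (r x', val (tt b' x')) x').
  move=> l; apply: contrapT => /r_mono; apply.
  by rewrite [r _]key [r (h _ _)]key.
move=> [b x] [b' x'] [/= l|/= [<- l]]; first by apply: far; apply/thm; left.
have [e|l'] : r x = r x' \/ lt (r x) (r x').
- have [|[|h']] := tri (r x) (r x'); [by right|by left|].
  by exfalso; apply: (@r_mono x x') h' => x'x; apply: irr (tr l x'x).
- have e' : tt b x = tt b x' by congr (th (_, _)); apply: val_inj.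
  have [_ k _] := hh (r x, val (tt b x)) (@r_M x) (@valM _).
  by rewrite -e -e'; apply: k.
- by apply: far; apply/thm; right.
Qed.

End Doubling.

(** * The linear order of a countable relation *)

(** An enumeration of [T] that takes each value infinitely often. *)
Definition hit (T : countType) (x0 : T) (n : nat) : T :=
  odflt x0 (unpickle (head 0%N (CodeSeq.decode n))).

Lemma hitP (T : countType) (x0 x : T) N : exists2 n, (N <= n)%N & hit x0 n = x.
Proof.
exists (CodeSeq.code [:: pickle x; N]); last first.
  by rewrite /hit CodeSeq.codeK /= pickleK.
by have /and3P[_ /ltnW] := CodeSeq.ltn_code [:: pickle x; N].
Qed.

Lemma all2_catE (T : Type) (r : T -> T -> bool) (s1 s2 t1 t2 : seq T) :
  all2 r s1 t1 -> all2 r s2 t2 -> all2 r (s1 ++ s2) (t1 ++ t2).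
Proof. by elim: s1 t1 => [|a s1 IH] [|b t1]//= /andP[-> /IH]; apply. Qed.

Section Tree.
Context (N : countType) (E : rel N).

(** [ill a]: an infinite [E]-chain starts at [a]. *)
Definition ill (a : N) : Prop := ~ Acc (fun b a => E a b) a.

(** A node is a finite sequence of elements; its rank is the least rank of its
    entries, so that it is ill-founded when all its entries are. *)
Definition illseq (v : seq N) : Prop := forall a, a \in v -> ill a.

(** [None] stands for a dead node, without children. *)
Definition illnode (s : option (seq N)) : Prop := if s is Some v then illseq v else False.

(** The candidate successors of the entries, and the sequence to append, that are
    coded by the index [n] up to parity; each pair has infinitely many indices. *)
Definition childcode (n : nat) : seq N * option (seq N) :=
  hit ([::], None) n./2.

(** A child of [v] replaces every entry by an [E]-successor and appends an arbitrary
    finite sequence, [None] yielding a dead child. For odd [n] all choices are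
    listed. Even indices have the same successors as the next odd index, but append
    the sequence numbered by the depth [k], so that this sequence is appended before
    the first ill-founded child is met. *)
Definition child (k : nat) (v : seq N) (n : nat) : option (seq N) :=
  let p := childcode n in
  if all2 E v p.1 then omap (cat p.1) (if odd n then p.2 else hit None k)
  else None.

(** The order on the cone of the node [s] at depth [k]. Points are all finite
    sequences of naturals, read as paths of child indices: a path precedes its
    extensions, and paths that differ are ordered by the first difference. Inside
    the cone of a dead node the order is that of the codes, of type [omega]. *)
Fixpoint plt (k : nat) (s : option (seq N)) (a b : seq nat) {struct a} : bool :=
  if s is Some v then
    match a, b with
    | _, [::] => false
    | [::], _ :: _ => true
    | c :: a', d :: b' =>
        (c < d)%N || (c == d) && plt k.+1 (child k v c) a' b'
    end
  else (CodeSeq.code a < CodeSeq.code b)%N.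

Definition ltp k s : seq nat -> seq nat -> Prop := fun a b => plt k s a b.

Lemma pltNone k a b : plt k None a b = (CodeSeq.code a < CodeSeq.code b)%N.
Proof. by case: a. Qed.

Lemma ltp_total k s : strict_total (ltp k s).
Proof.
rewrite /ltp; split.
- move=> a; elim: a k s => [|c a IH] k [v|]; rewrite ?pltNone ?ltnn //.
  by rewrite /= ltnn eqxx; apply: IH.
- move=> b a c; elim: a k s b c => [|x a IH] k [v|] b c;
    rewrite ?pltNone; try exact: ltn_trans.
    by case: b c => [|y b] [|z c].
  case: b c => [|y b] [|z c] //=.
  move=> /orP[xy|/andP[/eqP<- ab]] /orP[yz|/andP[/eqP<- bc]].
  + by rewrite (ltn_trans xy yz).
  + by rewrite xy.
  + by rewrite yz.
  + by rewrite eqxx (IH _ _ _ _ ab bc) orbT.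
- move=> a b; have code_tri c d : CodeSeq.code c < CodeSeq.code d \/ c = d \/
      CodeSeq.code d < CodeSeq.code c.
    have [h|h|/(can_inj CodeSeq.codeK) h] := ltngtP (CodeSeq.code c) (CodeSeq.code d);
      [by left|by right; right|by right; left].
  elim: a k s b => [|x a IH] k [v|] b; rewrite ?pltNone //.
    by case: b => [|y b]; [right; left|left].
  case: b => [|y b] /=; first by right; right.
  have [xy|yx|<-] := ltngtP x y; [by left|by right; right|].
  by have [h|[->|h]] := IH k.+1 (child k v x) b; [left|right; left|right; right].
Qed.

Lemma ltpxx k s a : ~ ltp k s a a. Proof. by case: (ltp_total k s) => + _ _; apply. Qed.

Lemma ltp_trans k s b a c : ltp k s a b -> ltp k s b c -> ltp k s a c.
Proof. by case: (ltp_total k s) => _ + _; apply. Qed.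

Lemma ltp_nil k s a : ~ ltp k s a [::].
Proof. by case: s => [v|]; [case: a|rewrite /ltp pltNone]. Qed.

Lemma ltp_cons k v c a d b : ltp k (Some v) (c :: a) (d :: b) <->
  (c < d)%N \/ c = d /\ ltp k.+1 (child k v c) a b.
Proof.
rewrite /ltp /=; split=> [/orP[|/andP[/eqP e h]]|[->//|[<- ->]]].
- by left.
- by right.
- by rewrite eqxx orbT.
Qed.

Lemma ltp_cons_same k v c a b :
  ltp k (Some v) (c :: a) (c :: b) <-> ltp k.+1 (child k v c) a b.
Proof. by rewrite ltp_cons; split=> [[|[]]|]; rewrite ?ltnn //; right. Qed.

Lemma ltpNcons k v c a d b : ~ ltp k (Some v) (c :: a) (d :: b) ->
  (d < c)%N \/ c = d /\ ~ ltp k.+1 (child k v c) a b.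
Proof.
move=> h; have [cd|dc|e] := ltngtP c d; [|by left|].
  by case: h; apply/ltp_cons; left.
by right; split=> // h'; apply: h; apply/ltp_cons; right.
Qed.

Local Notation W k s := (wfset (ltp k s)).
Local Notation btw k s := (between (ltp k s)).

(** The set [S] transported into the cone of the child of index [e]. *)
Definition pcons (e : nat) (S : set (seq nat)) : set (seq nat) :=
  [set x | exists2 a, S a & x = e :: a].

(** The points lying in the cones of children with index in [I]. *)
Definition cones (I : set nat) : set (seq nat) :=
  [set x | exists e a, I e /\ x = e :: a].

Lemma W_pcons k v e S : W k.+1 (child k v e) S -> W k (Some v) (pcons e S).
Proof.
move=> w A AS [x Ax].
have [||a Aa ha] := w [set a | A (e :: a)].
- by move=> a /AS[b Sb [->]].
- by have [a Sa xe] := AS _ Ax; exists a; rewrite /= -xe.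
- exists (e :: a) => // b Ab; have [b' Sb' be] := AS _ Ab.
  rewrite be => /ltp_cons_same; apply: ha; by rewrite /= -be.
Qed.

Lemma W_cones k v (I : set nat) :
  (forall e, I e -> W k.+1 (child k v e) setT) -> W k (Some v) (cones I).
Proof.
move=> w A AS [x Ax].
have ex : exists e, `[< exists a, A (e :: a) >].
  have [e [a [_ xe]]] := AS _ Ax; exists e; apply/asboolP; exists a.
  by rewrite -xe.
have [e /asboolP[a Aa] he] := ex_minnP ex.
have Ie : I e by have [e' [a' [Ie' [-> _]]]] := AS _ Aa.
have [||b Ab hb] := @W_pcons k v e setT (w _ Ie) [set x | A x /\ exists b, x = e :: b].
- by move=> _ [_ [b ->]]; exists b.
- by exists (e :: a); split=> //; exists a.
- exists b; first by case: Ab.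
  move=> c Ac cb; have [e' [c' [_ ce]]] := AS _ Ac.
  have [_ [b' be]] := Ab.
  have ee' : (e <= e')%N by apply: he; apply/asboolP; exists c'; rewrite -ce.
  move: (cb); rewrite ce be => /ltp_cons[|[e'e _]]; first by rewrite ltnNge ee'.
  by apply: (hb c) => //; split=> //; exists c'; rewrite ce e'e.
Qed.

Lemma W_None k : W k None setT.
Proof.
move=> A _ [x Ax].
have ex : exists n, `[< exists2 a, A a & CodeSeq.code a = n >].
  by exists (CodeSeq.code x); apply/asboolP; exists x.
have [n /asboolP[a Aa an] hn] := ex_minnP ex; exists a => // b Ab.
rewrite /ltp pltNone ltnNge an => /negP; apply; apply: hn.
by apply/asboolP; exists b.
Qed.

Lemma between_cons k v c x y : btw k (Some v) (c :: x) (c :: y) =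
  pcons c (btw k.+1 (child k v c) x y).
Proof.
apply/seteqP; split=> [[|e z] [h1 h2]|_ [z [h1 h2] ->]]; first by case: h1.
  have [h1'|[ee h1']] := ltpNcons h1; have [h2'|[ee' h2']] := ltpNcons h2.
  - by move: (ltn_trans h1' h2'); rewrite ltnn.
  - by rewrite ee' ltnn in h1'.
  - by rewrite ee ltnn in h2'.
  - by exists z; [split; rewrite // -ee|rewrite ee].
by split=> /ltp_cons_same.
Qed.

(** ** Children *)

Lemma all2_mem (v w : seq N) a : all2 E v w -> a \in v ->
  exists2 b, b \in w & E a b.
Proof.
elim: v w => [//|c v IH] [//|d w] /= /andP[cd vw].
rewrite inE => /orP[/eqP->|/(IH _ vw)[b bw ab]].
  by exists d; rewrite // mem_head.
by exists b; rewrite // inE bw orbT.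
Qed.

Lemma ill_step a b : E a b -> ill b -> ill a.
Proof. by move=> ab ib aa; apply: ib; apply: Acc_inv aa _ ab. Qed.

Lemma ill_succ a : ill a -> exists2 b, E a b & ill b.
Proof.
move=> ia; apply: contrapT => nb; apply: ia; constructor => b ab.
by apply: contrapT => ib; apply: nb; exists b.
Qed.

Lemma illseq_succ v : illseq v -> exists2 w, all2 E v w & illseq w.
Proof.
elim: v => [|a v IH] iv; first by exists [::].
have [b ab ib] := ill_succ (iv _ (mem_head _ _)).
have [|w vw iw] := IH; first by move=> c cv; apply: iv; rewrite inE cv orbT.
exists (b :: w); first by rewrite /= ab.
by move=> c; rewrite inE => /orP[/eqP->|/iw].
Qed.

Lemma childP k v n u : child k v n = Some u ->
  exists w m, all2 E v w /\ u = w ++ m.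
Proof.
rewrite /child; case: ifP => // vw.
by case: (X in omap _ X) => //= m [<-]; exists (childcode n).1, m.
Qed.

Lemma child_odd k v w m n0 : all2 E v w ->
  exists2 n, (n0 <= n)%N & child k v n = omap (cat w) m.
Proof.
move=> vw; have [n n0n hn] := hitP ([::], None) (w, m) n0.
exists n.*2.+1; first by apply: leq_trans n0n _; rewrite -addnn; apply/leqW/leq_addr.
by rewrite /child /childcode /= uphalf_double hn vw odd_double.
Qed.

Lemma child_odd_None k v n0 : exists2 n, (n0 <= n)%N & child k v n = None.
Proof.
have [n n0n hn] := hitP ([::], None) ([::] : seq N, None : option (seq N)) n0.
exists n.*2.+1; first by apply: leq_trans n0n _; rewrite -addnn; apply/leqW/leq_addr.
by rewrite /child /childcode /= uphalf_double hn odd_double /=; case: ifP.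
Qed.

Lemma ill_child k v n0 : illseq v ->
  exists2 n, (n0 <= n)%N & illnode (child k v n).
Proof.
move=> iv; have [w vw iw] := illseq_succ iv.
have [n n0n hn] := child_odd k (Some [::]) n0 vw.
by exists n => //; rewrite hn /= cats0.
Qed.

Lemma first_ill_child k v n0 : illseq v -> exists n, [/\ (n0 <= n)%N,
  illnode (child k v n) & forall e, (n0 <= e < n)%N -> ~ illnode (child k v e)].
Proof.
move=> iv; have ex : exists n, (n0 <= n)%N && `[< illnode (child k v n) >].
  by have [n n0n h] := ill_child k n0 iv; exists n; rewrite n0n; apply/asboolP.
have [n /andP[n0n /asboolP h] hn] := ex_minnP ex; exists n; split=> //.
move=> e /andP[n0e en] ie; move: en; rewrite ltnNge => /negP; apply.
by apply: hn; rewrite n0e; apply/asboolP.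
Qed.

(** ** Nodes without infinite chains have well-ordered cones *)

Lemma setT_cones : setT = [set [::]] `|` cones setT.
Proof. by apply/seteqP; split=> // -[|c a] _; [left|right; exists c, a]. Qed.

Lemma W_fin k s : ~ illnode s -> W k s setT.
Proof.
case: s => [v|_]; last exact: W_None.
move=> nv; have [a av aa] : exists2 a, a \in v & Acc (fun b a => E a b) a.
  by apply: contrapT => h; apply: nv => a av aa; apply: h; exists a.
elim: aa k v {nv} av => {}a _ IH k v av; rewrite setT_cones.
apply: (wfsetU (ltp_total _ _)); first exact/wfset1/ltp_total.
apply: W_cones => e _; case ce: child => [u|]; last exact: W_None.
have [w [m [vw ->]]] := childP ce; have [b bw ab] := all2_mem vw av.
by apply: (IH b ab); rewrite mem_cat bw.
Qed.

(** ** Nodes with infinite chains have ill-founded cones *)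

(** Points reached through ill-founded nodes only, and whose last step has an
    ill-founded node to its left. *)
Fixpoint ill_path (k : nat) (v : seq N) (x : seq nat) : Prop :=
  if x is e :: x' then
    if child k v e is Some v' then
      illseq v' /\ (x' = [::] /\ (exists2 e', (e' < e)%N & illnode (child k v e'))
                    \/ ill_path k.+1 v' x')
    else False
  else False.

Lemma ill_path_ex k v : illseq v -> exists x, ill_path k v x.
Proof.
move=> iv; have [e _ ie] := ill_child k 0 iv.
have [e' ee' ie'] := ill_child k e.+1 iv.
exists [:: e'] => /=; case: child ie' => // v' iv'.
by split=> //; left; split=> //; exists e.
Qed.

Lemma ill_path_lt k v x : ill_path k v x ->
  exists2 y, ill_path k v y & ltp k (Some v) y x.
Proof.
elim: x k v => [//|e x IH] k v /=.
case ce: child => [v'|//] [iv' [[-> [e' e'e ie']]|/IH[y hy yx]]].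
  move: ie'; case ce': child => [v''|//] /= iv''.
  have [y hy] := ill_path_ex k.+1 iv''.
  exists (e' :: y); first by rewrite /= ce'; split=> //; right.
  by apply/ltp_cons; left.
exists (e :: y); first by rewrite /= ce; split=> //; right.
by apply/ltp_cons_same; rewrite ce.
Qed.

Lemma not_W_ill k v : illseq v -> ~ W k (Some v) setT.
Proof.
move=> iv w; have [||x hx nx] := w (ill_path k v); first by [].
  exact: ill_path_ex.
by have [y hy] := ill_path_lt hx; apply: nx.
Qed.

Lemma W_pcons_inv k v e (S : set (seq nat)) :
  W k (Some v) (pcons e S) -> W k.+1 (child k v e) S.
Proof.
move=> w A AS [x Ax].
have [||y [a Aa ->] hy] := w (pcons e A).
- by move=> _ [a /AS Sa ->]; exists a.
- by exists (e :: x), x.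
- by exists a => // b Ab ba; apply: (hy (e :: b)); [exists b|apply/ltp_cons_same].
Qed.

Lemma not_W_pcons k v e : illnode (child k v e) ->
  ~ W k (Some v) (pcons e setT).
Proof.
by move=> + /W_pcons_inv; case: child => // v' iv'; apply: not_W_ill.
Qed.

(** Every final segment of the cone of an ill-founded node is ill-founded. *)
Lemma not_W_final k v x : illseq v -> ~ W k (Some v) [set z | ~ ltp k (Some v) z x].
Proof.
move=> iv; pose c := if x is c :: _ then c.+1 else 0%N.
have [e ce ie] := ill_child k c iv => w; apply: (not_W_pcons ie).
apply: (wfset_sub w) => _ [a _ ->] /=.
case: x @c ce w => [|d x] /= ce _; first exact: ltp_nil.
by move=> /ltp_cons[|[ed _]]; [rewrite ltnNge (ltnW ce)|rewrite ed ltnn in ce].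
Qed.

(** ** Absorption *)

(** Prefixing a well-founded node by an ill-founded one does not decrease it. *)
Lemma emb_cat s k l v : ~ illnode s -> illseq v -> exists f : seq nat -> seq nat,
  forall a b, ltp k s a b -> ltp l (omap (cat v) s) (f a) (f b).
Proof.
case: s => [u|] ns iv; last by exists id => a b; rewrite /ltp !pltNone.
have [a au aa] : exists2 a, a \in u & Acc (fun b a => E a b) a.
  by apply: contrapT => h; apply: ns => a av aa; apply: h; exists a.
elim: aa k l u v {ns} au iv => {}a _ IH k l u v au iv.
have [v' vv' iv'] := illseq_succ iv.
(* [nf.1] is an index past [p.2] whose cone receives that of the child [p.1] *)
have step (p : nat * nat) : exists nf : nat * (seq nat -> seq nat),
    (p.2 <= nf.1)%N /\ forall x y, ltp k.+1 (child k u p.1) x y ->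
      ltp l.+1 (child l (v ++ u) nf.1) (nf.2 x) (nf.2 y).
  case: p => n n0 /=; case ce: child => [u'|]; last first.
    have [n' n0n' cn'] := child_odd_None l (v ++ u) n0.
    by exists (n', id); split=> //= x y; rewrite cn' /ltp !pltNone.
  have [w [m [uw eu']]] := childP ce.
  have [b bw ab] := all2_mem uw au.
  have [n' n0n' cn'] := child_odd l (Some m) n0 (all2_catE vv' uw).
  have [|f hf] := IH b ab k.+1 l.+1 u' v' _ iv'; first by rewrite eu' mem_cat bw.
  by exists (n', f); split=> //= x y /hf; rewrite cn' /= eu' catA.
have [F hF] := choice step.
pose g := fix g n := (F (n, if n is n'.+1 then (g n').+1 else 0%N)).1.
pose h n := (F (n, if n is n'.+1 then (g n').+1 else 0%N)).2.
have gS n : (g n < g n.+1)%N by have [] := hF (n.+1, (g n).+1).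
have gmono m n : (m < n)%N -> (g m < g n)%N.
  elim: n => // n IHn; rewrite ltnS leq_eqVlt => /orP[/eqP->//|/IHn mn].
  exact: ltn_trans mn (gS n).
have hP n x y : ltp k.+1 (child k u n) x y ->
    ltp l.+1 (child l (v ++ u) (g n)) (h n x) (h n y).
  by rewrite /h; case: n => [|n]; [have [_] := hF (0, 0)%N|
    have [_] := hF (n.+1, (g n).+1)]; apply.
exists (fun x => if x is e :: x' then g e :: h e x' else [::]).
move=> [|x a'] [|y b'] //= /ltp_cons[xy|[<- ab]]; apply/ltp_cons.
  by left; apply: gmono.
by right; split=> //; apply: hP.
Qed.

(** The union of the root, the cones of the first [d] children and [S] in the cone
    of the next child is well-ordered when these children and [S] are. *)
Lemma W_initial k v d (S : set (seq nat)) :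
  (forall e, (e < d)%N -> ~ illnode (child k v e)) ->
  W k.+1 (child k v d) S ->
  W k (Some v) ([set [::]] `|` cones [set e | (e < d)%N] `|` pcons d S).
Proof.
move=> hd wS; apply: (wfsetU (ltp_total _ _)); last exact: W_pcons.
apply: (wfsetU (ltp_total _ _)); first exact/wfset1/ltp_total.
by apply: W_cones => e /hd; apply: W_fin.
Qed.

(** Along the leftmost path through ill-founded nodes, a copy of the cone of every
    well-founded node [s] is met to the left of the path: [d] levels below [v], [s]
    is the sequence that even indices append. *)
Lemma absorb_initial d k v s l :
  illseq v -> ~ illnode s -> hit None (k + d) = s ->
  exists y (f : seq nat -> seq nat),
  [/\ W k (Some v) [set z | ~ ltp k (Some v) y z],
      forall a, ltp k (Some v) [::] (f a) /\ ~ ltp k (Some v) y (f a) &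
      forall a b, ltp l s a b -> ltp k (Some v) (f a) (f b)].
Proof.
elim: d k v => [|d IH] k v iv ns hs; have [n [_ cn hn]] := first_ill_child k 0 iv.
- rewrite addn0 in hs.
  have [nodd [vp ip]] : odd n /\ all2 E v (childcode n).1 /\
      illseq (childcode n).1.
    move: cn; rewrite /child; case: ifP => // vp; case: ifP => _ /=.
      case: (childcode n).2 => //= m im; do 2!split=> //.
      by move=> a ap; apply: im; rewrite mem_cat ap.
    rewrite hs; case: (s) ns => //= m nm im; exfalso; apply: nm => a am.
    by apply: im; rewrite mem_cat am orbT.
  have [f hf] := emb_cat l k.+1 ns ip.
  have nE : n = (n./2).*2.+1 by rewrite -[LHS]odd_double_half nodd.
  have ce : child k v (n./2).*2 = omap (cat (childcode n).1) s.
    by rewrite /child /childcode doubleK -/(childcode n) vp odd_double hs.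
  exists [:: n], (fun a => (n./2).*2 :: f a); split.
  + apply: (wfset_sub (W_initial (d := n) (S := [set [::]]) hn _)).
      exact/wfset1/ltp_total.
    move=> [|e x]; first by left; left.
    move=> /ltpNcons[en|[<- h]]; first by left; right; exists e, x.
    right; exists x => //; case: x h => // a x; case: (child k v n) cn => //.
    by move=> u _ [].
  + have en : ((n./2).*2 < n)%N by rewrite {2}nE.
    move=> a; split=> // /ltp_cons[|[e _]]; first by rewrite ltnNge (ltnW en).
    by rewrite -e ltnn in en.
  + by move=> a b /hf h; apply/ltp_cons_same; rewrite ce.
- move: cn; case cn : child => [u|//] /= iu.
  have [|y [f [wy fy hf]]] := IH k.+1 u iu ns; first by rewrite addSnnS.
  exists (n :: y), (fun a => n :: f a); split.
  + apply: (wfset_sub (W_initial (d := n) hn _)); first by rewrite cn; exact: wy.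
    move=> [|e x]; first by left; left.
    move=> /ltpNcons[en|[<- h]]; first by left; right; exists e, x.
    by right; exists x => //; rewrite /= -cn.
  + by move=> a; split=> // /ltp_cons_same; rewrite cn; case: (fy a).
  + by move=> a b ab; apply/ltp_cons_same; rewrite cn; apply: hf.
Qed.

(** Every point is followed, within its class, by a copy of the cone of any
    well-founded node. *)
Lemma absorb z k v s l : illseq v -> ~ illnode s ->
  exists y (f : seq nat -> seq nat),
  [/\ W k (Some v) (between (ltp k (Some v)) z y),
      forall a, ltp k (Some v) z (f a) /\ ~ ltp k (Some v) y (f a) &
      forall a b, ltp l s a b -> ltp k (Some v) (f a) (f b)].
Proof.
elim: z k v => [|c z IH] k v iv ns.
  have [n kn hn] := hitP None s k.
  have [|y [f [wy fy hf]]] := @absorb_initial (n - k) k v s l iv ns.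
    by rewrite subnKC.
  by exists y, f; split=> //; apply: (wfset_sub wy) => x [].
have [ic|nc] := pselect (illnode (child k v c)).
  case cc: (child k v c) ic => [u|//] /= iu.
  have [y [f [wy fy hf]]] := IH k.+1 u iu ns.
  exists (c :: y), (fun a => c :: f a); split.
  + by rewrite between_cons cc; apply: W_pcons; rewrite cc.
  + move=> a; have [h1 h2] := fy a; split; first by apply/ltp_cons_same; rewrite cc.
    by move=> /ltp_cons_same; rewrite cc.
  + by move=> a b ab; apply/ltp_cons_same; rewrite cc; apply: hf.
have [n [cn ic hn]] := first_ill_child k c.+1 iv.
case cc: (child k v n) ic => [u|//] /= iu.
have [m' km' hm'] := hitP None s k.+1.
have [|y [f [wy fy hf]]] := @absorb_initial (m' - k.+1) k.+1 u s l iu ns.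
  by rewrite subnKC.
exists (n :: y), (fun a => n :: f a); split.
+ apply: (wfset_sub (S' := cones [set e | c <= e < n] `|`
    pcons n [set x | ~ ltp k.+1 (Some u) y x])); last first.
    move=> [|e x] [h1 h2]; first by case: h1.
    have [en|[ee h2']] := ltpNcons h2.
      left; exists e, x; split=> //=; rewrite en andbT.
      by have [/ltnW//|[->]] := ltpNcons h1.
    by right; exists x; rewrite ?ee // -cc.
  apply: (wfsetU (ltp_total _ _)); last by apply: W_pcons; rewrite cc.
  apply: W_cones => e /= /andP[]; rewrite leq_eqVlt => /orP[/eqP<- _|ce en].
    exact: W_fin.
  by apply/W_fin/hn; rewrite ce.
+ move=> a; have [_ h2] := fy a; split; first by apply/ltp_cons; left.
  by move=> /ltp_cons_same; rewrite cc.
+ by move=> a b ab; apply/ltp_cons_same; rewrite cc; apply: hf.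
Qed.

(** ** The classes of well-ordered distance *)

Lemma between_pcons k v x y e S : pcons e S `<=` btw k (Some v) x y ->
  W k (Some v) (btw k (Some v) x y) -> W k.+1 (child k v e) S.
Proof. by move=> sS w; apply: W_pcons_inv; apply: (wfset_sub w). Qed.

(** No class is last. *)
Lemma class_unbounded k v x : illseq v -> exists2 z,
  ltp k (Some v) x z & ~ W k (Some v) (btw k (Some v) x z).
Proof.
move=> iv; pose c := if x is c :: _ then c.+1 else 0%N.
have [e ce ie] := ill_child k c iv; have [e' ee' _] := ill_child k e.+1 iv.
have xz a : ltp k (Some v) x (e :: a).
  by case: x @c ce => // c x /= ce; apply/ltp_cons; left.
exists [:: e']; first by apply: ltp_trans (xz [::]) _; apply/ltp_cons; left.
move=> w; apply: (not_W_pcons ie); apply: (wfset_sub w) => _ [a _ ->]; split.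
  by move=> /(ltp_trans (xz a)); apply: ltpxx.
by move=> /ltp_cons[|[e'e _]]; [rewrite ltnNge (ltnW ee')|rewrite e'e ltnn in ee'].
Qed.

(** Either [x] is at well-ordered distance from the root, or its class has a least
    point that is not the root. *)
Lemma class_least_or k v x : illseq v ->
  W k (Some v) [set z | ~ ltp k (Some v) x z] \/
  exists m, [/\ ~ ltp k (Some v) x m, W k (Some v) (btw k (Some v) m x) &
    forall y, ltp k (Some v) y m -> ~ W k (Some v) (btw k (Some v) y m)].
Proof.
elim: x k v => [|c x IH] k v iv.
  left; apply: (wfset_sub (wfset1 (x := [::]) (ltp_total _ _))).
  by move=> [|a b] // h; case: h.
have [wx|nwx] :=
  pselect (W k.+1 (child k v c) [set z | ~ ltp k.+1 (child k v c) x z]).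
- (* the class of [c :: x] starts right after the last ill-founded sibling *)
  have [bad|nbad] := pselect (exists2 e, (e < c)%N & illnode (child k v e)).
    right; have ex : exists d, (d <= c)%N &&
        `[< forall e, (d <= e < c)%N -> ~ illnode (child k v e) >].
      exists c; rewrite leqnn; apply/asboolP => e.
      by rewrite leqNgt; case: (e < c)%N.
    have [d /andP[dc /asboolP hd] dmin] := ex_minnP ex.
    exists [:: d]; split.
    + by move=> /ltp_cons[|[_ /ltp_nil//]]; rewrite ltnNge dc.
    + apply: (wfset_sub (S' := cones [set e | d <= e < c] `|`
        pcons c [set z | ~ ltp k.+1 (child k v c) x z])); last first.
        move=> [|e z] [h1 h2]; first by case: h1.
        have [ec|[<- h]] := ltpNcons h2; last by right; exists z.
        left; exists e, z; split=> //=; rewrite ec andbT.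
        by have [/ltnW//|[->]] := ltpNcons h1.
      apply: (wfsetU (ltp_total _ _)); last exact: W_pcons.
      by apply: W_cones => e /= /hd; apply: W_fin.
    + have cone y e : (e < d)%N -> illnode (child k v e) ->
          (forall a, ~ ltp k (Some v) (e :: a) y) ->
          ~ W k (Some v) (btw k (Some v) y [:: d]).
        move=> ed ie hy w; apply: (not_W_pcons ie); apply: (wfset_sub w).
        move=> _ [a _ ->]; split=> // /ltp_cons[|[de _]].
          by rewrite ltnNge (ltnW ed).
        by rewrite de ltnn in ed.
      have lt_d e : (e < c)%N -> illnode (child k v e) -> (e < d)%N.
        move=> ec ie; rewrite ltnNge; apply/negP => de.
        by apply: (hd e) => //; rewrite de ec.
      move=> [_|e' y].
        have [e ec ie] := bad; apply: (cone [::] e (lt_d e ec ie) ie) => a.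
        exact: ltp_nil.
      move=> /ltp_cons[e'd|[_ /ltp_nil//]].
      have [e [e'e ec ie]] :
          exists e, [/\ (e' <= e)%N, (e < c)%N & illnode (child k v e)].
        apply: contrapT => ne; move: (e'd); rewrite ltnNge => /negP; apply.
        apply: dmin; rewrite (leq_trans (ltnW e'd) dc); apply/asboolP.
        by move=> e /andP[e'e ec] ie; apply: ne; exists e.
      move: e'e; rewrite leq_eqVlt => /orP[/eqP ee|e'e]; last first.
        apply: (cone (e' :: y) e (lt_d e ec ie) ie) => a.
        move=> /ltp_cons[|[ee _]]; first by rewrite ltnNge (ltnW e'e).
        by rewrite ee ltnn in e'e.
      rewrite -ee in ie; move=> w; case ce: (child k v e') ie => [u|//] /= iu.
      apply: (not_W_final (k := k.+1) (x := y) iu); rewrite -ce.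
      apply: between_pcons w => _ [z h ->]; split; first by move=> /ltp_cons_same.
      by move=> /ltp_cons[|[de _]]; [rewrite ltnNge (ltnW e'd)|rewrite de ltnn in e'd].
  left; apply: (wfset_sub (W_initial (d := c) _ wx)).
    by move=> e ec ie; apply: nbad; exists e.
  move=> [|e z]; first by left; left.
  move=> /ltpNcons[ec|[<- h]]; first by left; right; exists e, z.
  by right; exists z.
case cc: (child k v c) nwx => [u|] nwx; last by case: nwx; apply: (wfset_subT (@W_None _)).
have iu : illseq u.
  by apply: contrapT => nu; apply: nwx; apply: (wfset_subT (@W_fin _ (Some u) nu)).
right; have [//|[m [xm wm hm]]] := IH k.+1 u iu.
have m0 : m <> [::].
  move=> m0; apply: nwx; apply: (wfset_sub wm) => z xz; rewrite m0.
  by split=> //; exact: ltp_nil.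
exists (c :: m); split.
- by move=> /ltp_cons_same; rewrite cc.
- by rewrite between_cons; apply: W_pcons; rewrite cc.
- move=> [_|e y].
    move=> w; apply: (hm [::]); first by case: m m0 {xm wm hm w}.
    rewrite -cc; apply: between_pcons w => _ [z [_ h2] ->].
    by split; [exact: ltp_nil|move=> /ltp_cons_same].
  move=> /ltp_cons[ec|[-> ym]]; last first.
    by rewrite between_cons => /W_pcons_inv; rewrite cc in ym *; apply: hm.
  move=> w; apply: (hm [::]); first by case: m m0 {xm wm hm w}.
  rewrite -cc; apply: between_pcons w => _ [z [_ h2] ->]; split.
    move=> /ltp_cons[|[ce _]]; first by rewrite ltnNge (ltnW ec).
    by rewrite ce ltnn in ec.
  by move=> /ltp_cons_same.
Qed.

Lemma class_least_ex k v x : illseq v ->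
  exists m, [/\ ~ ltp k (Some v) x m, W k (Some v) (btw k (Some v) m x) &
    forall y, ltp k (Some v) y m -> ~ W k (Some v) (btw k (Some v) y m)].
Proof.
move=> iv; have [w|//] := class_least_or k x iv; exists [::]; split.
- exact: ltp_nil.
- by apply: (wfset_sub w) => z [].
- by move=> y /ltp_nil.
Qed.

(** Inside the cone of an ill-founded node, past any point [w] of this cone,
    there is a point at ill-founded distance from both ends. *)
Lemma ill_cone_dense k v x y c w : illnode (child k v c) ->
  ~ ltp k (Some v) (c :: w) x -> (forall a, ltp k (Some v) (c :: a) y) ->
  exists z, [/\ ltp k (Some v) x z, ltp k (Some v) z y,
    ~ W k (Some v) (btw k (Some v) x z) & ~ W k (Some v) (btw k (Some v) z y)].
Proof.
case cc: (child k v c) => [u|//] /= iu xw wy.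
have [z wz nz] := class_unbounded k.+1 w iu.
have le_x a : ~ ltp k.+1 (Some u) a w -> ~ ltp k (Some v) (c :: a) x.
  move=> aw ax; apply: aw; have [_ _ tri] := ltp_total k.+1 (Some u).
  have [//|[e|wa]] := tri a w; first by case: xw; rewrite -e.
  by case: xw; apply: ltp_trans ax; apply/ltp_cons_same; rewrite cc.
exists (c :: z); split=> //.
- have [_ _ tri] := ltp_total k (Some v).
  have [//|[e|h]] := tri x (c :: z).
    case: xw; rewrite e; apply/ltp_cons_same; by rewrite cc.
  case: (le_x z) => // h'; exact: (ltpxx (ltp_trans h' wz)).
- move=> h; apply: nz; rewrite -cc; apply: between_pcons h => _ [a [h1 h2] ->].
  split; first by apply: le_x; rewrite -cc.
  by move=> /ltp_cons_same.
- move=> h; apply: (not_W_final (k := k.+1) (x := z) iu); rewrite -cc.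
  apply: between_pcons h => _ [a h ->]; split; first by move=> /ltp_cons_same.
  by move=> h'; apply: (ltpxx (ltp_trans h' (wy a))).
Qed.

(** Between two classes there is a third one. *)
Lemma class_dense_ex k v x y : illseq v -> ltp k (Some v) x y ->
  ~ W k (Some v) (btw k (Some v) x y) ->
  exists z, [/\ ltp k (Some v) x z, ltp k (Some v) z y,
    ~ W k (Some v) (btw k (Some v) x z) & ~ W k (Some v) (btw k (Some v) z y)].
Proof.
elim: y x k v => [|d y IH] x k v iv; first by move=> /ltp_nil.
move=> xy nW.
have same x' : x = d :: x' -> exists z, [/\ ltp k (Some v) x z,
    ltp k (Some v) z (d :: y), ~ W k (Some v) (btw k (Some v) x z) &
    ~ W k (Some v) (btw k (Some v) z (d :: y))].
  move=> xE; rewrite xE between_cons in xy nW *; move: xy => /ltp_cons_same xy.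
  case cc: (child k v d) xy nW => [u|] xy nW; last first.
    by case: nW; apply: W_pcons; rewrite cc; apply: (wfset_subT (@W_None _)).
  have nW' : ~ W k.+1 (Some u) (btw k.+1 (Some u) x' y).
    by move=> h; apply: nW; apply: W_pcons; rewrite cc.
  have iu : illseq u.
    apply: contrapT => nu; apply: nW'.
    apply: (wfset_subT (@W_fin _ (Some u) nu)).
  have [z [h1 h2 h3 h4]] := IH _ _ _ iu xy nW'.
  exists (d :: z); rewrite !between_cons; split; try by apply/ltp_cons_same; rewrite cc.
    by move/W_pcons_inv; rewrite cc.
  by move/W_pcons_inv; rewrite cc.
have [[c [w [cd ic cx]]]|nc] := pselect (exists c w, [/\ (c < d)%N,
    illnode (child k v c) & ~ ltp k (Some v) (c :: w) x]).
  by apply: (ill_cone_dense ic cx) => a; apply/ltp_cons; left.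
have [[x' xE]|nx] := pselect (exists x', x = d :: x'); first exact: (same x').
have xd a : ltp k (Some v) x (d :: a).
  case: x xy nx {nW same nc} => [//|e x] /ltp_cons[h|[-> _]] nx.
    by apply/ltp_cons; left.
  by case: nx; exists x.
have nW' : ~ W k.+1 (child k v d) (btw k.+1 (child k v d) [::] y).
  move=> h; apply: nW; apply: (wfset_sub (S' := [set [::]] `|`
    cones [set e | (e < d)%N /\ ~ illnode (child k v e)] `|`
    pcons d (btw k.+1 (child k v d) [::] y))); last first.
    move=> [|e a] [h1 h2]; first by left; left.
    have [ed|[<- h']] := ltpNcons h2; last first.
      by right; exists a => //; split=> //; exact: ltp_nil.
    left; right; exists e, a; split=> //; split=> // ie.
    by apply: nc; exists e, a.
  apply: (wfsetU (ltp_total _ _)); last exact: W_pcons.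
  apply: (wfsetU (ltp_total _ _)); first exact/wfset1/ltp_total.
  by apply: W_cones => e [_]; apply: W_fin.
case cc: (child k v d) nW' => [u|] nW'; last first.
  by case: nW'; apply: (wfset_subT (@W_None _)).
have iu : illseq u.
  by apply: contrapT => nu; apply: nW'; apply: (wfset_subT (@W_fin _ (Some u) nu)).
have y0 : ltp k.+1 (Some u) [::] y.
  case: (y) nW' => // nW'; case: nW'.
  apply: (wfset_sub (wfset1 (x := [::]) (ltp_total _ _))) => -[|a b] [h1 h2] //.
  by case: h2.
have [z [h1 h2 h3 h4]] := IH _ _ _ iu y0 nW'.
exists (d :: z); split=> //.
- by apply/ltp_cons_same; rewrite cc.
- move=> h; apply: h3; rewrite -cc; apply: between_pcons h => _ [a [_ h] ->]; split.
    by move=> h'; apply: (ltpxx (ltp_trans h' (xd a))).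
  by move=> /ltp_cons_same.
- by rewrite between_cons => /W_pcons_inv; rewrite cc.
Qed.

Section Absorption.
Context (k0 : nat) (v0 : seq N).
Hypothesis iv0 : illseq v0.

Local Notation L0 := (ltp k0 (Some v0)).

(** [S] embeds into the class of every point of the cone of [v0], above this
    point and below another one. *)
Definition absorbed (k : nat) (s : option (seq N)) (S : set (seq nat)) : Prop :=
  forall z, exists y (f : seq nat -> seq nat),
  [/\ L0 z y, W k0 (Some v0) (between L0 z y),
      forall a, S a -> L0 z (f a) /\ ~ L0 y (f a) &
      forall a b, S a -> S b -> ltp k s a b -> L0 (f a) (f b)].

Let lt_le_trans x y z : L0 x y -> ~ L0 z y -> L0 x z.
Proof.
move=> xy yz; have [_ _ tri] := ltp_total k0 (Some v0).
have [h|[<-//|//]] := tri y z; exact: ltp_trans xy h.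
Qed.

Let le_lt_trans x y z : ~ L0 y x -> L0 y z -> L0 x z.
Proof.
move=> xy yz; have [_ _ tri] := ltp_total k0 (Some v0).
have [h|[->//|//]] := tri x y; exact: ltp_trans h yz.
Qed.

Lemma absorbed_sub k s (S S' : set (seq nat)) :
  absorbed k s S' -> S `<=` S' -> absorbed k s S.
Proof.
move=> h SS' z; have [y [f [zy h1 h2 h3]]] := h z; exists y, f; split=> //.
  by move=> a /SS'; apply: h2.
by move=> a b /SS' Sa /SS' Sb; apply: h3.
Qed.

Lemma absorbed_fin k s S : ~ illnode s -> absorbed k s S.
Proof.
move=> ns z; have [y [f [h1 h2 h3]]] := absorb z k0 k iv0 ns; exists y, f.
split=> // [|a b _ _]; last exact: h3.
by have [h h'] := h2 [::]; apply: lt_le_trans h'.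
Qed.

Lemma absorbed1 k s x : absorbed k s [set x].
Proof.
move=> z; have [y [f [zy h1 h2 _]]] := @absorbed_fin 0 None setT id z.
exists y, (fun=> f x); split=> // [a _|a b -> ->]; [exact: h2|by move/ltpxx].
Qed.

Lemma absorbedU k s S1 S2 : absorbed k s S1 -> absorbed k s S2 ->
  (forall a b, S1 a -> S2 b -> ltp k s a b) -> absorbed k s (S1 `|` S2).
Proof.
move=> h1 h2 S12 z; have [y1 [f1 [zy1 w1 b1 m1]]] := h1 z.
have [y2 [f2 [y12 w2 b2 m2]]] := h2 y1.
have f12 a b : S1 a -> S2 b -> L0 (f1 a) (f2 b).
  by move=> /b1[_ ay] /b2[yb _]; apply: le_lt_trans yb.
exists y2, (fun a => if `[< S1 a >] then f1 a else f2 a); split.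
- exact: ltp_trans zy1 y12.
- apply: (wfset_sub (wfsetU (ltp_total _ _) w1 w2)) => x [zx xy].
  have [h|h] := pselect (L0 y1 x); [right; split=> // h'|by left].
  exact: (ltpxx (ltp_trans h h')).
- move=> a; case: asboolP => [S1a _|nS1 [//|S2a]].
    have [h1' h2'] := b1 _ S1a; split=> // h; apply: h2'.
    exact: ltp_trans y12 h.
  by have [h1' h2'] := b2 _ S2a; split=> //; apply: ltp_trans zy1 h1'.
- move=> a b; case: asboolP => S1a Sa; case: asboolP => S1b Sb ab.
  + exact: m1.
  + by apply: f12 => //; case: Sb.
  + case: Sa => // S2a; case: (ltpxx (ltp_trans ab (S12 _ _ S1b S2a))).
  + by apply: m2 => //; [case: Sa|case: Sb].
Qed.

Lemma absorbed_pcons k v e S :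
  absorbed k.+1 (child k v e) S -> absorbed k (Some v) (pcons e S).
Proof.
move=> h z; have [y [f [zy w b m]]] := h z; exists y, (f \o behead); split=> //.
  by move=> _ [a Sa ->]; apply: b.
by move=> _ _ [a Sa ->] [a' Sa' ->] /ltp_cons_same; apply: m.
Qed.

Lemma absorbed_cones k v c d :
  (forall e, (c <= e < d)%N -> ~ illnode (child k v e)) ->
  absorbed k (Some v) (cones [set e | (c <= e < d)%N]).
Proof.
elim: d => [|d IH] hd.
  by apply: (absorbed_sub (absorbed1 _ _ [::])) => x [e [a /= []]]; rewrite ltn0 andbF.
have [cd|dc] := leqP c d; last first.
  apply: (absorbed_sub (absorbed1 _ _ [::])) => x [e [a /= [/andP[ce]]]].
  by rewrite ltnS => ed; move: (leq_trans ce ed); rewrite leqNgt dc.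
apply: (absorbed_sub (S' := cones [set e | c <= e < d] `|` pcons d setT)).
  apply: absorbedU.
  - by apply: IH => e /andP[ce ed]; apply: hd; rewrite ce ltnS (ltnW ed).
  - by apply: absorbed_pcons; apply: absorbed_fin; apply: hd; rewrite cd ltnSn.
  - move=> _ _ [e [a [/= /andP[_ ed] ->]]] [b _ ->].
    by apply/ltp_cons; left.
move=> x [e [a [/= /andP[ce]]]]; rewrite ltnS leq_eqVlt => /orP[/eqP-> ->|ed ->].
  by right; exists a.
by left; exists e, a; rewrite /= ce ed.
Qed.

(** A well-ordered initial segment is a finite sum of cones of well-founded nodes
    and single points. *)
Lemma absorbed_initial k s x : W k s [set z | ~ ltp k s x z] ->
  absorbed k s [set z | ~ ltp k s x z].
Proof.
have [|ns _] := pselect (illnode s); last exact: absorbed_fin.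
case: s => [v|//] /=; elim: x k v => [|d x IH] k v iv w.
  by apply: (absorbed_sub (absorbed1 _ _ [::])) => -[|a b] // h; case: h.
have hd e : (e < d)%N -> ~ illnode (child k v e).
  move=> ed ie; apply: (not_W_pcons ie); apply: (wfset_sub w) => _ [a _ ->].
  by move=> /ltp_cons[|[de _]]; [rewrite ltnNge (ltnW ed)|rewrite de ltnn in ed].
have wd : W k.+1 (child k v d) [set z | ~ ltp k.+1 (child k v d) x z].
  apply: W_pcons_inv; apply: (wfset_sub w) => _ [a h ->].
  by move=> /ltp_cons_same.
apply: (absorbed_sub (S' := [set [::]] `|` (cones [set e | (0 <= e < d)%N] `|`
  pcons d [set z | ~ ltp k.+1 (child k v d) x z]))); last first.
  move=> [|e z]; first by left.
  move=> /ltpNcons[ed|[<- h]]; first by right; left; exists e, z.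
  by right; right; exists z.
apply: absorbedU; first exact: absorbed1.
  apply: absorbedU; first by apply: absorbed_cones => e /= /hd.
    apply: absorbed_pcons; case cd: (child k v d) wd => [u|] wd.
      have [iu|nu] := pselect (illseq u); first exact: IH.
      exact: absorbed_fin.
    exact: absorbed_fin.
  by move=> _ _ [e [a [/= ed ->]]] [b _ ->]; apply/ltp_cons; left.
by move=> _ b -> [[e [a [_ ->]]]|[a _ ->]].
Qed.

(** Every well-ordered interval is absorbed. *)
Lemma absorbed_between k s x y : W k s (btw k s x y) -> absorbed k s (btw k s x y).
Proof.
have [|ns _] := pselect (illnode s); last exact: absorbed_fin.
case: s => [v|//] /=; elim: x y k v => [|c x IH] y k v iv w.
  have e : btw k (Some v) [::] y = [set z | ~ ltp k (Some v) y z].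
    by apply/seteqP; split=> z; [case|split=> //; exact: ltp_nil].
  by rewrite e in w *; apply: absorbed_initial.
case: y w => [|d y] w.
  apply: (absorbed_sub (absorbed1 _ _ [::])) => -[|e z] [h1 h2] //.
  by case: h2.
have [cd|dc|dc] := ltngtP c d; last first.
- rewrite -dc between_cons in w *; apply: absorbed_pcons.
  have {}w := W_pcons_inv w; case cc: (child k v c) w => [u|] w.
    have [iu|nu] := pselect (illseq u); first exact: IH.
    exact: absorbed_fin.
  exact: absorbed_fin.
- apply: (absorbed_sub (absorbed1 _ _ [::])) => -[|e z] [h1 h2] //.
  have [h|[eh h]] := ltpNcons h2.
    by case: h1; apply/ltp_cons; left; apply: ltn_trans h dc.
  by case: h1; apply/ltp_cons; left; rewrite -eh.
have hd e : (c <= e < d)%N -> ~ illnode (child k v e).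
  case/andP; rewrite leq_eqVlt => /orP[/eqP<- _|ce ed] ie; last first.
    apply: (not_W_pcons ie); apply: (wfset_sub w) => _ [a _ ->]; split.
      by move=> /ltp_cons[|[ec _]]; [rewrite ltnNge (ltnW ce)|rewrite ec ltnn in ce].
    by move=> /ltp_cons[|[ec _]]; [rewrite ltnNge (ltnW ed)|rewrite ec ltnn in ed].
  case cc: (child k v c) ie => [u|//] /= iu.
  apply: (not_W_final (k := k.+1) (x := x) iu); rewrite -cc.
  apply: between_pcons w => _ [z h ->]; split; first by move=> /ltp_cons_same.
  by move=> /ltp_cons[|[ec _]]; [rewrite ltnNge (ltnW cd)|rewrite ec ltnn in cd].
have wd : W k.+1 (child k v d) [set z | ~ ltp k.+1 (child k v d) y z].
  apply: between_pcons w => _ [z h ->]; split; last by move=> /ltp_cons_same.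
  by move=> /ltp_cons[|[ec _]]; [rewrite ltnNge (ltnW cd)|rewrite ec ltnn in cd].
apply: (absorbed_sub (S' := cones [set e | (c <= e < d)%N] `|`
  pcons d [set z | ~ ltp k.+1 (child k v d) y z])).
  apply: absorbedU; first exact: absorbed_cones.
    exact/absorbed_pcons/absorbed_initial.
  by move=> _ _ [e [a [/= /andP[_ ed] ->]]] [b _ ->]; apply/ltp_cons; left.
move=> [|e z] [h1 h2]; first by case: h1.
have [ed|[<- h]] := ltpNcons h2; last by right; exists z.
left; exists e, z; split=> //=; rewrite ed andbT.
by have [/ltnW//|[->]] := ltpNcons h1.
Qed.

(** The cone of an ill-founded node is isomorphic to its double. *)
Lemma ill_doubling : exists F : bool * seq nat -> seq nat,
  (forall p q, lex ltB L0 p q -> L0 (F p) (F q)) /\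
  forall y, exists p, F p = y.
Proof.
apply: (@self_doubling _ L0 CodeSeq.code [::] (can_inj CodeSeq.codeK)).
- exact: ltp_total.
- exact: ltp_nil.
- by move=> x; apply: class_least_ex.
- by move=> x; apply: class_unbounded.
- by move=> x y; apply: class_dense_ex.
- move=> x y z /absorbed_between /(_ z)[y' [f [_ w b m]]]; exists f => a xya.
  have [h1 h2] := b _ xya; split.
  + by move=> h; apply: (ltpxx (ltp_trans h h1)).
  + apply: (wfset_sub w) => t [zt tf]; split=> // yt; apply: tf.
    by apply: le_lt_trans yt.
  + by move=> t xyt; apply: m.
Qed.

End Absorption.

End Tree.

(** * Codes of linear orders *)

Lemma LinP (K : Lin) : linear_order_code (val K).
Proof. by case: K => c /= /set_mem [[]|[]]. Qed.

Lemma LO_refl (c : lo_code) n : LO c -> c (n, n).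
Proof. by case=> _; apply. Qed.

Section LinearCode.
Context (c : lo_code).
Hypothesis lin : linear_order_code c.

Lemma code_dom m n : c (m, n) -> c (m, m) /\ c (n, n).
Proof. by case: lin => _ h _ _ _ /h /andP. Qed.

Lemma code_anti m n : c (m, n) -> c (n, m) -> m = n.
Proof.
case: lin => _ _ h _ _ mn nm; have [hm hn] := code_dom mn.
have := h (exist _ m hm) (exist _ n hn).
by rewrite /ole /= mn nm => /(_ isT) [].
Qed.

Lemma code_trans n m p : c (m, n) -> c (n, p) -> c (m, p).
Proof.
case: lin => _ _ _ h _ mn np; have [hm hn] := code_dom mn.
have [_ hp] := code_dom np.
exact: (h (exist _ n hn) (exist _ m hm) (exist _ p hp)).
Qed.

Lemma code_total m n : c (m, m) -> c (n, n) -> c (m, n) \/ c (n, m).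
Proof.
case: lin => _ _ _ _ h hm hn.
by have := h (exist _ m hm) (exist _ n hn); rewrite /ole /= => /orP.
Qed.

End LinearCode.

Lemma linear_order_codeI (c : lo_code) :
  (exists n, c (n, n)) -> (forall m n, c (m, n) -> c (m, m) /\ c (n, n)) ->
  (forall m n, c (m, n) -> c (n, m) -> m = n) ->
  (forall n m p, c (m, n) -> c (n, p) -> c (m, p)) ->
  (forall m n, c (m, m) -> c (n, n) -> c (m, n) \/ c (n, m)) ->
  linear_order_code c.
Proof.
move=> h0 h1 h2 h3 h4; split=> //.
- by move=> m n /h1[-> ->].
- by move=> [m hm] [n hn] /andP[/= mn nm]; apply: val_inj; apply: h2.
- by move=> [n hn] [m hm] [p hp]; apply: h3.
- by move=> [m hm] [n hn]; apply/orP; apply: h4.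
Qed.

(** The relation of piecewise convex embeddability between orders with domain
    the natural numbers, by means of the function [pi] that gives the piece of a
    point. *)
Lemma pceP (C : set Lin) (L L' : lo_code) : LO L -> LO L' ->
  piecewise_convex_embeds C L L' <->
  exists2 K : Lin, C K & exists pi f : nat -> nat,
  [/\ forall n, val K (pi n, pi n),
      forall k, val K (k, k) -> exists n, pi n = k,
      forall m n, L (m, n) -> val K (pi m, pi n),
      forall m n, L (m, n) = L' (f m, f n) &
      forall m n y, pi m = pi n -> L' (f m, y) -> L' (y, f n) ->
        exists z, pi z = pi m /\ f z = y].
Proof.
move=> loL loL'; have [linL dL] := loL; have [linL' dL'] := loL'.
pose mk n : dom L := exist _ n (dL n); pose mk' n : dom L' := exist _ n (dL' n).
have mkK x : mk (val x) = x by apply: val_inj.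
have mkK' x : mk' (val x) = x by apply: val_inj.
split=> -[K CK].
  move=> [P [f [[P0 PT PD PO] fE fC]]]; exists K => //.
  have linK := LinP K.
  have /choice[pi hpi] x : exists k, P k x.
    have : setT x by []. by rewrite -PT => -[k _ Pk]; exists k.
  have piE k x : P k x -> pi x = k.
    move=> Px; apply: contrapT => ne; have := PD _ _ ne.
    by rewrite -subset0 => h; exact: (h x (conj (hpi x) Px)).
  have pi_mono x y : ole x y -> ole (pi x) (pi y).
    move=> xy; have [//|yx] := code_total linK (valP (pi x)) (valP (pi y)).
    have [e|ne] := eqVneq (val (pi x)) (val (pi y)).
      by rewrite /ole e; case: (pi y) => n hn.
    have : olt (pi y) (pi x) by rewrite /olt eq_sym ne andbT.
    move=> /PO /(_ _ _ (hpi y) (hpi x)) /andP[yx' /eqP ne']; exfalso; apply: ne'.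
    exact: (code_anti linL (m := val y) (n := val x) yx' xy).
  exists (fun n => val (pi (mk n))), (fun n => val (f (mk n))); split.
  - by move=> n; case: (pi (mk n)).
  - move=> k kk; have [x Px] := P0 (exist _ k kk); exists (val x).
    by rewrite mkK (piE _ _ Px).
  - by move=> m n mn; apply: (pi_mono (mk m) (mk n)).
  - move=> m n; apply/idP/idP => [mn|]; first exact: (fE (mk m) (mk n)).1.
    by move=> h; apply: (fE (mk m) (mk n)).2.
  - move=> m n y e my yn.
    have [||z Pz zy] := fC (pi (mk m)) (f (mk m)) (mk' y) (f (mk n)) my yn.
      by exists (mk m).
      by exists (mk n) => //; rewrite (val_inj e : pi (mk m) = pi (mk n)); apply: hpi.
    exists (val z); rewrite mkK (piE _ _ Pz); split=> //.
    by rewrite zy.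
move=> [pi [f [piK pis pim fE fC]]]; exists K => //; have linK := LinP K.
exists (fun k => [set x | pi (val x) = val k]), (fun x => mk' (f (val x))); split.
- split.
  + by move=> k; have [n hn] := pis _ (valP k); exists (mk n).
  + apply/seteqP; split=> // x _; exists (exist _ (pi (val x)) (piK _)) => //.
  + move=> k k' ne; rewrite -subset0 => x [/= -> /val_inj]; exact: ne.
  + move=> k k'; split=> [/andP[kk' ne] x y /= xk yk|h].
      have yx : ~~ ole y x.
        apply/negP => /pim; rewrite xk yk => k'k; move/eqP: ne; apply.
        exact: (code_anti linK (m := val k) (n := val k') kk' k'k).
      apply/andP; split.
        by case: (code_total linL (dL (val x)) (dL (val y))) => // h; case/negP: yx.
      apply/eqP => e; move/negP: yx; apply; rewrite /ole e; exact: dL.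
    have [m hm] := pis _ (valP k); have [n hn] := pis _ (valP k').
    have /andP[mn ne] := h (mk m) (mk n) hm hn.
    apply/andP; split; first by rewrite /ole -hm -hn; apply: pim.
    apply/eqP => e; have /andP[_ /eqP] := h (mk m) (mk m) hm (etrans hm e).
    exact.
- by move=> x y; rewrite /ole /= fE.
- move=> k x' y z' xy yz [x /= xk xE] [z /= zk zE]; subst x' z'.
  have [z' [z'k z'y]] := fC _ _ _ (etrans xk (esym zk)) xy yz.
  by exists (mk z'); [rewrite /= z'k|apply: val_inj].
Qed.

(** The code of an order on a type [T] in bijection with the natural numbers. *)
Definition code_of (T : Type) (dec : nat -> T) (lt : T -> T -> Prop) : lo_code :=
  fun p => `[< ~ lt (dec p.2) (dec p.1) >].

Lemma code_ofE T dec lt m n :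
  @code_of T dec lt (m, n) = `[< ~ lt (dec n) (dec m) >].
Proof. by []. Qed.

Section CodeOf.
Context (T : Type) (dec : nat -> T) (enc : T -> nat) (lt : T -> T -> Prop).
Hypotheses (decK : cancel dec enc) (tot : strict_total lt).

Lemma code_of_LO : LO (code_of dec lt).
Proof.
have [irr tr tri] := tot.
have refl n : code_of dec lt (n, n) by apply/asboolP; apply: irr.
split=> //; apply: linear_order_codeI => //.
- by exists 0%N.
- move=> m n /asboolP nm /asboolP mn; apply: (can_inj decK).
  by have [|[|]] := tri (dec m) (dec n).
- move=> n m p /asboolP nm /asboolP pn; apply/asboolP => pm.
  have [h|[h|h]] := tri (dec n) (dec p).
  + by apply: nm; apply: tr h pm.
  + by apply: nm; rewrite h.
  + by apply: pn.
- move=> m n _ _; have [h|h] := pselect (lt (dec m) (dec n)).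
    by left; apply/asboolP => h'; apply: (irr (dec m)); apply: tr h h'.
  by right; apply/asboolP.
Qed.

End CodeOf.

Section CodePce.
Context (T T' : Type) (dec : nat -> T) (enc : T -> nat) (lt : T -> T -> Prop).
Context (dec' : nat -> T') (enc' : T' -> nat) (lt' : T' -> T' -> Prop).
Hypotheses (decK : cancel dec enc) (encK : cancel enc dec) (tot : strict_total lt).
Hypotheses (decK' : cancel dec' enc') (encK' : cancel enc' dec').
Hypothesis (tot' : strict_total lt').

Lemma strict_mono (f : T -> T') : (forall x y, lt x y -> lt' (f x) (f y)) ->
  forall x y, lt x y <-> lt' (f x) (f y).
Proof.
move=> hf x y; split; first exact: hf.
have [_ _ tri] := tot; have [irr tr _] := tot'.
have [//|[->|/hf h]] := tri x y; first by move/irr.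
by move=> /(tr _ _ _ h)/irr.
Qed.

(** The same characterization for codes of orders on arbitrary types; the embedding
    need only be strictly increasing. *)
Lemma pce_code (C : set Lin) :
  piecewise_convex_embeds C (code_of dec lt) (code_of dec' lt') <->
  exists2 K : Lin, C K & exists (pi : T -> nat) (f : T -> T'),
  [/\ forall x, val K (pi x, pi x),
      forall k, val K (k, k) -> exists x, pi x = k,
      forall x y, lt x y -> val K (pi x, pi y),
      forall x y, lt x y -> lt' (f x) (f y) &
      forall x z y, pi x = pi z -> ~ lt' y (f x) -> ~ lt' (f z) y ->
        exists t, pi t = pi x /\ f t = y].
Proof.
have [irr tr tri] := tot.
rewrite (pceP _ (code_of_LO decK tot) (code_of_LO decK' tot')).
split=> -[K CK [pi [f [h1 h2 h3 h4 h5]]]]; exists K => //; have linK := LinP K.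
- have h4' m n : lt (dec m) (dec n) <-> lt' (dec' (f m)) (dec' (f n)).
    have := h4 n m; rewrite !code_ofE => e.
    split=> h; apply: contrapT => nh.
      by move: e; rewrite (asboolT nh) => /asboolP; apply.
    by move: e; rewrite (asboolT nh) => /esym/asboolP; apply.
  exists (pi \o enc), (dec' \o f \o enc); split=> /=.
  + by move=> x; apply: h1.
  + by move=> k /h2[n nk]; exists (dec n); rewrite decK.
  + move=> x y xy; apply: h3; apply/asboolP; rewrite !encK => yx.
    by apply: irr (tr _ _ _ xy yx).
  + by move=> x y xy; apply/h4'; rewrite !encK.
  + move=> x z y e yx zy.
    have [||t [t1 t2]] := h5 (enc x) (enc z) (enc' y) e.
      by apply/asboolP; rewrite encK'.
      by apply/asboolP; rewrite encK'.
    by exists (dec t); rewrite decK t2 encK'.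
- have h4' := strict_mono h4.
  exists (pi \o dec), (enc' \o f \o dec); split=> /=.
  + by move=> x; apply: h1.
  + by move=> k /h2[n nk]; exists (enc n); rewrite encK.
  + move=> m n /asboolP mn; have [h|[->|//]] := tri (dec m) (dec n).
      exact: h3.
    exact: h1.
  + move=> m n; rewrite !code_ofE !encK'; apply/asboolP/asboolP => h h'; apply: h.
      exact/h4'.
    exact/h4'.
  + move=> m n y e /asboolP; rewrite encK' => my /asboolP; rewrite encK' => yn.
    have [t [t1 t2]] := h5 _ _ _ e my yn.
    by exists (enc t); rewrite encK t2 decK'.
Qed.

End CodePce.

(** The one-point order with domain [{0}]. *)
Definition one_code : lo_code := fun p => p == (0, 0)%N.

Lemma one_code_lin : linear_order_code one_code.
Proof.
have h m n : one_code (m, n) -> m = 0%N /\ n = 0%N by move=> /eqP[-> ->].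
apply: linear_order_codeI.
- by exists 0%N.
- by move=> m n /h[-> ->].
- by move=> m n /h[-> ->].
- by move=> n m p /h[-> ->].
- by move=> m n /h[-> _] /h[-> _]; left.
Qed.

Lemma one_code_Lin : one_code \in Lin.
Proof.
apply/mem_set; left; split; first exact: one_code_lin.
by apply: (sub_finite_set _ (finite_set1 0%N)) => n /eqP[->].
Qed.

Definition one_Lin : Lin := exist _ one_code one_code_Lin.

Lemma one_in (C : set Lin) : C !=set0 -> downward_closed C -> C one_Lin.
Proof.
move=> [K CK] down; apply: (down _ K) => //.
have [[n nn] _ _ _ _] := LinP K.
exists (fun=> exist _ n nn) => -[x hx] [y hy]; split=> // _; rewrite /ole /=.
by move/eqP: hx => [->]; move/eqP: hy => [->].
Qed.

(** * Projections of closed sets in Cantor and Baire space *)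

Notation cantor := (nat -> bool).
Notation baire := (nat -> nat).

(** [f] and [g] have the same first [n] values. *)
Definition agree (A : Type) (n : nat) (f g : nat -> A) : Prop :=
  forall i, (i < n)%N -> f i = g i.

Lemma agree_sym A n (f g : nat -> A) : agree n f g -> agree n g f.
Proof. by move=> h i /h. Qed.

Lemma agree_trans A n (g f h : nat -> A) : agree n f g -> agree n g h -> agree n f h.
Proof. by move=> fg gh i i_n; rewrite fg ?gh. Qed.

Lemma agree_le A m n (f g : nat -> A) : agree n f g -> (m <= n)%N -> agree m f g.
Proof. by move=> h mn i im; apply: h; apply: leq_trans mn. Qed.

(** Closed subsets of the product of Cantor and Baire space. *)
Definition clo2 (Q : cantor -> baire -> Prop) : Prop := forall w y,
  (forall n, exists w' y', [/\ agree n w w', agree n y y' & Q w' y']) -> Q w y.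

(** Locally constant functions on the product of Cantor and Baire space. *)
Definition lc (A : Type) (F : cantor -> baire -> A) : Prop := forall w y,
  exists n, forall w' y', agree n w w' -> agree n y y' -> F w' y' = F w y.

(** Analytic subsets of Cantor space. *)
Definition sigma11 (B : cantor -> Prop) : Prop :=
  exists2 Q, clo2 Q & forall w, B w <-> exists y, Q w y.

Lemma lc_cst A (a : A) : lc (fun _ _ => a).
Proof. by move=> w y; exists 0%N. Qed.

Lemma lc_bind A A' (F : cantor -> baire -> A) (G : A -> cantor -> baire -> A') :
  lc F -> (forall a, lc (G a)) -> lc (fun w y => G (F w y) w y).
Proof.
move=> hF hG w y; have [m hm] := hF w y; have [n hn] := hG (F w y) w y.
exists (maxn m n) => w' y' ww' yy'.
rewrite hm ?hn //; (apply: (agree_le ww') || apply: (agree_le yy')).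
all: by rewrite ?leq_maxl ?leq_maxr.
Qed.

Lemma lc_app1 A A' (h : A -> A') F : lc F -> lc (fun w y => h (F w y)).
Proof. by move=> hF; apply: (lc_bind (G := fun a _ _ => h a)) => // a; apply: lc_cst. Qed.

Lemma lc_app2 A A' A'' (h : A -> A' -> A'') F G :
  lc F -> lc G -> lc (fun w y => h (F w y) (G w y)).
Proof.
move=> hF hG; apply: (lc_bind (G := fun a w y => h a (G w y))) => // a.
exact: lc_app1.
Qed.

Lemma lc_w (I : cantor -> baire -> nat) : lc I -> lc (fun w y => w (I w y)).
Proof.
move=> hI; apply: (lc_bind (G := fun a w _ => w a)) => // a w y.
by exists a.+1 => w' y' h _; rewrite h.
Qed.

Lemma lc_y (I : cantor -> baire -> nat) : lc I -> lc (fun w y => y (I w y)).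
Proof.
move=> hI; apply: (lc_bind (G := fun a _ y => y a)) => // a w y.
by exists a.+1 => w' y' _ h; rewrite h.
Qed.

Lemma clo2_lc (P : cantor -> baire -> Prop) : lc P -> clo2 P.
Proof.
move=> hP w y h; have [n hn] := hP w y; have [w' [y' [ww' yy']]] := h n.
by rewrite hn.
Qed.

Lemma clo2_all (I : Type) (Q : I -> cantor -> baire -> Prop) :
  (forall i, clo2 (Q i)) -> clo2 (fun w y => forall i, Q i w y).
Proof.
move=> hQ w y h i; apply: hQ => n; have [w' [y' [h1 h2 h3]]] := h n.
by exists w', y'; split.
Qed.

Lemma clo2_and Q Q' : clo2 Q -> clo2 Q' -> clo2 (fun w y => Q w y /\ Q' w y).
Proof.
move=> hQ hQ' w y h; split; [apply: hQ|apply: hQ'] => n;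
  have [w' [y' [h1 h2 [h3 h4]]]] := h n; exists w', y'; by split.
Qed.

Lemma clo2_imp (P Q : cantor -> baire -> Prop) :
  lc P -> clo2 Q -> clo2 (fun w y => P w y -> Q w y).
Proof.
move=> hP hQ w y h Pwy; apply: hQ => n; have [m hm] := hP w y.
have [w' [y' [h1 h2 h3]]] := h (maxn m n); exists w', y'; split.
- by apply: (agree_le h1); rewrite leq_maxr.
- by apply: (agree_le h2); rewrite leq_maxr.
- apply: h3; rewrite hm //; [apply: (agree_le h1)|apply: (agree_le h2)];
    by rewrite leq_maxl.
Qed.

(** Continuous substitutions. *)
Lemma clo2_comp Q (F : cantor -> baire -> cantor) (G : cantor -> baire -> baire) :
  (forall i, lc (fun w y => F w y i)) -> (forall i, lc (fun w y => G w y i)) ->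
  clo2 Q -> clo2 (fun w y => Q (F w y) (G w y)).
Proof.
move=> hF hG hQ w y h; apply: hQ => n.
have [m hm] : exists m, forall w' y', agree m w w' -> agree m y y' ->
    agree n (F w y) (F w' y') /\ agree n (G w y) (G w' y').
  elim: n => [|n [m hm]]; first by exists 0%N.
  have [a ha] := hF n w y; have [b hb] := hG n w y.
  exists (maxn m (maxn a b)) => w' y' ww' yy'.
  have [|| h1 h2] := hm w' y';
    try by (apply: (agree_le ww') || apply: (agree_le yy')); rewrite leq_maxl.
  have [la lb] : (a <= maxn m (maxn a b))%N /\ (b <= maxn m (maxn a b))%N.
    by rewrite !leq_max !leqnn !orbT.
  split=> i; rewrite ltnS leq_eqVlt => /orP[/eqP->|].
  - by rewrite ha //; [apply: (agree_le ww')|apply: (agree_le yy')].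
  - exact: h1.
  - by rewrite hb //; [apply: (agree_le ww')|apply: (agree_le yy')].
  - exact: h2.
have [w' [y' [h1 h2 h3]]] := h m; have [h4 h5] := hm _ _ h1 h2.
by exists (F w' y'), (G w' y').
Qed.

(** An injective, not surjective, pairing of natural numbers and its projections. *)
Definition natpair (m n : nat) : nat := CodeSeq.code [:: m; n].

Definition natfst (p : nat) : nat := nth 0%N (CodeSeq.decode p) 0.
Definition natsnd (p : nat) : nat := nth 0%N (CodeSeq.decode p) 1.

Lemma natfstK m n : natfst (natpair m n) = m.
Proof. by rewrite /natfst /natpair CodeSeq.codeK. Qed.

Lemma natsndK m n : natsnd (natpair m n) = n.
Proof. by rewrite /natsnd /natpair CodeSeq.codeK. Qed.

(** The [m]-th of the sequences coded by [y]. *)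
Definition slice (y : baire) (m : nat) : baire := fun n => y (natpair m n).

Lemma slice_surj (z : nat -> baire) : exists y, forall m, slice y m = z m.
Proof.
exists (fun p => z (natfst p) (natsnd p)) => m; apply/funext => n.
by rewrite /slice natfstK natsndK.
Qed.

Lemma lc_slice i m : lc (fun (_ : cantor) y => slice y m i).
Proof. exact: (lc_y (lc_cst _)). Qed.

Lemma lc_id_w i : lc (fun w (_ : baire) => w i).
Proof. exact: (lc_w (lc_cst _)). Qed.

Lemma clo2_slice Q m : clo2 Q -> clo2 (fun w y => Q w (slice y m)).
Proof.
move=> hQ; apply: (clo2_comp (F := fun w _ => w) (G := fun _ y => slice y m)) => // i.
  exact: lc_id_w.
exact: lc_slice.
Qed.

Lemma sigma11_ext B B' : (forall w, B w <-> B' w) -> sigma11 B -> sigma11 B'.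
Proof. by move=> e [Q cQ hQ]; exists Q => // w; rewrite -e. Qed.

Lemma sigma11_clo (P : cantor -> Prop) :
  (forall w, (forall n, exists2 w', agree n w w' & P w') -> P w) -> sigma11 P.
Proof.
move=> h; exists (fun w _ => P w) => [w y hw|w]; last first.
  by split=> [Pw|[]//]; exists (fun=> 0%N).
by apply: h => n; have [w' [_ [ww' _ Pw']]] := hw n; exists w'.
Qed.

Lemma sigma11_all (B : nat -> cantor -> Prop) : (forall n, sigma11 (B n)) ->
  sigma11 (fun w => forall n, B n w).
Proof.
move=> hB0; have hB n := cid2 (hB0 n); pose Q n := s2val (hB n).
exists (fun w y => forall n, Q n w (slice y n)).
  by apply: clo2_all => n; apply: clo2_slice; apply: s2valP.
move=> w; split=> [h|[y hy] n]; last first.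
  by apply/(s2valP' (hB n)); exists (slice y n); exact: hy.
have /choice[z hz] n : exists y, Q n w y by apply/(s2valP' (hB n)).
by have [y yz] := slice_surj z; exists y => n; rewrite yz.
Qed.

Lemma sigma11_ex (B : nat -> cantor -> Prop) : (forall n, sigma11 (B n)) ->
  sigma11 (fun w => exists n, B n w).
Proof.
move=> hB0; have hB n := cid2 (hB0 n); pose Q n := s2val (hB n).
exists (fun w y => Q (y 0%N) w (fun i => y i.+1)).
  move=> w y h; apply: (s2valP (hB (y 0%N))) => n.
  have [w' [y' [ww' yy' q]]] := h n.+1.
  exists w', (fun i => y' i.+1); split.
  - exact: (agree_le ww' (leqnSn n)).
  - by move=> i i_n; apply: yy'.
  - by rewrite yy'.
move=> w; split=> [[n /(s2valP' (hB n))[y hy]]|[y hy]]; last first.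
  by exists (y 0%N); apply/(s2valP' (hB (y 0%N))); exists (fun i => y i.+1).
by exists (fun i => if i is i'.+1 then y i' else n).
Qed.

Lemma sigma11_and B B' : sigma11 B -> sigma11 B' -> sigma11 (fun w => B w /\ B' w).
Proof.
move=> h h'; apply: (sigma11_ext (B := fun w => forall n, (if n is 0 then B else B') w)).
  move=> w; split=> [H|[b b'] [|n]//]; split; [exact: (H 0%N)|exact: (H 1%N)].
by apply: sigma11_all => -[|n].
Qed.

Lemma sigma11_or B B' : sigma11 B -> sigma11 B' -> sigma11 (fun w => B w \/ B' w).
Proof.
move=> h h'; apply: (sigma11_ext (B := fun w => exists n, (if n is 0 then B else B') w)).
  by move=> w; split=> [[[|n]]|[b|b']]; [left|right|exists 0%N|exists 1%N].
by apply: sigma11_ex => -[|n].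
Qed.

(** Projection along Cantor space and sequences of elements of Baire space. *)
Lemma sigma11_proj (B : cantor -> Prop) (Q : cantor -> (nat -> baire) -> Prop) :
  clo2 (fun w y => Q w (slice y)) ->
  (forall w, B w <-> exists z, Q w z) -> sigma11 B.
Proof.
move=> cQ hB; exists (fun w y => Q w (slice y)) => // w; rewrite hB.
split=> [[z hz]|[y hy]]; last by exists (slice y).
have [y yz] := slice_surj z; exists y.
by have -> : slice y = z by apply/funext.
Qed.

(** ** The tree of an analytic set *)

Section AnalyticTree.
Context (Q : cantor -> baire -> Prop).
Hypothesis cQ : clo2 Q.

(** The sequence [s] is compatible with [w], as far as their first [size s] values
    are concerned. *)
Definition legal (w : cantor) (s : seq nat) : Prop := exists w' y',
  [/\ agree (size s) w w', agree (size s) (nth 0%N s) y' & Q w' y'].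

(** The successor relation of the tree of [w]; only the extension has to be
    compatible with [w], so that all sequences may be nodes. *)
Definition extends (w : cantor) : rel (seq nat) :=
  fun a b => `[< exists n, b = rcons a n >] && `[< legal w b >].

Lemma extends_lc (A : Type) (h : bool -> A) a b : lc (fun w (_ : baire) => h (extends w a b)).
Proof.
apply: lc_app1 => w y; exists (size b) => w' y' ww' _; rewrite /extends.
congr (_ && _); apply: asbool_equiv_eq; split=> -[v [z [h1 h2 h3]]]; exists v, z; split=> //.
  exact: (agree_trans ww' h1).
exact: (agree_trans (agree_sym ww') h1).
Qed.

(** Infinite branches of the tree of [w] are witnesses for [w]. *)
Lemma ill_extends w : ill (extends w) [::] <-> exists y, Q w y.
Proof.
split=> [i0|[y Qwy]]; last first.
  move=> acc; have : exists n, mkseq y n = [::] by exists 0%N.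
  elim: acc => {}a _ IH [n na].
  apply: (IH (rcons a (y n))); last by exists n.+1; rewrite mkseqS na.
  rewrite /extends; apply/andP; split; first by apply/asboolP; exists (y n).
  rewrite -na -mkseqS; apply/asboolP; exists w, y; split=> // i.
  by rewrite size_mkseq => i_n; rewrite nth_mkseq.
pose T := {a | ill (extends w) a}.
have step (a : T) : exists b : T, extends w (sval a) (sval b).
  by have [b ab ib] := ill_succ (svalP a); exists (exist _ b ib).
have [F hF] := choice step.
pose S := fix S n : T := if n is n'.+1 then F (S n') else exist _ [::] i0.
pose y n := nth 0%N (sval (S n.+1)) n.
have SE n : sval (S n) = mkseq y n.
  elim: n => // n IH; have /andP[/asboolP[m mE] _] := hF (S n).
  rewrite mkseqS /y -IH [sval (S n.+1)]mE nth_rcons.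
  by rewrite IH size_mkseq ltnn eqxx.
exists y; apply: cQ => n.
have /andP[_ /asboolP] := hF (S n); rewrite -[F _]/(S n.+1) SE.
move=> [w' [y' [h1 h2 h3]]]; rewrite size_mkseq in h1 h2; exists w', y'; split=> //.
  exact: (agree_le h1 (leqnSn n)).
move=> i i_n; rewrite -h2; last exact: ltnW.
by rewrite nth_mkseq //; apply: ltnW.
Qed.

Lemma lc_all2 (v w : seq (seq nat)) :
  lc (fun (c : cantor) (_ : baire) => all2 (extends c) v w).
Proof.
elim: v w => [|a v IH] [|b w] /=; try exact: lc_cst.
by apply: (lc_app2 andb) => //; apply: (extends_lc id).
Qed.

Lemma lc_child k v n : lc (fun (c : cantor) (_ : baire) => child (extends c) k v n).
Proof.
rewrite /child; apply: (lc_app1 (fun b : bool => if b then _ else _)).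
exact: lc_all2.
Qed.

Lemma lc_plt a b k s : lc (fun (c : cantor) (_ : baire) => plt (extends c) k s a b).
Proof.
elim: a b k s => [|x a IH] b k [v|]; try exact: lc_cst.
case: b => [|y b] /=; first exact: lc_cst.
apply: (lc_app1 (fun e => (x < y)%N || (x == y) && e)).
apply: (lc_bind (G := fun u c _ => plt (extends c) k.+1 u a b)) => [|u].
  exact: lc_child.
exact: IH.
Qed.

End AnalyticTree.

(** * The reduction to piecewise convex embeddability *)

(** A bijection of the naturals with the points of the double of an order on finite
    sequences; the parity gives the first coordinate. *)
Definition dec2 (n : nat) : bool * seq nat := (odd n, CodeSeq.decode n./2).
Definition enc2 (p : bool * seq nat) : nat := (p.1 + (CodeSeq.code p.2).*2)%N.

Lemma dec2K : cancel dec2 enc2.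
Proof. by move=> n; rewrite /enc2 /= CodeSeq.decodeK odd_double_half. Qed.

Lemma enc2K : cancel enc2 dec2.
Proof.
move=> [b s]; rewrite /dec2 /enc2 /= half_bit_double CodeSeq.codeK.
by rewrite oddD odd_double addbF oddb.
Qed.

(** A well-founded order does not contain its double. *)
Lemma wf_no_doubling (X : Type) (lt : X -> X -> Prop) (f : bool * X -> X) :
  inhabited X -> strict_total lt -> wfset lt setT ->
  ~ (forall p q, lex ltB lt p q -> lt (f p) (f q)).
Proof.
move=> [x0] [irr tr tri] w hf.
pose y := f (true, x0).
have [||x fx hx] := w [set x | lt (f (false, x)) x]; first by [].
  by exists y; apply: hf; left.
by apply: (hx (f (false, x))) => //=; apply: hf; right.
Qed.

Section Reduction.
Context (Q : cantor -> baire -> Prop).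
Hypothesis cQ : clo2 Q.

(** The order of the tree of [w], whose root is the one-entry node formed by the
    empty sequence, and its double. *)
Definition tree_lt (w : cantor) : seq nat -> seq nat -> Prop :=
  ltp (extends Q w) 0 (Some [:: [::]]).

Definition tree_code (w : cantor) : lo_code := code_of CodeSeq.decode (tree_lt w).

Definition double_code (w : cantor) : lo_code := code_of dec2 (lex ltB (tree_lt w)).

Lemma tree_lt_total w : strict_total (tree_lt w).
Proof. exact: ltp_total. Qed.

Lemma tree_code_LO w : LO (tree_code w).
Proof. by apply: (code_of_LO CodeSeq.decodeK); apply: tree_lt_total. Qed.

Lemma double_lt_total w : strict_total (lex ltB (tree_lt w)).
Proof. by apply: strict_total_lex; [apply: ltB_total|apply: tree_lt_total]. Qed.

Lemma double_code_LO w : LO (double_code w).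
Proof. by apply: (code_of_LO dec2K); apply: double_lt_total. Qed.

(** The double is below the order of the tree exactly when [w] belongs to the
    analytic set. *)
Lemma double_pce (C : set Lin) w : C one_Lin ->
  piecewise_convex_embeds C (double_code w) (tree_code w) <-> exists y, Q w y.
Proof.
move=> C1; rewrite -(ill_extends cQ w).
rewrite (pce_code dec2K enc2K (double_lt_total w) CodeSeq.decodeK CodeSeq.codeK
  (tree_lt_total w)).
split=> [[K CK [pi [f [_ _ _ hf _]]]]|i0].
  apply: contrapT => n0; have ns : ~ illnode (extends Q w) (Some [:: [::]]).
    by move=> /= h; apply: n0; apply: h; rewrite inE.
  exact: (wf_no_doubling (inhabits [::]) (tree_lt_total w) (@W_fin _ _ 0 _ ns) hf).
have iv : illseq (extends Q w) [:: [::]] by move=> a; rewrite inE => /eqP->.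
have [F [hF Fs]] := ill_doubling 0 iv.
exists one_Lin => //; exists (fun=> 0%N), F; split=> //.
- by move=> k /eqP[->]; exists (true, [::]).
- by move=> x z y _ _ _; have [t ty] := Fs y; exists t.
Qed.

(** The order of the tree is an initial segment of its double. *)
Lemma pce_double (C : set Lin) w : C one_Lin ->
  piecewise_convex_embeds C (tree_code w) (double_code w).
Proof.
move=> C1; apply/(pce_code CodeSeq.decodeK CodeSeq.codeK (tree_lt_total w)
  dec2K enc2K (double_lt_total w)).
exists one_Lin => //; exists (fun=> 0%N), (pair false); split=> //.
- by move=> k /eqP[->]; exists [::].
- by move=> x y; right.
- move=> x z [[] s] _ _ h; last by exists s.
  by case: h; left.
Qed.

Lemma tree_code_lc p : lc (fun w (_ : baire) => tree_code w p).
Proof.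
rewrite /tree_code /code_of.
apply: (lc_app1 (fun b : bool => `[< ~ b >])); exact: lc_plt.
Qed.

Lemma double_code_lc p : lc (fun w (_ : baire) => double_code w p).
Proof.
rewrite /double_code /code_of /lex.
apply: (lc_app1 (fun b : bool =>
  `[< ~ (ltB (dec2 p.2).1 (dec2 p.1).1 \/ (dec2 p.2).1 = (dec2 p.1).1 /\ b) >])).
exact: lc_plt.
Qed.

End Reduction.

(** * Spaces presented as subspaces of Cantor space *)

(** [chi] is a topological embedding of [X] into Cantor space. *)
Definition bits (X : topologicalType) (chi : X -> cantor) : Prop :=
  [/\ injective chi, forall x i, nbhs x [set x' | chi x' i = chi x i] &
      forall x A, nbhs x A -> exists n, forall x', agree n (chi x) (chi x') -> A x'].

Lemma nbhs_agree (X : topologicalType) (A : Type) (F : X -> nat -> A) n x :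
  (forall i, nbhs x [set x' | F x' i = F x i]) ->
  nbhs x [set x' | agree n (F x) (F x')].
Proof.
move=> h; elim: n => [|n IH]; first by apply: filterS (filterT).
apply: filterS (filterI IH (h n)) => x' [h1 h2] i.
by rewrite ltnS leq_eqVlt => /orP[/eqP->|/h1].
Qed.

Lemma bits_continuous (Z X : topologicalType) (chi : X -> cantor) (g : Z -> X) :
  bits chi -> (forall z i, nbhs z [set z' | chi (g z') i = chi (g z) i]) ->
  continuous g.
Proof.
move=> [_ _ nb] h z A /nb[n hn].
by apply: filterS (nbhs_agree n (h z)) => z' h'; apply: hn.
Qed.

Lemma initial_nbhs (S : choiceType) (T : topologicalType) (f : S -> T) x A :
  nbhs (x : initial_topology f) A ->
  exists2 B, nbhs (f x) B & f @^-1` B `<=` A.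
Proof.
rewrite nbhsE => -[_ [[B oB <-] Bx] BA]; exists B => //.
by exists B; first split.
Qed.

Lemma prod_nbhs_agree (I : Type) (T : topologicalType) (e : I -> nat)
    (x : prod_topology (fun _ : I => T)) (A : set (prod_topology (fun _ : I => T))) :
  (forall t : T, nbhs t [set t]) -> nbhs x A ->
  exists n, forall x' : I -> T, (forall i, (e i < n)%N -> x' i = x i) -> A x'.
Proof.
move=> disc.
pose F : set_system (prod_topology (fun _ : I => T)) := fun A => exists n,
  forall x' : I -> T, (forall i, (e i < n)%N -> x' i = x i) -> A x'.
have FF : Filter F.
  split.
  - by exists 0%N.
  - move=> P P' [n hn] [n' hn']; exists (maxn n n') => x' h; split.
      by apply: hn => i ien; apply: h; rewrite (leq_trans ien) ?leq_maxl.
    by apply: hn' => i ien; apply: h; rewrite (leq_trans ien) ?leq_maxr.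
  - by move=> P P' PP' [n hn]; exists n => x' /hn/PP'.
suff h : F --> x by move=> nA; exact: (h A nA).
apply/cvg_sup => i U /= nU.
have [B nB BU] := initial_nbhs nU; exists (e i).+1 => x' hx'; apply: BU => /=.
by rewrite hx' //; exact: nbhs_singleton nB.
Qed.

Lemma prod_nbhs_coord (I : Type) (T : topologicalType)
    (x : prod_topology (fun _ : I => T)) (i : I) :
  (forall t : T, nbhs t [set t]) ->
  nbhs x [set x' : prod_topology (fun _ : I => T) | x' i = x i].
Proof.
move=> disc; have /cvg_sup/(_ i) h : x --> x by apply: cvg_id.
have : nbhs (x : initial_topology (fun f : prod_topology (fun _ : I => T) => f i))
    [set x' | x' i = x i].
  rewrite nbhsE; exists [set x' | x' i = x i] => //; split=> //.
  exists [set x i] => //; rewrite openE => t ->; exact: disc.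
by move=> /h.
Qed.

Lemma bool_disc (b : bool) : nbhs b [set b]. Proof. exact: discrete_set1. Qed.
Lemma nat_disc (b : nat) : nbhs b [set b]. Proof. exact: discrete_set1. Qed.

(** The bits of a code; bits at numbers that are not pairs are redundant. *)
Definition code_bits (c : lo_code) : cantor := fun i => c (natfst i, natsnd i).

Definition of_bits (w : cantor) : lo_code := fun p => w (natpair p.1 p.2).

Lemma code_bitsK : cancel code_bits of_bits.
Proof.
by move=> c; apply/funext => -[m n]; rewrite /of_bits /code_bits natfstK natsndK.
Qed.

Section SubBits.
Context (S : set lo_code).

Definition sub_bits (x : S) : cantor := code_bits (val x).

Lemma sub_bits_bits : bits sub_bits.
Proof.
split.
- by move=> x y /(can_inj code_bitsK)/val_inj.
- move=> x i; have := @initial_continuous _ _ (val : S -> lo_code) x.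
  move=> /(_ [set c : lo_code | c (natfst i, natsnd i) = val x (natfst i, natsnd i)]).
  by apply; apply: prod_nbhs_coord; apply: bool_disc.
- move=> x A /initial_nbhs[U nU UA].
  have [n hn] := prod_nbhs_agree (fun p => natpair p.1 p.2) bool_disc nU.
  exists n => x' h; apply: UA => /=; apply: hn => -[i j] /= ijn.
  by have := h _ ijn; rewrite /sub_bits /code_bits natfstK natsndK.
Qed.

End SubBits.

(** The bits of a pair. *)
Definition pair_bits (w w' : cantor) : cantor :=
  fun i => if odd i then w' i./2 else w i./2.

Definition fst_bits (w : cantor) : cantor := fun i => w i.*2.
Definition snd_bits (w : cantor) : cantor := fun i => w i.*2.+1.

Lemma fst_bitsK w w' : fst_bits (pair_bits w w') = w.
Proof. by apply/funext => i; rewrite /fst_bits /pair_bits odd_double doubleK. Qed.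

Lemma snd_bitsK w w' : snd_bits (pair_bits w w') = w'.
Proof.
by apply/funext => i; rewrite /snd_bits /pair_bits /= odd_double uphalf_double.
Qed.

Lemma prod_bits (X Y : topologicalType) (chi : X -> cantor) (chi' : Y -> cantor) :
  bits chi -> bits chi' -> bits (fun p : X * Y => pair_bits (chi p.1) (chi' p.2)).
Proof.
move=> [i1 b1 n1] [i2 b2 n2]; split.
- move=> [x y] [x' y'] /= e; congr (_, _).
    by apply: i1; rewrite -[LHS](fst_bitsK _ (chi' y)) e fst_bitsK.
  by apply: i2; rewrite -[LHS](snd_bitsK (chi x)) e snd_bitsK.
- move=> [x y] i; rewrite /pair_bits /=; case: (odd i).
    exists (setT, [set y' | chi' y' i./2 = chi' y i./2]).
      by split; [exact: filterT|exact: b2].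
    by move=> [x' y'] [].
  exists ([set x' | chi x' i./2 = chi x i./2], setT).
    by split; [exact: b1|exact: filterT].
  by move=> [x' y'] [].
- move=> [x y] A [[P P'] /= [/n1[n hn] /n2[n' hn']] PA].
  exists (maxn n n').*2 => -[x' y'] h; apply: PA; split=> /=.
    apply: hn => i i_n; have := h i.*2.
    rewrite /pair_bits /= odd_double doubleK; apply.
    by rewrite ltn_double (leq_trans i_n) ?leq_maxl.
  apply: hn' => i i_n; have := h i.*2.+1.
  rewrite /pair_bits /= odd_double uphalf_double; apply.
  by rewrite ltn_Sdouble (leq_trans i_n) ?leq_maxr.
Qed.

(** Subsets of [X] that are, through [chi], traces of analytic subsets of Cantor space. *)
Definition souslin (X : Type) (chi : X -> cantor) (A : set X) : Prop :=
  exists2 B, sigma11 B & forall x, A x <-> B (chi x).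

Section Souslin.
Context (X : topologicalType) (chi : X -> cantor).
Hypothesis hchi : bits chi.

Lemma souslin_all (A : nat -> set X) : (forall n, souslin chi (A n)) ->
  souslin chi [set x | forall n, A n x].
Proof.
move=> h0; have h n := cid2 (h0 n).
exists (fun w => forall n, s2val (h n) w).
  by apply: sigma11_all => n; apply: s2valP.
by move=> x; split=> hx n; apply/(s2valP' (h n)).
Qed.

Lemma souslin_ex (A : nat -> set X) : (forall n, souslin chi (A n)) ->
  souslin chi [set x | exists n, A n x].
Proof.
move=> h0; have h n := cid2 (h0 n).
exists (fun w => exists n, s2val (h n) w).
  by apply: sigma11_ex => n; apply: s2valP.
by move=> x; split=> -[n hx]; exists n; apply/(s2valP' (h n)).
Qed.

Lemma souslinI A A' : souslin chi A -> souslin chi A' -> souslin chi (A `&` A').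
Proof.
move=> [B hB e] [B' hB' e']; exists (fun w => B w /\ B' w); first exact: sigma11_and.
by move=> x; rewrite /setI /= e e'.
Qed.

Lemma souslinU A A' : souslin chi A -> souslin chi A' -> souslin chi (A `|` A').
Proof.
move=> [B hB e] [B' hB' e']; exists (fun w => B w \/ B' w); first exact: sigma11_or.
by move=> x; rewrite /setU /= e e'.
Qed.

Lemma souslin_closed A : closed A -> souslin chi A.
Proof.
case: hchi => _ bb nb cA.
exists (fun w => forall n, exists2 x, agree n w (chi x) & A x).
  apply: sigma11_clo => w h n; have [w' ww' hw'] := h n.
  by have [x h1 Ax] := hw' n; exists x => //; exact: (agree_trans ww' h1).
move=> x; split=> [Ax n|h]; first by exists x.
apply: cA => U /nb[n hn]; have [y xy Ay] := h n.
by exists y; split=> //; apply: hn.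
Qed.

Lemma souslin_open A : open A -> souslin chi A.
Proof.
case: hchi => _ bb nb oA.
exists (fun w => exists n, forall x, agree n w (chi x) -> A x).
  apply: sigma11_ex => n; apply: sigma11_clo => w h x wx.
  have [w' ww' h'] := h n; apply: h'; exact: (agree_trans (agree_sym ww') wx).
move=> x; split=> [Ax|[n]]; last exact.
have /nb[n hn] : nbhs x A by apply: open_nbhs_nbhs; split.
by exists n.
Qed.

Lemma souslin_borel A : borel A -> souslin chi A.
Proof.
move=> bA; suff : souslin chi A /\ souslin chi (~` A) by case.
apply: (bA [set A : set X | souslin chi A /\ souslin chi (~` A)]).
split; last first.
  move=> U oU; split; first exact: souslin_open.
  by apply: souslin_closed; rewrite closedC.
split.
- split; first by apply: souslin_open; exact: open0.
  by apply: souslin_closed; rewrite closedC; exact: open0.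
- by move=> U [h h']; rewrite setTD; split=> //; rewrite setCK.
- move=> F hF; split.
    have -> : (\bigcup_k F k) = [set x | exists n, F n x].
      by apply/seteqP; split=> x [n]; [exists n|exists n].
    by apply: souslin_ex => n; case: (hF n).
  have -> : ~` (\bigcup_k F k) = [set x | forall n, (~` F n) x].
    apply/seteqP; split=> x h; first by move=> n Fn; apply: h; exists n.
    by move=> [n _ Fn]; apply: (h n).
  by apply: souslin_all => n; case: (hF n).
Qed.

(** As [g] need not extend to Cantor space, the preimage is obtained by projecting
    the closure of the set of pairs of a [chi x] and a witness for [chi' (g x)]. *)
Lemma souslin_preimage (X' : topologicalType) (chi' : X' -> cantor)
    (g : X -> X') (A : set X') :
  bits chi' -> continuous g -> souslin chi' A -> souslin chi (g @^-1` A).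
Proof.
case: hchi => _ _ nb [_ b' _] cg [B [Q cQ hB] e].
pose Q' w y := forall n, exists x y',
  [/\ agree n w (chi x), agree n y y' & Q (chi' (g x)) y'].
exists (fun w => exists y, Q' w y).
  exists Q' => // w y h n; have [w' [y' [ww' yy' hw']]] := h n.
  have [x [y'' [h1 h2 h3]]] := hw' n; exists x, y''; split=> //.
    exact: (agree_trans ww' h1).
  exact: (agree_trans yy' h2).
move=> x; rewrite /preimage /= e hB; split=> -[y hy]; exists y.
  by move=> n; exists x, y.
apply: cQ => n.
have /cg/nb[m hm] : nbhs (g x) [set z | agree n (chi' (g x)) (chi' z)].
  exact: nbhs_agree.
have [x' [y' [h1 h2 h3]]] := hy (maxn m n).
exists (chi' (g x')), y'; split=> //.
  by apply: hm; apply: (agree_le h1); rewrite leq_maxl.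
by apply: (agree_le h2); rewrite leq_maxr.
Qed.

End Souslin.

Import Order.TTheory GRing.Theory Num.Theory.

(** * Polish spaces *)

Section Polish.
Local Open Scope ring_scope.
Context (R : realType).

(** The radii used to approximate points. *)
Definition half_pow (n : nat) : R := ((2 ^ n)%N%:R)^-1.

Lemma half_pow_gt0 n : 0 < half_pow n.
Proof. by rewrite invr_gt0 ltr0n expn_gt0. Qed.

Lemma half_powS n : half_pow n.+1 = half_pow n / 2.
Proof. by rewrite /half_pow expnS natrM invfM mulrC. Qed.

Lemma ltr_half_pow m n : (half_pow m < half_pow n) = (n < m)%N.
Proof.
rewrite /half_pow ltf_pV2 ?posrE ?ltr0n ?expn_gt0 // ltr_nat ltn_exp2l //.
Qed.

Lemma ler_half_pow m n : (half_pow m <= half_pow n) = (n <= m)%N.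
Proof. by rewrite leNgt ltr_half_pow -leqNgt. Qed.

Lemma half_pow_small (e : R) : 0 < e -> exists n, forall m, (n <= m)%N -> half_pow m < e.
Proof.
move=> e0; pose n := Num.bound e^-1; exists n => m nm.
rewrite -[e]invrK /half_pow ltf_pV2 ?posrE ?ltr0n ?expn_gt0 ?invr_gt0 //.
apply: lt_le_trans (archi_boundP _) _; first by rewrite invr_ge0 ltW.
by rewrite ler_nat (leq_trans nm) // ltnW // ltn_expl.
Qed.

Section Metric.
Context (P : topologicalType) (d : P -> P -> R).
Hypothesis dm : is_metric d.
Hypothesis dn : forall (x : P) (A : set P),
  nbhs x A <-> exists2 e, 0 < e & [set y | d x y < e] `<=` A.

Let dsym x y : d x y = d y x. Proof. by case: dm. Qed.
Let dtri y x z : d x z <= d x y + d y z. Proof. by case: dm => _ _ _; apply. Qed.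
Let dxx x : d x x = 0. Proof. by case: dm => _ + _ _; move=> ->. Qed.

(** A countable dense set has an enumeration, possibly with other values. *)
Lemma dense_enum (D : set P) : countable D -> dense D -> inhabited P ->
  exists u : nat -> P, forall p e, 0 < e -> exists n, d (u n) p < e.
Proof.
move=> /countable_injP[c cI] dD [p0].
have /choice[u hu] n : exists q, forall q', D q' -> c q' = n -> q = q'.
  have [[q Dq qn]|nq] := pselect (exists2 q, D q & c q = n).
    exists q => q' Dq' q'n; apply: cI; rewrite ?inE //.
    by rewrite qn q'n.
  by exists p0 => q' Dq' q'n; exfalso; apply: nq; exists q'.
exists u => p e e0.
have [|q [pq Dq]] := dD (interior [set y | d p y < e]) _ (open_interior _).
  exists p; apply/dn; exists e => //.
exists (c q); rewrite (hu _ q Dq erefl) dsym.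
by move: pq => /interior_subset.
Qed.

(** Distinct points of a Polish space with a basis of clopen sets are separated
    by a sequence of clopen sets. *)
Lemma clopen_bits (D : set P) : countable D -> dense D -> clopen_basis P ->
  exists chi : P -> cantor, injective chi /\
    forall x i, nbhs x [set x' | chi x' i = chi x i].
Proof.
move=> cD dD cb; have [inh|ninh] := pselect (inhabited P); last first.
  by exists (fun=> fun=> false); split=> x; exfalso; apply: ninh.
have [u hu] := dense_enum cD dD inh.
pose B n m := [set x | d (u n) x < half_pow m].
pose good i (U : set P) := [/\ clopen U,
  B (natfst (natfst i)) (natsnd (natfst i)) `<=` U &
  B (natfst (natsnd i)) (natsnd (natsnd i)) `<=` ~` U].
have /choice[U hU] i : exists U, clopen U /\ ((exists V, good i V) -> good i U).
  have [[V hV]|nV] := pselect (exists V, good i V).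
    by exists V; split=> //; case: hV.
  by exists set0; split=> //; split; [exact: open0|exact: closed0].
exists (fun x i => `[< U i x >]); split=> [x y exy|x i]; last first.
  have [oU cU] := (hU i).1.
  have [Ux|nUx] := pselect (U i x).
    have : nbhs x (U i) by apply: open_nbhs_nbhs.
    by apply: filterS => x' Ux' /=; rewrite !asboolT.
  have : nbhs x (~` U i) by apply: open_nbhs_nbhs; split=> //; rewrite openC.
  by apply: filterS => x' Ux' /=; rewrite !asboolF.
apply: contrapT => nxy.
have dxy : 0 < d x y.
  rewrite lt_neqAle; case: dm => d0 d1 _ _; rewrite d0 andbT eq_sym.
  by apply/eqP => /d1.
have [V [[oV cV] Vx Vy]] : exists U, [/\ clopen U, U x & U `<=` ~` [set y]].
  apply: cb; apply/dn; exists (d x y) => // z /= dxz zy; move: dxz.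
  by rewrite zy ltxx.
have small (W : set P) z : open W -> W z -> exists n m, B n m z /\ B n m `<=` W.
  move=> oW Wz; have /dn[e e0 eW] : nbhs z W by apply: open_nbhs_nbhs.
  have [m hm] := half_pow_small (e := e / 2) (divr_gt0 e0 (ltr0Sn _ _)).
  have [n hn] := hu z _ (half_pow_gt0 m); exists n, m; split=> // t /= nt.
  apply: eW => /=; apply: le_lt_trans (dtri (u n) _ _) _.
  by rewrite (splitr e) dsym ltrD // (lt_trans _ (hm m (leqnn m))).
have [n [m [xnm nmV]]] := small V x oV Vx.
have [n' [m' [ynm nmV']]] : exists n m, B n m y /\ B n m `<=` ~` V.
  by apply: small; [rewrite openC|move=> Vyy; exact: (Vy y Vyy erefl)].
pose i := natpair (natpair n m) (natpair n' m').
have [|_ gx gy] := (hU i).2.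
  exists V; rewrite /good /i !natfstK !natsndK !natfstK.
  by split=> //; split.
rewrite /i !natfstK !natsndK !natfstK in gx gy.
have := congr1 (fun f => f i) exy; rewrite asboolT; last exact: gx.
by rewrite asboolF //; exact: gy.
Qed.

(** A continuous image of a Polish space in a space with a continuous injection into
    Cantor space. *)
Lemma complete_range_souslin (X : topologicalType) (chi : X -> cantor) (D : set P)
    (f : P -> X) : countable D -> dense D -> metric_complete d ->
  injective chi -> (forall x i, nbhs x [set x' | chi x' i = chi x i]) ->
  continuous f -> souslin chi (range f).
Proof.
move=> cD dD compl chiI chib cf.
have [inh|ninh] := pselect (inhabited P); last first.
  exists (fun=> False); last by move=> x; split=> // -[p]; exfalso; apply: ninh.
  by apply: sigma11_clo => w /(_ 0%N)[].
have [u hu] := dense_enum cD dD inh.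
(* [y] codes a sequence of approximations [u (y k)] of a point *)
pose near w (y : baire) k := exists p,
  d (u (y k)) p < half_pow k /\ agree k w (chi (f p)).
pose Q w (y : baire) := forall k,
  d (u (y k)) (u (y k.+1)) < half_pow k /\ near w y k.
exists (fun w => exists y, Q w y).
  exists Q => //; apply: clo2_all => k; apply: clo2_and; apply: clo2_lc.
    apply: (lc_app2 (fun a b => d (u a) (u b) < half_pow k : Prop));
      exact: lc_y (lc_cst _).
  move=> w y; exists k.+1 => w' y' ww' yy'; apply/propext; rewrite /near yy' //.
  split=> -[p [h1 h2]]; exists p; split=> // i ik.
    by rewrite -h2 // ww' // ltnW.
  by rewrite -h2 // ww' // ltnW.
move=> x; split=> [[p _ <-]|[y hy]].
  have /choice[y hy] k := hu p (half_pow k.+2) (half_pow_gt0 _).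
  exists y => k; split; last first.
    exists p; split=> //; apply: lt_le_trans (hy k) _.
    by rewrite ler_half_pow (leq_trans (leqnSn k)).
  apply: le_lt_trans (dtri p _ _) _; rewrite [d p _]dsym.
  have h0 := half_pow_gt0 k; have h1 := hy k; have h2 := hy k.+1.
  rewrite !half_powS in h1 h2; lra.
have geo m j : d (u (y m)) (u (y (m + j)%N)) <= 2 * half_pow m - 2 * half_pow (m + j)%N.
  elim: j => [|j IH]; first by rewrite addn0 dxx subrr.
  rewrite addnS; apply: le_trans (dtri (u (y (m + j)%N)) _ _) _.
  have := (hy (m + j)%N).1; rewrite half_powS; lra.
have geo2 m n : (m <= n)%N -> d (u (y m)) (u (y n)) < 2 * half_pow m.
  move=> mn; have := geo m (n - m)%N; rewrite subnKC //.
  by have := half_pow_gt0 n; lra.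
have [|l hl] := compl (fun n => u (y n)).
  move=> e e0; have [N hN] := half_pow_small (e := e / 4) (divr_gt0 e0 (ltr0Sn _ _)).
  exists N => m n Nm Nn; apply: le_lt_trans (dtri (u (y N)) _ _) _.
  rewrite dsym; have := geo2 _ _ Nm; have := geo2 _ _ Nn.
  have := hN N (leqnn N); lra.
exists l => //; apply: chiI; apply/funext => i.
have /cf/dn[e e0 he] := chib (f l) i.
have [N hN] := half_pow_small (e := e / 2) (divr_gt0 e0 (ltr0Sn _ _)).
have [N' hN'] := hl (e / 2) (divr_gt0 e0 (ltr0Sn _ _)).
pose k := maxn i.+1 (maxn N N').
have [ik Nk N'k] : [/\ (i < k)%N, (N <= k)%N & (N' <= k)%N].
  by rewrite /k !leq_max !leqnn !orbT.
have [_ [p [hp ag]]] := hy k.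
rewrite ag //; have -> // := he p; rewrite /=.
apply: le_lt_trans (dtri (u (y k)) _ _) _; rewrite dsym.
have := hN' k N'k; have := hN k Nk; lra.
Qed.

End Metric.

Lemma analytic_souslin (X : topologicalType) (chi : X -> cantor) (A : set X) :
  injective chi -> (forall x i, nbhs x [set x' | chi x' i = chi x i]) ->
  analytic R A -> souslin chi A.
Proof.
move=> chiI chib [P [f [[[D cD dD] [d [dm dn dc]]] cf ->]]].
exact: (complete_range_souslin dm dn cD dD dc chiI chib cf).
Qed.

(** A Polish space with a basis of clopen sets has a continuous injection into
    Cantor space. *)
Lemma polish_bits (Z : topologicalType) : polish R Z -> clopen_basis Z ->
  exists chi : Z -> cantor, injective chi /\
    forall x i, nbhs x [set x' | chi x' i = chi x i].
Proof.
by move=> [[D cD dD] [d [dm dn _]]]; apply: (clopen_bits dm dn cD dD).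
Qed.

End Polish.

(** ** Closed subsets of Baire space are Polish *)

(** Baire space with its product topology. *)
Definition baire_space : Type := prod_topology (fun _ : nat => nat).
HB.instance Definition _ := Topological.on baire_space.

Section BaireMetric.
Local Open Scope ring_scope.
Context (R : realType) (F : set baire_space).
Hypothesis closedF : forall z : baire,
  (forall n, exists2 z' : baire, agree n z z' & F z') -> F z.

Local Notation P := (set_type F).

(** The distance of two sequences is determined by the first index at which
    they differ. *)
Definition baire_dist (x y : P) : R :=
  if pselect (exists n, (val x : baire) n != (val y : baire) n) is left h
  then half_pow R (ex_minn h) else 0.

Lemma baire_dist_lt x y n :
  baire_dist x y < half_pow R n <-> agree n.+1 (val x : baire) (val y).
Proof.
rewrite /baire_dist; case: pselect => [h|nh]; last first.
  split=> _; last exact: half_pow_gt0.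
  by move=> i _; apply: contrapT => /eqP ne; apply: nh; exists i.
case: ex_minnP => m ne hm; rewrite ltr_half_pow; split=> [nm i i_n|ag].
  apply: contrapT => /eqP/hm; rewrite leqNgt => /negP; apply.
  exact: leq_trans nm.
by rewrite ltnNge; apply/negP => mn; move/eqP: ne; apply; apply: ag.
Qed.

Lemma baire_dist_ge0 x y : 0 <= baire_dist x y.
Proof.
by rewrite /baire_dist; case: pselect => // h; apply/ltW/half_pow_gt0.
Qed.

Lemma baire_dist_eq0 x y : baire_dist x y = 0 <-> x = y.
Proof.
split=> [d0|->]; last first.
  rewrite /baire_dist; case: pselect => // h; case: ex_minnP => m.
  by rewrite eqxx.
apply/val_inj/funext => n; have : baire_dist x y < half_pow R n.
  by rewrite d0; apply: half_pow_gt0.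
by move/baire_dist_lt; apply.
Qed.

Lemma baire_dist_le x y e : 0 <= e ->
  (forall n, e < half_pow R n -> agree n.+1 (val x : baire) (val y)) ->
  baire_dist x y <= e.
Proof.
move=> e0 h; rewrite /baire_dist; case: pselect => // hx.
case: ex_minnP => m ne _; rewrite leNgt; apply/negP => /h ag.
by move/eqP: ne; apply; apply: ag.
Qed.

Lemma baire_dist_metric : is_metric baire_dist.
Proof.
have sym x y : baire_dist x y <= baire_dist y x.
  by apply: baire_dist_le (baire_dist_ge0 _ _) _ => n /baire_dist_lt/agree_sym.
split.
- exact: baire_dist_ge0.
- exact: baire_dist_eq0.
- by move=> x y; apply/eqP; rewrite eq_le !sym.
- move=> x y z; have h1 := baire_dist_ge0 x y; have h2 := baire_dist_ge0 y z.
  apply: baire_dist_le => [|n hn]; first exact: addr_ge0.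
  apply: (@agree_trans _ _ (val y : baire)); apply/baire_dist_lt; lra.
Qed.

Lemma baire_dist_nbhs x (A : set P) :
  nbhs x A <-> exists2 e, 0 < e & [set y | baire_dist x y < e] `<=` A.
Proof.
split=> [/initial_nbhs[U nU UA]|[e e0 eA]].
  have [n hn] := prod_nbhs_agree (fun i => i) nat_disc nU.
  exists (half_pow R n); first exact: half_pow_gt0.
  move=> y /baire_dist_lt ag; apply: UA => /=; apply: hn => i i_n.
  by apply/esym; exact: (ag i (ltnW i_n)).
have [n hn] := half_pow_small e0.
have coord i : nbhs x [set x' : P | (val x' : baire) i = (val x : baire) i].
  have := @initial_continuous _ _ (val : P -> baire_space) x.
  move=> /(_ [set z : baire_space | z i = (val x : baire) i]).
  by apply; apply: prod_nbhs_coord; apply: nat_disc.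
apply: filterS (nbhs_agree (F := fun z : P => val z : baire) n.+1 coord) => y ag.
by apply: eA => /=; apply: lt_trans (hn n (leqnn n)); apply/baire_dist_lt.
Qed.

Lemma baire_dist_complete : metric_complete baire_dist.
Proof.
move=> u hu; have /choice[N hN] n := hu _ (half_pow_gt0 R n).
pose l : baire := fun i => (val (u (N i)) : baire) i.
have uN m n k : (N k <= m)%N -> (N k <= n)%N ->
    agree k.+1 (val (u m) : baire) (val (u n)).
  by move=> km kn; apply/baire_dist_lt; apply: hN.
have lim k : exists N', forall n, (N' <= n)%N -> agree k l (val (u n) : baire).
  elim: k => [|k [N' h]]; first by exists 0%N.
  exists (maxn N' (N k)) => n; rewrite geq_max => /andP[N'n Nkn] i.
  rewrite ltnS leq_eqVlt => /orP[/eqP->|]; last exact: h.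
  by apply: (uN (N k) n k).
have Fl : F l.
  apply: closedF => k; have [N' h] := lim k.
  exists (val (u N') : baire); first exact: h.
  exact: set_valP.
exists (SigSub (mem_set Fl) : P) => e e0; have [n hn] := half_pow_small e0.
have [N' h] := lim n.+1; exists N' => m N'm.
apply: lt_trans (hn n (leqnn n)); apply/baire_dist_lt/agree_sym; exact: h.
Qed.

Lemma closed_baire_polish : polish R P.
Proof.
split; last first.
  exists baire_dist; split.
  - exact: baire_dist_metric.
  - exact: baire_dist_nbhs.
  - exact: baire_dist_complete.
have /choice[c hc] (s : seq nat) : exists o : option P,
    (exists z : P, agree (size s) (nth 0%N s) (val z : baire)) ->
    exists2 z : P, o = Some z & agree (size s) (nth 0%N s) (val z : baire).
  have [[z hz]|nz] := pselect (exists z : P, agree (size s) (nth 0%N s) (val z : baire)).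
    by exists (Some z) => _; exists z.
  by exists None => /nz.
pose D := [set z : P | exists s, c s = Some z].
exists D.
  have /choice[g hg] (z : P) : exists s, D z -> c s = Some z.
    have [[s hs]|nz] := pselect (D z); first by exists s.
    by exists [::] => /nz.
  apply/countable_injP; exists (fun z => CodeSeq.code (g z)) => z z'.
  rewrite !inE => Dz Dz' /(can_inj CodeSeq.codeK) e.
  by have := hg _ Dz; rewrite e hg // => -[].
move=> O [z Oz] oO.
have /baire_dist_nbhs[e e0 eO] : nbhs z O by apply: open_nbhs_nbhs; split.
have [n hn] := half_pow_small e0.
pose s := mkseq (val z : baire) n.+1.
have [|z' cs ag] := hc s.
  by exists z => i; rewrite size_mkseq => i_n; rewrite nth_mkseq.
exists z'; split; last by exists s.
apply: eO => /=; apply: lt_trans (hn n (leqnn n)); apply/baire_dist_lt => i i_n.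
by rewrite -ag ?size_mkseq // nth_mkseq.
Qed.

End BaireMetric.

(** ** Analytic subsets of presented spaces *)

Section Presented.
Context (R : realType) (X : topologicalType) (chi : X -> cantor).
Hypothesis hchi : bits chi.
(** The image of [chi] is itself analytic. *)
Hypothesis chi_range : exists2 G, sigma11 G & forall w, G w <-> exists x, chi x = w.

Lemma souslin_analytic (A : set X) : souslin chi A -> analytic R A.
Proof.
case: chi_range => G sG hG [B sB hB]; have [Q cQ hQ] := sigma11_and sG sB.
pose w (z : baire) : cantor := fun i => z i.*2 != 0%N.
pose y (z : baire) : baire := fun i => z i.*2.+1.
pose F : set baire_space := [set z : baire | Q (w z) (y z)].
have cF (z : baire) : (forall n, exists2 z' : baire, agree n z z' & F z') -> F z.
  move=> h; apply: cQ => n; have [z' ag Fz'] := h n.*2.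
  exists (w z'), (y z'); split=> // i i_n; first by rewrite /w ag // ltn_double.
  by rewrite /y ag // ltn_Sdouble.
have ex (p : set_type F) : exists x, chi x = w (val p).
  have Fp := set_valP p; apply/hG.
  by case: ((hQ (w (val p))).2 (ex_intro _ (y (val p)) Fp)).
have [f hf] := choice ex.
exists (set_type F), f; split.
- exact: closed_baire_polish.
- apply: (bits_continuous hchi) => p i; rewrite hf.
  have := @initial_continuous _ _ (val : set_type F -> baire_space) p.
  move=> /(_ [set z : baire_space | z i.*2 = (val p : baire) i.*2]) h.
  have : nbhs p [set p' : set_type F | (val p' : baire) i.*2 = (val p : baire) i.*2].
    by apply: h; apply: prod_nbhs_coord; apply: nat_disc.
  by apply: filterS => p' e; rewrite /= hf; exact: (congr1 (fun a => a != 0%N) e).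
- apply/seteqP; split=> [x|_ [p _ <-]].
    move=> /hB Bx; have Gx : G (chi x) by apply/hG; exists x.
    have [v hv] := (hQ (chi x)).1 (conj Gx Bx).
    pose z : baire := fun i => if odd i then v i./2 else chi x i./2.
    have wz : w z = chi x.
      by apply/funext => i; rewrite /w /z odd_double doubleK; case: (chi x i).
    have yz : y z = v.
      by apply/funext => i; rewrite /y /z /= odd_double uphalf_double.
    have Fz : F z by rewrite /F /= wz yz.
    exists (SigSub (mem_set Fz)) => //; case: hchi => inj _ _.
    by apply: inj; rewrite hf.
  apply/hB; rewrite hf; have Fp := set_valP p.
  by case: ((hQ (w (val p))).2 (ex_intro _ (y (val p)) Fp)).
Qed.

End Presented.

(** ** The spaces of codes *)

Lemma sigma11_lc (P : cantor -> Prop) : lc (fun w (_ : baire) => P w) -> sigma11 P.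
Proof.
move=> hP; exists (fun w _ => P w); first exact: clo2_lc.
by move=> w; split=> [Pw|[]//]; exists (fun=> 0%N).
Qed.

(** Conditions on finitely many entries of a code. *)
Lemma sigma11_bits1 (h : bool -> Prop) p : sigma11 (fun w => h (of_bits w p)).
Proof. by apply: sigma11_lc; apply: lc_app1; apply: (lc_w (lc_cst _)). Qed.

Lemma sigma11_bits3 (h : bool -> bool -> bool -> Prop) p q r :
  sigma11 (fun w => h (of_bits w p) (of_bits w q) (of_bits w r)).
Proof.
apply: sigma11_lc; apply: (lc_app2 (fun (a : bool) (bc : bool * bool) => h a bc.1 bc.2)
  (F := fun w _ => of_bits w p) (G := fun w _ => (of_bits w q, of_bits w r))).
  exact: (lc_w (lc_cst _)).
by apply: lc_app2; apply: (lc_w (lc_cst _)).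
Qed.

Lemma sigma11_bits4 (h : bool -> bool -> bool -> bool -> Prop) p q r s :
  sigma11 (fun w => h (of_bits w p) (of_bits w q) (of_bits w r) (of_bits w s)).
Proof.
apply: sigma11_lc; apply: (lc_app2 (fun (a bc : bool * bool) => h a.1 a.2 bc.1 bc.2)
  (F := fun w _ => (of_bits w p, of_bits w q))
  (G := fun w _ => (of_bits w r, of_bits w s))).
  by apply: lc_app2; apply: (lc_w (lc_cst _)).
by apply: lc_app2; apply: (lc_w (lc_cst _)).
Qed.

Lemma sigma11_linear : sigma11 (fun w => linear_order_code (of_bits w)).
Proof.
pose c w : lo_code := of_bits w.
apply: (sigma11_ext (B := fun w => (exists n, c w (n, n)) /\
  ((forall m n, c w (m, n) -> c w (m, m) /\ c w (n, n)) /\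
  ((forall m n, c w (m, n) -> c w (n, m) -> m = n) /\
  ((forall n m p, c w (m, n) -> c w (n, p) -> c w (m, p)) /\
  (forall m n, c w (m, m) -> c w (n, n) -> c w (m, n) \/ c w (n, m))))))).
  move=> w; split=> [[h1 [h2 [h3 [h4 h5]]]]|h]; first exact: linear_order_codeI.
  split; first by case: h.
  split; first exact: (code_dom h).
  split; first exact: (code_anti h).
  split; first by move=> n m p; exact: (code_trans h).
  exact: (code_total h).
apply: sigma11_and.
  by apply: sigma11_ex => n; apply: sigma11_bits1.
apply: sigma11_and.
  apply: sigma11_all => m; apply: sigma11_all => n.
  exact: (sigma11_bits3 (fun a b c => a -> b /\ c)).
apply: sigma11_and.
  apply: sigma11_all => m; apply: sigma11_all => n.
  exact: (sigma11_bits3 (fun a b c => a -> b -> m = n) _ _ (m, n)).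
apply: sigma11_and.
  apply: sigma11_all => m; apply: sigma11_all => n; apply: sigma11_all => p.
  exact: (sigma11_bits3 (fun a b c => a -> b -> c)).
apply: sigma11_all => m; apply: sigma11_all => n.
exact: (sigma11_bits4 (fun a b c d => a -> b -> c \/ d)).
Qed.

(** The sequences of bits that come from codes. *)
Lemma sigma11_image : sigma11 (fun w => code_bits (of_bits w) = w).
Proof.
apply: (sigma11_ext (B := fun w => forall i, code_bits (of_bits w) i = w i)).
  by move=> w; split=> [h|->//]; apply/funext.
apply: sigma11_all => i; apply: sigma11_lc.
apply: (lc_app2 (fun a b : bool => a = b)).
  exact: (lc_w (lc_cst (natpair (natfst i) (natsnd i)))).
exact: (lc_w (lc_cst i)).
Qed.

Lemma sub_bits_range (S : set lo_code) : sigma11 (fun w => S (of_bits w)) ->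
  exists2 G, sigma11 G & forall w, G w <-> exists x : S, sub_bits x = w.
Proof.
move=> hS; exists (fun w => S (of_bits w) /\ code_bits (of_bits w) = w).
  exact: sigma11_and hS sigma11_image.
move=> w; split=> [[Sw ww]|[x <-]]; first by exists (SigSub (mem_set Sw)).
by rewrite /sub_bits code_bitsK; split=> //; apply: set_valP.
Qed.

Lemma sigma11_LO : sigma11 (fun w => LO (of_bits w)).
Proof.
apply: sigma11_and sigma11_linear _; apply: sigma11_all => n.
exact: (sigma11_bits1 is_true).
Qed.

Lemma finite_set_natP (A : set nat) :
  finite_set A <-> exists b, forall n, A n -> (n < b)%N.
Proof.
split=> [/finite_seqP[s ->]|[b hb]].
  exists (\max_(i <- s) i).+1 => n /= ns; rewrite ltnS.
  exact: (leq_bigmax_seq (F := fun i => i) n ns).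
by apply: (sub_finite_set _ (finite_II b)) => n /hb.
Qed.

Lemma sigma11_Lin : sigma11 (fun w => Lin (of_bits w)).
Proof.
apply: sigma11_or; last exact: sigma11_LO.
apply: sigma11_and sigma11_linear _.
apply: (sigma11_ext (B := fun w =>
    exists b, forall n, of_bits w (n, n) -> (n < b)%N)).
  by move=> w; rewrite finite_set_natP.
apply: sigma11_ex => b; apply: sigma11_all => n.
exact: (sigma11_bits1 (fun a => a -> (n < b)%N)).
Qed.

Lemma prod_bits_range (X Y : Type) (chi : X -> cantor) (chi' : Y -> cantor) :
  (exists2 G, sigma11 G & forall w, G w <-> exists x, chi x = w) ->
  (exists2 G, sigma11 G & forall w, G w <-> exists x, chi' x = w) ->
  exists2 G, sigma11 G &
    forall w, G w <-> exists p : X * Y, pair_bits (chi p.1) (chi' p.2) = w.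
Proof.
move=> [G sG hG] [G' sG' hG'].
exists (fun w => G (fst_bits w) /\ G' (snd_bits w)); last first.
  move=> w; split=> [[/hG[x xw] /hG'[y yw]]|[[x y] <-]] /=; last first.
    by rewrite fst_bitsK snd_bitsK; split; [apply/hG; exists x|apply/hG'; exists y].
  exists (x, y); rewrite /= xw yw; apply/funext => i.
  rewrite /pair_bits /fst_bits /snd_bits.
  have := odd_double_half i; case: (odd i) => /= e; congr (w _);
    by rewrite -[RHS]e ?add0n ?add1n.
have sub (B : cantor -> Prop) (s : nat -> nat) :
    sigma11 B -> sigma11 (fun w => B (fun i => w (s i))).
  move=> [Q cQ hQ]; exists (fun w y => Q (fun i => w (s i)) y); last by move=> w; rewrite hQ.
  apply: (clo2_comp (F := fun w _ i => w (s i)) (G := fun _ y => y)) => // i.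
    exact: (lc_w (lc_cst _)).
  exact: (lc_y (lc_cst _)).
by apply: sigma11_and; apply: sub.
Qed.

(** * Piecewise convex embeddability is analytic over an analytic class *)

Definition LO_bits : LO -> cantor := @sub_bits LO.

(** The bits of a pair of codes. *)
Definition LO2_bits (p : LO * LO) : cantor :=
  pair_bits (LO_bits p.1) (LO_bits p.2).

Lemma LO2_bits_bits : bits LO2_bits.
Proof. by apply: prod_bits; apply: sub_bits_bits. Qed.

Lemma LO2_bits_range :
  exists2 G, sigma11 G & forall w, G w <-> exists p, LO2_bits p = w.
Proof. by apply: prod_bits_range; apply: sub_bits_range; apply: sigma11_LO. Qed.

Section PceSouslin.
Context (C : set Lin).
Hypothesis hC : souslin (@sub_bits Lin) C.

(** [z 0] codes the index order, [z 1] witnesses that it belongs to [C], [z 2] and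
    [z 3] are the index of the pieces and the embedding, and [z 4] and [z 5]
    witness surjectivity and convexity. *)
Lemma pce_souslin : souslin LO2_bits (pce_LO C).
Proof.
have [B sB hB] := hC; have [G sG hG] := sub_bits_range sigma11_Lin.
have [QC cQC hQC] := sigma11_and sG sB.
pose v (z : nat -> baire) : cantor := fun i => z 0%N i != 0%N.
pose Kb z a b := v z (natpair a b).
pose Lb (w : cantor) a b := w (natpair a b).*2.
pose Lb' (w : cantor) a b := w (natpair a b).*2.+1.
pose Q w z := QC (v z) (z 1%N) /\
  ((forall n, Kb z (z 2 n) (z 2 n)) /\
  ((forall k, Kb z k k -> z 2 (z 4 k) = k) /\
  ((forall m n, Lb w m n -> Kb z (z 2 m) (z 2 n)) /\
  ((forall m n, Lb w m n = Lb' w (z 3 m) (z 3 n)) /\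
  (forall m n y, z 2 m = z 2 n /\ Lb' w (z 3 m) y /\ Lb' w y (z 3 n) ->
     z 2 (z 5 (natpair m (natpair n y))) = z 2 m /\
     z 3 (z 5 (natpair m (natpair n y))) = y))))).
have sl m I : lc I -> lc (fun w y => slice y m (I w y)).
  by move=> hI; exact: (lc_y (lc_app1 (natpair m) hI)).
have cst n : lc (fun (_ : cantor) (_ : baire) => n : nat) by exact: lc_cst.
have lK I J : lc I -> lc J -> lc (fun w y => Kb (slice y) (I w y) (J w y)).
  move=> hI hJ; exact: (lc_app1 (fun a => a != 0%N) (sl 0%N _ (lc_app2 natpair hI hJ))).
have lL I J : lc I -> lc J -> lc (fun w y => Lb w (I w y) (J w y)).
  move=> hI hJ; exact: (lc_w (lc_app2 (fun a b => (natpair a b).*2) hI hJ)).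
have lL' I J : lc I -> lc J -> lc (fun w y => Lb' w (I w y) (J w y)).
  move=> hI hJ; exact: (lc_w (lc_app2 (fun a b => (natpair a b).*2.+1) hI hJ)).
have leq I J : lc I -> lc J -> lc (fun w y => I w y = J w y :> nat).
  exact: (lc_app2 (fun a b : nat => a = b)).
have sc m n : lc (fun (_ : cantor) y => slice y m n) by exact: sl.
exists (fun w => exists z, Q w z).
  apply: (sigma11_proj (Q := Q)) => //.
  apply: clo2_and.
    apply: (clo2_comp (F := fun _ y => v (slice y)) (G := fun _ y => slice y 1%N)) => // i.
    exact: (lc_app1 (fun a => a != 0%N) (sc 0%N i)).
  have lKt I J (hI : lc I) (hJ : lc J) := lc_app1 is_true (lK _ _ hI hJ).
  apply: clo2_and.
    by apply: clo2_all => n; exact: (clo2_lc (lKt _ _ (sc 2 n) (sc 2 n))).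
  apply: clo2_and.
    apply: clo2_all => k; exact: (clo2_imp (lKt _ _ (cst k) (cst k))
      (clo2_lc (leq _ _ (sl 2 _ (sc 4 k)) (cst k)))).
  apply: clo2_and.
    apply: clo2_all => m; apply: clo2_all => n.
    exact: (clo2_imp (lc_app1 is_true (lL _ _ (cst m) (cst n)))
      (clo2_lc (lKt _ _ (sc 2 m) (sc 2 n)))).
  apply: clo2_and.
    apply: clo2_all => m; apply: clo2_all => n; apply: clo2_lc.
    exact: (lc_app2 (fun a b : bool => a = b) (lL _ _ (cst m) (cst n))
      (lL' _ _ (sc 3 m) (sc 3 n))).
  apply: clo2_all => m; apply: clo2_all => n; apply: clo2_all => y.
  have s5 := sc 5 (natpair m (natpair n y)).
  exact: (clo2_imp (lc_app2 and (leq _ _ (sc 2 m) (sc 2 n))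
      (lc_app2 and (lc_app1 is_true (lL' _ _ (sc 3 m) (cst y)))
        (lc_app1 is_true (lL' _ _ (cst y) (sc 3 n)))))
    (clo2_and (clo2_lc (leq _ _ (sl 2 _ s5) (sc 2 m)))
      (clo2_lc (leq _ _ (sl 3 _ s5) (cst y))))).
have Lfst (p : LO * LO) m n : Lb (LO2_bits p) m n = val p.1 (m, n).
  rewrite /Lb -[LHS]/(fst_bits (LO2_bits p) (natpair m n)) fst_bitsK.
  by rewrite /LO_bits /sub_bits /code_bits natfstK natsndK.
have Lsnd (p : LO * LO) m n : Lb' (LO2_bits p) m n = val p.2 (m, n).
  rewrite /Lb' -[LHS]/(snd_bits (LO2_bits p) (natpair m n)) snd_bitsK.
  by rewrite /LO_bits /sub_bits /code_bits natfstK natsndK.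
move=> p; rewrite /pce_LO /= (pceP C (set_valP p.1) (set_valP p.2)).
have KE z (K : Lin) m n : sub_bits K = v z -> Kb z m n = val K (m, n).
  by rewrite /Kb => <-; rewrite /sub_bits /code_bits natfstK natsndK.
split.
  move=> [K CK [pi [f [h1 h2 h3 h4 h5]]]].
  have /choice[g hg] k : exists n, val K (k, k) -> pi n = k.
    have [/h2[n nk]|nk] := pselect (val K (k, k)); first by exists n.
    by exists 0%N.
  have /choice[h hh] (q : nat) : exists z,
      pi (natfst q) = pi (natfst (natsnd q)) ->
      val p.2 (f (natfst q), natsnd (natsnd q)) ->
      val p.2 (natsnd (natsnd q), f (natfst (natsnd q))) ->
      pi z = pi (natfst q) /\ f z = natsnd (natsnd q).
    have [[e1 e2 e3]|n] := pselect ([/\ pi (natfst q) = pi (natfst (natsnd q)),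
      val p.2 (f (natfst q), natsnd (natsnd q)) &
      val p.2 (natsnd (natsnd q), f (natfst (natsnd q)))]).
      by have [z hz] := h5 _ _ _ e1 e2 e3; exists z.
    by exists 0%N => e1 e2 e3; case: n.
  have [y hy] : exists y, QC (sub_bits K) y.
    by apply/hQC; split; [apply/hG; exists K|apply/hB].
  pose z n : baire := if n == 0%N then fun i => sub_bits K i : nat else
    if n == 1%N then y else if n == 2 then pi else if n == 3 then f else
    if n == 4 then g else h.
  have vz : sub_bits K = v z by apply/funext => i; rewrite /v /z /=; case: (sub_bits K i).
  exists z; split; first by rewrite -vz.
  split; first by move=> n; rewrite (KE _ _ _ _ vz).
  split; first by move=> k; rewrite (KE _ _ _ _ vz); apply: hg.
  split; first by move=> m n; rewrite (KE _ _ _ _ vz) Lfst; apply: h3.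
  split; first by move=> m n; rewrite Lfst Lsnd.
  move=> m n y' [e1 [e2 e3]]; rewrite Lsnd in e2; rewrite Lsnd in e3.
  have hq := hh (natpair m (natpair n y')).
  rewrite !natfstK !natsndK !natfstK in hq; exact: (hq e1 e2 e3).
move=> [z [h0 [h1 [h2 [h3 [h4 h5]]]]]].
have [/hG[K Kv] Bv] : G (v z) /\ B (v z) by apply/hQC; exists (z 1%N).
exists K; first by apply/hB; rewrite Kv.
exists (z 2), (z 3); split.
- by move=> n; rewrite -(KE _ _ _ _ Kv).
- by move=> k; rewrite -(KE _ _ _ _ Kv) => /h2 <-; exists (z 4 k).
- by move=> m n; rewrite -(KE _ _ _ _ Kv) -Lfst; apply: h3.
- by move=> m n; rewrite -Lfst -Lsnd.
- move=> m n y e1; rewrite -!Lsnd => e2 e3.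
  by exists (z 5 (natpair m (natpair n y))); apply: h5.
Qed.

Lemma bi_pce_souslin : souslin LO2_bits (bi_pce_LO C).
Proof.
have -> : bi_pce_LO C = pce_LO C `&` (fun p => (p.2, p.1)) @^-1` pce_LO C.
  by apply/seteqP; split=> -[p q].
apply: (souslinI pce_souslin).
apply: (souslin_preimage LO2_bits_bits LO2_bits_bits) pce_souslin.
exact: swap_continuous.
Qed.

End PceSouslin.

(** * Reducing a class to piecewise convex embeddability *)

Lemma countable_infinite_bij (T : Type) (c : T -> nat) (i : nat -> T) :
  injective c -> injective i ->
  exists (dec : nat -> T) (enc : T -> nat), cancel dec enc /\ cancel enc dec.
Proof.
move=> cI iI.
have inf : ~ finite_set [set: T].
  move=> fT; apply: infinite_nat.
  have -> : [set: nat] = i @^-1` [set: T] by [].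
  by apply: finite_preimage => // x y _ _; apply: iI.
have cT : countable [set: T] by apply/countable_injP; exists c => x y _ _; apply: cI.
have /card_set_bijP[f [_ fI fS]] := eq_card_nat cT inf.
have /choice[g hg] n : exists t, f t = n by have [t _ tn] := fS n I; exists t.
exists g, f; split=> [n|t]; first exact: hg.
by apply: fI; rewrite ?inE // hg.
Qed.

Definition ltQ (q r : rat) : Prop := (q < r)%R.

Lemma ltQ_total : strict_total ltQ.
Proof.
rewrite /ltQ; split=> [x|y x z|x y]; first by rewrite ltxx.
  exact: lt_trans.
by case: (ltgtP x y) => h; [left|right; right|right; left].
Qed.

Lemma ltQ_dense : dense_lt ltQ.
Proof. by move=> x y xy; exists ((x + y) / 2)%R; rewrite /ltQ in xy *; lra. Qed.

Lemma ltQ_above : unbounded_above ltQ.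
Proof. by move=> x; exists (x + 1)%R; rewrite /ltQ; lra. Qed.

Lemma ltQ_below : unbounded_below ltQ.
Proof. by move=> x; exists (x - 1)%R; rewrite /ltQ; lra. Qed.

(** The order type [omega + 1]. *)
Definition ltO (m n : option nat) : Prop :=
  match m, n with
  | Some a, Some b => (a < b)%N
  | Some _, None => True
  | None, _ => False
  end.

Lemma ltO_total : strict_total ltO.
Proof.
split=> [[a|]|[b|] [a|] [c|]|[a|] [b|]] //=; try by [right; left|left|right; right].
- by rewrite ltnn.
- exact: ltn_trans.
- by case: (ltngtP a b) => [h|h|->]; [left|right; right|right; left].
Qed.

(** The rationals with every point replaced by a copy of [omega + 1]. *)
Definition ltS : rat * option nat -> rat * option nat -> Prop := lex ltQ ltO.

Lemma ltS_total : strict_total ltS.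
Proof. exact: strict_total_lex ltQ_total ltO_total. Qed.

(** An open initial segment whose last copy of [omega + 1] lost its top. *)
Definition block_set : set (rat * option nat) := [set b | ltS b (0%R, None)].

Definition block : Type := set_type block_set.

Definition ltY (x y : block) : Prop := ltS (val x) (val y).

Lemma ltY_total : strict_total ltY.
Proof.
have [irr tr tri] := ltS_total; rewrite /ltY; split=> [x|y x z|x y].
- exact: irr.
- exact: tr.
- by have [|[/val_inj|]] := tri (val x) (val y); [left|right; left|right; right].
Qed.

Lemma blockP (y : block) : ltS (val y) (0%R, None).
Proof. by case: y => y /= /set_mem. Qed.

Definition mk_block b (h : ltS b (0%R, None)) : block :=
  SigSub (mem_set (h : block_set b)).

(** The sequence of points that is cofinal in a block. *)
Definition block_tail (i : nat) : block :=
  @mk_block (0%R, Some i) (or_intror (conj erefl Logic.I)).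

Lemma block_tail_lt i j : (i < j)%N -> ltY (block_tail i) (block_tail j).
Proof. by move=> ij; right. Qed.

Lemma block_tail_adj i (y : block) :
  ltY (block_tail i) y -> ltY y (block_tail i.+1) -> False.
Proof.
case: y => -[q n] hy; rewrite /ltY /ltS /lex /ltQ /=.
move=> [h|[<- h]] [h'|[e h']].
- by move: (lt_trans h h'); rewrite ltxx.
- by move: h; rewrite e ltxx.
- by move: h'; rewrite ltxx.
- by case: n hy h h' => //= n _ h h'; move: (leq_trans h h'); rewrite ltnn.
Qed.

Lemma block_tail_cofinal (y : block) : exists i, ltY y (block_tail i).
Proof.
have : ltS (val y) (0%R, None) by exact: blockP.
rewrite /ltY /=; case: (val y) => q [n|] [h|[/= q0 h]] //.
- by exists 0%N; left.
- by exists n.+1; right; split=> //=.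
- by exists 0%N; left.
Qed.

Lemma block_no_least (y : block) : exists y', ltY y' y.
Proof.
have hy : ltS (val y) (0%R, None) by exact: blockP.
case e : (val y) => [q n]; rewrite e in hy.
have q0 : (q <= 0)%R by case: hy => [/ltW//|[/= -> _]].
have hy' : ltS ((q - 1)%R, n) (0%R, None) by left; rewrite /ltQ /=; lra.
by exists (mk_block hy'); rewrite /ltY e; left; rewrite /ltQ /=; lra.
Qed.

(** Immediate successors in [ltS] stay within a copy of [omega + 1]. *)
Lemma ltS_succ x y : ltS x y -> (forall z, ltS x z -> ltS z y -> False) ->
  exists n, x.2 = Some n /\ y = (x.1, Some n.+1).
Proof.
move: x y => [q m] [r n] [h|[/= <- h]] adj.
  exfalso; have [z qz zr] := ltQ_dense h.
  by apply: (adj (z, None)); left.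
case: m h adj => // m; case: n => [n|] /= h adj; exists m; split=> //.
  move: h; rewrite leq_eqVlt => /orP[/eqP<-//|h].
  by exfalso; apply: (adj (q, Some m.+1)); right; split=> //=.
by exfalso; apply: (adj (q, Some m.+1)); right; split=> //=.
Qed.

Lemma ltS_bij : exists (dec : nat -> rat * option nat) enc,
  cancel dec enc /\ cancel enc dec.
Proof.
apply: (@countable_infinite_bij _ (@pickle (rat * option nat)%type) (fun n => (0%R, Some n))).
  exact: (pcan_inj pickleK).
by move=> m n [].
Qed.

Lemma block_bij : exists (dec : nat -> nat * block) enc,
  cancel dec enc /\ cancel enc dec.
Proof.
apply: (@countable_infinite_bij _ (fun p => pickle (p.1, val p.2))
  (fun n => (n, block_tail 0))).
  by move=> [m y] [n z] /(pcan_inj pickleK)[-> /val_inj->].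
by move=> m n [].
Qed.

Section Blocks.
Context (K : lo_code).
Hypothesis loK : LO K.

(** The strict order of [K]. *)
Definition ltK (a b : nat) : Prop := K (a, b) && (a != b).

Lemma ltK_total : strict_total ltK.
Proof.
have [linK _] := loK; rewrite /ltK; split=> [x|y x z|x y].
- by rewrite eqxx andbF.
- move=> /andP[xy nxy] /andP[yz nyz]; rewrite (code_trans linK xy yz) /=.
  apply/eqP => e; move/eqP: nxy; apply; rewrite -e in yz.
  exact: (code_anti linK xy yz).
- have [->|ne] := eqVneq x y; first by right; left.
  have [h|h] := code_total linK (LO_refl x loK) (LO_refl y loK).
    by left; apply/andP.
  by right; right; apply/andP; split=> //; rewrite eq_sym.
Qed.

(** Every point of [K] is replaced by a copy of the block. *)
Definition ltKY : nat * block -> nat * block -> Prop := lex ltK ltY.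

Lemma ltKY_total : strict_total ltKY.
Proof. exact: strict_total_lex ltK_total ltY_total. Qed.

(** The blocks embed as disjoint convex sets in [ltS], since [K] times the
    rationals is isomorphic to the rationals. *)
Lemma blocks_embed : exists f : nat * block -> rat * option nat,
  (forall x y, ltKY x y -> ltS (f x) (f y)) /\
  forall x z y, x.1 = z.1 -> ~ ltS y (f x) -> ~ ltS (f z) y ->
    exists t, t.1 = x.1 /\ f t = y.
Proof.
have totL := strict_total_lex ltK_total ltQ_total.
have [||||||||||psi [psim psis]] := @cantor_iso _ _ (lex ltK ltQ) ltQ
    (@pickle (nat * rat)%type) (@pickle rat) _ _ totL ltQ_total.
- exact: (pcan_inj pickleK).
- exact: (pcan_inj pickleK).
- move=> [a q] [b r] [h|[/= <- h]].
    have [s qs] := ltQ_above q; exists (a, s); [by right|by left].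
  by have [s qs sr] := ltQ_dense h; exists (a, s); right.
- exact: ltQ_dense.
- by move=> [a q]; have [s qs] := ltQ_above q; exists (a, s); right.
- exact: ltQ_above.
- by move=> [a q]; have [s qs] := ltQ_below q; exists (a, s); right.
- exact: ltQ_below.
- by constructor; exact: (0%N, 0%R).
- by constructor; exact: 0%R.
have [irr _ _] := ltQ_total.
exists (fun p => (psi (p.1, (val p.2).1), (val p.2).2)); split.
  move=> [a x] [b y] [/= ab|/= [<- [xy|[e xy]]]].
  - by left; apply/psim; left.
  - by left; apply/psim; right.
  - by right; rewrite /= e.
move=> [a x] [b z] [r n] /= <- hx hz; have [[c s] cs] := psis r.
have [irrK trK triK] := ltK_total.
have ac : a = c.
  have [h|[//|h]] := triK a c; exfalso.
    by apply: hz; left; rewrite /= -cs; apply/psim; left.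
  by apply: hx; left; rewrite /= -cs; apply/psim; left.
subst c; have hy : ltS (s, n) (0%R, None).
  have [irrS trS triS] := ltS_total.
  have zy : ~ ltS (val z) (s, n).
    move=> [h|[/= e h]]; apply: hz; first by left; rewrite /= -cs; apply/psim; right.
    by right; rewrite /= e.
  have [h|[->|h]] := triS (s, n) (val z); first exact: trS h (blockP z).
    exact: blockP.
  by case: zy.
by exists (a, mk_block hy); rewrite /= cs.
Qed.

(** The first block contains a convex copy of [ltS]. *)
Lemma first_block_embed : exists f : rat * option nat -> nat * block,
  (forall x y, ltS x y -> ltKY (f x) (f y)) /\
  forall x z y, ~ ltKY y (f x) -> ~ ltKY (f z) y -> exists t, f t = y.
Proof.
pose T := set_type [set q : rat | ltQ q 0%R].
pose ltT (a b : T) := ltQ (val a) (val b).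
have totT : strict_total ltT.
  have [irr tr tri] := ltQ_total; split=> [x|y x z|x y]; [exact: irr|exact: tr|].
  by have [|[/val_inj|]] := tri (val x) (val y); [left|right; left|right; right].
have Tneg (t : T) : ltQ (val t) 0%R by case: t => t /= /set_mem.
have [||||||||||psi [psim psis]] := @cantor_iso _ _ ltQ ltT
    (@pickle rat) (fun t => pickle (val t)) _ _ ltQ_total totT.
- exact: (pcan_inj pickleK).
- by move=> a b /(pcan_inj pickleK)/val_inj.
- exact: ltQ_dense.
- move=> a b ab; have [q aq qb] := ltQ_dense ab.
  have q0 : ltQ q 0%R by case: ltQ_total => _ tr _; exact: tr qb (Tneg b).
  by exists (SigSub (mem_set (q0 : [set q : rat | ltQ q 0%R] _))).
- exact: ltQ_above.
- move=> a; have [q aq q0] := ltQ_dense (Tneg a).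
  by exists (SigSub (mem_set (q0 : [set q : rat | ltQ q 0%R] _))).
- exact: ltQ_below.
- move=> a; have [q aq] := ltQ_below (val a).
  have q0 : ltQ q 0%R by case: ltQ_total => _ tr _; exact: tr aq (Tneg a).
  by exists (SigSub (mem_set (q0 : [set q : rat | ltQ q 0%R] _))).
- by constructor; exact: 0%R.
- have q0 : ltQ (-1)%R 0%R by rewrite /ltQ; lra.
  by constructor; exact: (SigSub (mem_set (q0 : [set q : rat | ltQ q 0%R] _))).
have neg q n : ltS (val (psi q), n) (0%R, None) by left; exact: Tneg.
exists (fun p => (0%N, mk_block (neg p.1 p.2))); split.
  move=> [q m] [r n] [h|[/= <- h]]; right; split=> //=; [left|right] => //=.
  exact: ((psim q r).1 h).
have [irrK trK triK] := ltK_total.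
move=> [q m] [r n] [k y] hx hz.
have k0 : 0%N = k.
  have [h|[//|h]] := triK 0%N k; exfalso; [apply: hz|apply: hx]; by left.
subst k; have hs : ltQ (val y).1 0%R.
  have ny : ~ ltQ (val (psi r)) (val y).1.
    by move=> h; apply: hz; right; split=> //; left.
  have [_ tr tri] := ltQ_total; have [h|[->|//]] := tri (val y).1 (val (psi r)).
    exact: tr h (Tneg _).
  exact: Tneg.
have [s sE] := psis (SigSub (mem_set (hs : [set q : rat | ltQ q 0%R] _)) : T).
exists (s, (val y).2); congr (_, _); apply: val_inj => /=.
by rewrite sE /= -surjective_pairing.
Qed.

(** A convex piece of the sum of blocks whose image in [ltS] is convex meets only
    one block. Otherwise it contains the end of a block, an increasing sequence of
    consecutive points that the embedding sends to consecutive points of a copy of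
    [omega + 1]; the top of this copy comes from the least point above the sequence
    in the piece, but blocks have no least point. *)
Lemma piece_one_block (S : nat * block -> Prop) (f : nat * block -> rat * option nat) :
  (forall x y, ltKY x y -> ltS (f x) (f y)) ->
  (forall x y z, S x -> S z -> ~ ltKY y x -> ~ ltKY z y -> S y) ->
  (forall x z y, S x -> S z -> ~ ltS y (f x) -> ~ ltS (f z) y ->
    exists2 t, S t & f t = y) ->
  forall x z, S x -> S z -> ~ ltK x.1 z.1.
Proof.
move=> fm Sc fc [k y] [k' y'] /= Sx Sz kk'.
have fm' := strict_mono ltKY_total ltS_total fm.
have [irr tr tri] := ltKY_total; have [irrS trS triS] := ltS_total.
have [irrK trK triK] := ltK_total; have [irrY trY triY] := ltY_total.
have [i0 hi0] := block_tail_cofinal y.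
pose x i := (k, block_tail (i0 + i)).
have x_ge i : ltKY (k, y) (x i).
  right; split=> //; rewrite /x /=; case: i => [|i]; first by rewrite addn0.
  by apply: trY hi0 _; apply: block_tail_lt; rewrite addnS ltnS leq_addr.
have x_lt i : ltKY (x i) (k', y') by left.
have Sx' i : S (x i).
  apply: (Sc _ _ _ Sx Sz) => h.
    by apply: (irr (x i)); apply: tr h (x_ge i).
  by apply: (irr (x i)); apply: tr (x_lt i) h.
have xS i : ltKY (x i) (x i.+1).
  by right; split=> //; apply: block_tail_lt; rewrite addnS.
have adj i : exists n, (f (x i)).2 = Some n /\ f (x i.+1) = ((f (x i)).1, Some n.+1).
  apply: ltS_succ; first exact: fm.
  move=> z xz zx; have [||[m t] St tz] := fc (x i) (x i.+1) z (Sx' _) (Sx' _).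
  - by move=> h; apply: (irrS z); apply: trS h xz.
  - by move=> h; apply: (irrS z); apply: trS zx h.
  rewrite -tz in xz zx; move/fm': xz => xz; move/fm': zx => zx.
  case: xz => [/= km|/= [km xt]]; case: zx => [/= mk|/= [mk tx]].
  - by apply: (irrK k); apply: trK km mk.
  - by move: km; rewrite mk; apply: irrK.
  - by move: mk; rewrite km; apply: irrK.
  - by rewrite addnS in tx; apply: block_tail_adj xt tx.
have [a [fa _]] := adj 0%N; pose q := (f (x 0%N)).1.
have fx i : f (x i) = (q, Some (a + i)%N).
  elim: i => [|i IH]; first by rewrite addn0 /q -fa -surjective_pairing.
  by have [n [+ ->]] := adj i; rewrite IH /= => -[<-]; rewrite addnS.
(* a point of [ltS] above all the [f (x i)] is at least [(q, None)] *)
have sup b : (forall i, ltS (f (x i)) b) -> ~ ltS b (q, None).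
  case: b => [r n] h [h'|[/= e h']].
    have := trS _ _ _ (h 0%N) (or_introl h' : ltS (r, n) (q, Some (a + 0)%N)).
    by rewrite fx; apply: irrS.
  case: n h h' => // n h _; have := h n; rewrite fx => -[|[_ /=]].
    by rewrite /= e; case: ltQ_total => ir _ _; apply: ir.
  by rewrite ltnNge leq_addl.
have [||[m t] St tu] := fc (x 0%N) (k', y') (q, None) (Sx' _) Sz.
- rewrite fx => -[/=|[_ //]]; by case: ltQ_total => ir _ _; apply: ir.
- by apply: sup => i; apply/fm.
have xt i : ltKY (x i) (m, t) by apply/fm'; rewrite tu fx; right.
have km : ltK k m.
  have [j hj] := block_tail_cofinal t.
  have [//|[/= e tt]] := xt j.
  exfalso; apply: (irrY t); apply: (trY _ _ _ hj).
  have [i00|j0] := posnP i0; first by rewrite i00 add0n in tt.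
  by apply: trY tt; apply: block_tail_lt; rewrite -{1}[j]add0n ltn_add2r.
have [t' tt'] := block_no_least t.
apply: (sup (f (m, t'))) => [i|]; first by apply: fm; left.
by rewrite -tu; apply: fm; right.
Qed.

End Blocks.

(** * Hardness, completeness and lower bounds *)

Lemma pce_hard (R : realType) (C : set Lin) (Z : topologicalType)
    (chi : Z -> cantor) (A : set Z) :
  C one_Lin -> injective chi ->
  (forall x i, nbhs x [set x' | chi x' i = chi x i]) -> analytic R A ->
  exists g : Z -> LO * LO, [/\ continuous g, A = g @^-1` pce_LO C &
    A = g @^-1` bi_pce_LO C].
Proof.
move=> C1 chiI chib /(analytic_souslin chiI chib)[B [Q cQ hQ] hB].
pose g (z : Z) : LO * LO := (SigSub (mem_set (double_code_LO Q (chi z))),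
  SigSub (mem_set (tree_code_LO Q (chi z)))).
have gE z : A z <-> pce_LO C (g z).
  by rewrite hB hQ -(double_pce cQ _ C1).
exists g; split.
- apply: (bits_continuous LO2_bits_bits) => z i.
  have near (c : cantor -> lo_code) p : lc (fun w (_ : baire) => c w p) ->
      nbhs z [set z' | c (chi z') p = c (chi z) p].
    move=> /(_ (chi z) (fun=> 0%N))[n hn].
    by apply: filterS (nbhs_agree n (chib z)) => z' h; apply: hn.
  rewrite /LO2_bits /pair_bits /LO_bits /sub_bits /code_bits /=.
  case: (odd i); apply: near; [exact: tree_code_lc|exact: double_code_lc].
- by apply/seteqP; split=> z /gE.
- apply/seteqP; split=> z; last by move=> [/gE].
  by move=> /gE h; split=> //; exact: pce_double.
Qed.

(** The inclusion of [LO] into [Lin]. *)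
Definition LO_Lin (c : LO) : Lin := SigSub (mem_set (or_intror (set_valP c) : Lin (val c))).

Lemma LO_Lin_continuous : continuous LO_Lin.
Proof.
apply: (bits_continuous (sub_bits_bits Lin)) => z i.
by have [_ + _] := sub_bits_bits LO; apply.
Qed.

(** The infinite orders of [C] reduce to both relations. *)
Lemma class_reduction (C : set Lin) : C one_Lin -> downward_closed C ->
  exists g : LO -> LO * LO, [/\ continuous g,
    LO_Lin @^-1` C = g @^-1` pce_LO C & LO_Lin @^-1` C = g @^-1` bi_pce_LO C].
Proof.
move=> C1 down.
have [decS [encS [decSK encSK]]] := ltS_bij.
have [decY [encY [decYK encYK]]] := block_bij.
pose SL : LO := SigSub (mem_set (code_of_LO decSK ltS_total)).
pose AL (K : LO) : LO :=
  SigSub (mem_set (code_of_LO decYK (ltKY_total (set_valP K)))).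
have fwd K : C (LO_Lin K) -> pce_LO C (AL K, SL).
  move=> CK; have loK : LO (val K) by exact: set_valP.
  apply/(pce_code decYK encYK (ltKY_total loK) decSK encSK ltS_total).
  have [f [fm fc]] := blocks_embed loK.
  exists (LO_Lin K) => //; exists fst, f; split=> //.
  - by move=> x; apply: LO_refl.
  - by move=> k _; exists (k, block_tail 0).
  - move=> x y [/andP[]//|[-> _]]; exact: LO_refl.
have bwd K : pce_LO C (AL K, SL) -> C (LO_Lin K).
  have loK : LO (val K) by exact: set_valP.
  move=> /(pce_code decYK encYK (ltKY_total loK) decSK encSK ltS_total).
  move=> [J CJ [pi [f [h1 h2 h3 h4 h5]]]]; have linJ := LinP J.
  have [irr tr tri] := ltKY_total loK.
  have one k k' y y' : pi (k, y) = pi (k', y') -> ~ ltK (val K) k k'.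
    move=> e; apply: (@piece_one_block _ loK (fun x => pi x = pi (k, y)) f h4 _ _
      (k, y) (k', y') erefl (esym e)).
    + move=> x x' z <- xz x'x zx'.
      have le a b : ~ ltKY (val K) b a -> val J (pi a, pi b).
        by have [h|[->|//]] := tri a b => _; [exact: h3|exact: h1].
      apply: (code_anti linJ (m := pi x') (n := pi x)); last exact: le.
      by rewrite -xz; apply: le.
    + move=> x z y0 xe ze yx zy; have [|t [t1 t2]] := h5 x z y0 _ yx zy.
        by rewrite xe ze.
      by exists t; rewrite // t1.
  apply: (down (LO_Lin K) J) => //.
  pose y0 := block_tail 0.
  have fJ (x : dom (val (LO_Lin K))) : val J (pi (val x, y0), pi (val x, y0)).
    exact: h1.
  exists (fun x => exist _ (pi (val x, y0)) (fJ x)) => x x'; rewrite /ole /=.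
  have [irrK trK triK] := ltK_total loK.
  have le a b : val K (a, b) -> val J (pi (a, y0), pi (b, y0)).
    move=> ab; have [->|ne] := eqVneq a b; first exact: h1.
    by apply: h3; left; apply/andP.
  split; first exact: le.
  move=> xx'; have [linK _] := loK.
  have [//|h] := code_total linK (LO_refl (val x) loK) (LO_refl (val x') loK).
  have e := code_anti linJ xx' (le _ _ h).
  have [->|ne] := eqVneq (val x) (val x'); first exact: LO_refl.
  exfalso; apply: (one _ _ _ _ (esym e)); apply/andP; split=> //.
  by rewrite eq_sym.
have back K : pce_LO C (SL, AL K).
  have loK : LO (val K) by exact: set_valP.
  apply/(pce_code decSK encSK ltS_total decYK encYK (ltKY_total loK)).
  have [f [fm fc]] := first_block_embed loK.
  exists one_Lin => //; exists (fun=> 0%N), f; split=> //.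
  - by move=> k /eqP[->]; exists (0%R, None).
  - by move=> x z y _ h1 h2; have [t ty] := fc x z y h1 h2; exists t.
exists (fun K => (AL K, SL)); split.
- apply: (bits_continuous LO2_bits_bits) => K i.
  rewrite /LO2_bits /pair_bits /=; case: (odd i); first exact: filterS (filterT).
  have [_ /(_ K) nb _] := sub_bits_bits LO.
  pose m := natfst i./2; pose n := natsnd i./2.
  apply: filterS (nb (natpair (decY n).1 (decY m).1)) => K' /=.
  rewrite /LO_bits /sub_bits /code_bits natfstK natsndK => e.
  by rewrite /= !code_ofE /ltKY /lex /ltK e.
- by apply/seteqP; split=> K; [apply: fwd|apply: bwd].
- apply/seteqP; split=> K; last by move=> [/bwd].
  by move=> CK; split; [apply: fwd|apply: back].
Qed.

(** The code whose pairs are those numbered by [l]. *)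
Definition finite_code (l : seq nat) : lo_code :=
  fun p => natpair p.1 p.2 \in l.

Lemma finite_codeP c : Fin c -> exists l, c = finite_code l.
Proof.
move=> [lin /finite_set_natP[b hb]].
exists [seq natpair m n | m <- iota 0 b, n <- [seq n <- iota 0 b | c (m, n)]].
apply/funext => -[m n]; rewrite /finite_code; apply/idP/idP => [mn|].
  have [mm nn] := code_dom lin mn.
  apply/allpairsPdep; exists m, n; split=> //; rewrite ?mem_filter ?mn mem_iota add0n /=.
    exact: hb.
  exact: hb.
move=> /allpairsPdep[m' [n' [_]]]; rewrite mem_filter => /andP[mn' _] /= e.
have := congr1 natfst e; have := congr1 natsnd e; rewrite !natfstK !natsndK.
by move=> -> ->.
Qed.

(** Any set of codes of finite orders is countable, hence analytic. *)
Lemma souslin_fin (C : set Lin) :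
  souslin (@sub_bits Lin) [set x : Lin | C x /\ Fin (val x)].
Proof.
have -> : [set x : Lin | C x /\ Fin (val x)] = [set x : Lin | exists n,
    [set x : Lin | [/\ C x, Fin (val x) &
      val x = finite_code (CodeSeq.decode n)]] x].
  apply/seteqP; split=> [x [Cx fx]|x [n []]//].
  have [l hl] := finite_codeP fx; exists (CodeSeq.code l).
  by rewrite /= CodeSeq.codeK.
apply: souslin_ex => n.
have [[x [Cx fx xl]]|nx] := pselect (exists x : Lin, [/\ C x, Fin (val x) &
    val x = finite_code (CodeSeq.decode n)]); last first.
  exists (fun=> False); last by move=> x; split=> // hx; apply: nx; exists x.
  by apply: sigma11_clo => w /(_ 0%N)[].
exists (fun w => w = sub_bits x).
  apply: sigma11_clo => w h; apply/funext => i.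
  by have [w' ww' <-] := h i.+1; apply: ww'.
move=> y; split=> [[_ _ yl]|e].
  by congr sub_bits; apply: val_inj; rewrite yl xl.
by have [inj _ _] := sub_bits_bits Lin; rewrite (inj _ _ e).
Qed.

Section LowerBounds.
Context (R : realType) (C : set Lin).

(** The codes of finite orders do not matter for the analyticity of [C]. *)
Lemma souslin_of_LO : souslin LO_bits (LO_Lin @^-1` C) -> analytic R C.
Proof.
move=> sC; have [P [f [pP cf fE]]] : analytic R (LO_Lin @^-1` C).
  apply: souslin_analytic sC; first exact: sub_bits_bits.
  exact: sub_bits_range sigma11_LO.
have [inj bb _] := sub_bits_bits Lin.
have an : analytic R (range (LO_Lin \o f)).
  exists P, (LO_Lin \o f); split=> // p.
  by apply: continuous_comp; [exact: cf|exact: LO_Lin_continuous].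
suff sCL : souslin (@sub_bits Lin) C.
  exact: (@souslin_analytic R _ _ (sub_bits_bits Lin) (@sub_bits_range Lin sigma11_Lin) C sCL).
have -> : C = range (LO_Lin \o f) `|` [set x : Lin | C x /\ Fin (val x)].
  apply/seteqP; split=> [x Cx|x [[p _ <-]|[]//]]; last first.
    have : range f (f p) by exists p.
    by rewrite -fE.
  have [fx|lx] := set_valP x; first by right.
  have xE : x = LO_Lin (SigSub (mem_set lx)) by apply: val_inj.
  left; have : (LO_Lin @^-1` C) (SigSub (mem_set lx)) by rewrite /preimage /= -xE.
  by rewrite fE => -[p _ pE]; exists p => //; rewrite /= pE -xE.
exact: (souslinU (analytic_souslin inj bb an) (souslin_fin C)).
Qed.

Lemma not_analytic (D : set (LO * LO)) (g : LO -> LO * LO) : continuous g ->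
  LO_Lin @^-1` C = g @^-1` D -> ~ analytic R C -> ~ analytic R D.
Proof.
move=> cg e nC aD; apply: nC; apply: souslin_of_LO; rewrite e.
have [inj bb _] := LO2_bits_bits.
apply: (souslin_preimage (sub_bits_bits LO) LO2_bits_bits cg).
exact: (analytic_souslin inj bb aD).
Qed.

Lemma not_coanalytic (D : set (LO * LO)) :
  (forall A : set LO, analytic R A -> exists2 g, continuous g & A = g @^-1` D) ->
  proper_coanalytic R C -> ~ coanalytic R D.
Proof.
move=> hard [coC nC] coD.
have [inj bb _] := sub_bits_bits Lin.
have sC : souslin LO_bits (LO_Lin @^-1` (~` C)).
  apply: (souslin_preimage (sub_bits_bits LO) (sub_bits_bits Lin) LO_Lin_continuous).
  exact: (analytic_souslin inj bb coC).
have [|g cg gE] := hard (LO_Lin @^-1` (~` C)).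
  apply: souslin_analytic sC; first exact: sub_bits_bits.
  exact: sub_bits_range sigma11_LO.
apply: (not_analytic cg _ nC coD).
have gx x : (~` C) (LO_Lin x) = D (g x) := congr1 (fun A : set LO => A x) gE.
apply/seteqP; split=> x /= h; first by move=> Dg; rewrite -gx in Dg; apply: Dg.
by apply: contrapT => nCx; apply: h; rewrite -gx.
Qed.

End LowerBounds.

Theorem theorem6p3 (R : realType) (C : set Lin)
    (C_nonempty : C !=set0) (C_down : downward_closed C) :
  [/\ analytic_hard R (pce_LO C),
      analytic_hard R (bi_pce_LO C),
      borel C ->
        complete_analytic R (pce_LO C) /\ complete_analytic R (bi_pce_LO C) &
      proper_coanalytic R C -> ccs C ->
        [/\ ~ analytic R (pce_LO C), ~ coanalytic R (pce_LO C),
            ~ analytic R (bi_pce_LO C) & ~ coanalytic R (bi_pce_LO C)]].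
Proof.
have C1 := one_in C_nonempty C_down.
have hard1 : analytic_hard R (pce_LO C).
  move=> Z A pZ cZ aA; have [chi [chiI chib]] := polish_bits pZ cZ.
  by have [g [cg gE _]] := pce_hard C1 chiI chib aA; exists g.
have hard2 : analytic_hard R (bi_pce_LO C).
  move=> Z A pZ cZ aA; have [chi [chiI chib]] := polish_bits pZ cZ.
  by have [g [cg _ gE]] := pce_hard C1 chiI chib aA; exists g.
split=> // [bC|pC _].
  have sC := souslin_borel (sub_bits_bits Lin) bC.
  have an (D : set (LO * LO)) : souslin LO2_bits D -> analytic R D.
    by move=> sD; refine (@souslin_analytic R _ _ LO2_bits_bits LO2_bits_range D sD).
  by split; split=> //; apply: an; [exact: pce_souslin|exact: bi_pce_souslin].
have [chiI chib _] := sub_bits_bits LO.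
have [g [cg gE gE']] := class_reduction C1 C_down.
split.
- exact: (not_analytic cg gE pC.2).
- apply: not_coanalytic pC => A aA.
  by have [h [ch hE _]] := pce_hard C1 chiI chib aA; exists h.
- exact: (not_analytic cg gE' pC.2).
- apply: not_coanalytic pC => A aA.
  by have [h [ch _ hE]] := pce_hard C1 chiI chib aA; exists h.
Qed.
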